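(* Let $S\subset\mathbb{R}^m$ be a $1$-dimensional semialgebraic set. The following conditions are equivalent: (i) $\mathrm{r}_{\mathfrak B}(S)=1$; (ii) $\mathrm{r}_{\mathfrak B}(S)<+\infty$; (iii) $\mathrm{rs}_{\mathfrak B}(S)=1$; (iv) $\mathrm{rs}_{\mathfrak B}(S)<+\infty$; (v) $\mathrm{r}_{\mathfrak S}(S)=1$; (vi) $\mathrm{r}_{\mathfrak S}(S)<+\infty$; (vii) $\mathrm{rs}_{\mathfrak S}(S)=1$; (viii) $\mathrm{rs}_{\mathfrak S}(S)<+\infty$; (ix) $S$ is irreducible, compact and its Zariski closure $\operatorname{Cl}^{\rm zar}_{\mathbb{R}\mathbb{P}^m}(S)$ in $\mathbb{R}\mathbb{P}^m$ is a (real) rational curve.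
   Context: $\overline{\mathcal B}_n\subset\mathbb{R}^n$ is the closed unit ball centered at the origin and $\mathbb{S}^n\subset\mathbb{R}^{n+1}$ the unit sphere centered at the origin. For $T\subset\mathbb{R}^n$, a rational map $f=(f_1,\dots,f_m):\mathbb{R}^n\dashrightarrow\mathbb{R}^m$ is regular on $T$ if each $f_i=g_i/h_i$ with polynomials $g_i,h_i$ and $h_i$ has no zero on $T$; it is regulous on $T$ if it extends to a continuous function on $T$ and the complement of its set of poles meets $T$ in a dense subset of $T$. $S$ is a regular (resp. regulous) image of $T$ if $S=f(T)$ for some rational map regular (resp. regulous) on $T$. Define $\mathrm{r}_{\mathfrak B}(S)=\inf\{n\ge1: S \text{ is a regular image of } \overline{\mathcal B}_n\}$, $\mathrm{rs}_{\mathfrak B}(S)=\inf\{n\ge1: S \text{ is a regulous image of } \overline{\mathcal B}_n\}$, $\mathrm{r}_{\mathfrak S}(S)=\inf\{n\ge1: S \text{ is a regular image of } \mathbb{S}^n\}$, $\mathrm{rs}_{\mathfrak S}(S)=\inf\{n\ge1: S \text{ is a regulous image of } \mathbb{S}^n\}$, with $\inf\varnothing=+\infty$. A Nash function on an open semialgebraic set $U$ is an analytic function on $U$ satisfying a nontrivial polynomial equation $P(x,f(x))=0$; the ring $\mathcal N(S)$ of Nash functions on a semialgebraic set $S$ consists of functions on $S$ admitting a Nash extension to an open semialgebraic neighborhood of $S$. $S$ is called irreducible if $\mathcal N(S)$ is an integral domain. For a semialgebraic set $S$, $S_{(k)}$ denotes the set of points of $S$ at which $S$ has local dimension $k$. A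 real rational curve is a real projective irreducible curve $C$ such that $C_{(1)}$ is the image of $\mathbb{R}\mathbb{P}^1$ under a birational map. $\mathbb{R}^m$ is identified with $\{x_0=1\}\subset\mathbb{R}\mathbb{P}^m$. *)

(* Defs.v *)
From HB Require Import structures.
From mathcomp Require Import all_boot all_order all_algebra.
From mathcomp Require Import all_classical all_reals all_analysis.
From mathcomp Require Import (canonicals, coercions) mpoly.

Set Implicit Arguments.
Unset Strict Implicit.
Unset Printing Implicit Defensive.

Import Order.TTheory GRing.Theory Num.Theory.
Import numFieldNormedType.Exports.
Local Open Scope classical_set_scope.
Local Open Scope ring_scope.

Section Defs.
Variable R : realType.

Definition mpol (n : nat) := mpoly.mpoly n R.
Definition mev (n : nat) (p : mpol n) (x : 'rV[R]_n) : R :=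
  mpoly.meval (fun i => x ord0 i) p.

Definition is_homog (n d : nat) (p : mpol n) : Prop :=
  p \is @mpoly.ishomog1 n R d mpoly.mdeg.

Inductive saformula (n : nat) : Type :=
| SAPos of mpol n
| SAZero of mpol n
| SANot of saformula n
| SAAnd of saformula n & saformula n
| SAOr of saformula n & saformula n.

Fixpoint saeval (n : nat) (F : saformula n) (x : 'rV[R]_n) : Prop :=
  match F with
  | SAPos p => 0 < mev p x
  | SAZero p => mev p x = 0
  | SANot F => ~ saeval F x
  | SAAnd F G => saeval F x /\ saeval G x
  | SAOr F G => saeval F x \/ saeval G x
  end.

Definition semialgebraic (n : nat) (S : set 'rV[R]_n) : Prop :=
  exists F : saformula n, S = [set x | saeval F x].

(* ---------- Dimension (= dimension of the Zariski closure = maximal number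
   of coordinate functions that are algebraically independent on S) *)
Definition coord_indep (n k : nat) (j : 'I_k -> 'I_n) (S : set 'rV[R]_n) : Prop :=
  forall p : mpol k, p != 0 ->
    exists x, S x /\ mev p (\row_(l < k) x ord0 (j l)) != 0.

Definition has_dim (n : nat) (S : set 'rV[R]_n) (k : nat) : Prop :=
  (exists j : 'I_k -> 'I_n, injective j /\ coord_indep j S) /\
  (forall (k' : nat) (j : 'I_k' -> 'I_n), injective j -> coord_indep j S ->
     (k' <= k)%N).

Definition local_dim (n : nat) (S : set 'rV[R]_n) (a : 'rV[R]_n) (k : nat) : Prop :=
  exists2 e0 : R, 0 < e0 &
    forall e : R, 0 < e -> e <= e0 -> has_dim (S `&` ball a e) k.

Definition sqnorm (n : nat) (x : 'rV[R]_n) : R := \sum_(i < n) x ord0 i ^+ 2.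
Definition closed_ball1 (n : nat) : set 'rV[R]_n := [set x | sqnorm x <= 1].
Definition sphere1 (n : nat) : set 'rV[R]_n.+1 := [set x | sqnorm x = 1].

Definition rat_eval (n m : nat) (g h : 'I_m -> mpol n) (x : 'rV[R]_n) : 'rV[R]_m :=
  \row_(i < m) (mev (g i) x / mev (h i) x).

Definition regular_image (n m : nat) (S : set 'rV[R]_m) (T : set 'rV[R]_n) : Prop :=
  exists g h : 'I_m -> mpol n,
    (forall i, h i != 0) /\
    (forall i x, T x -> mev (h i) x != 0) /\
    S = rat_eval g h @` T.

(* the complement of the poles of f = g/h contains the points where all h_i
   are nonzero; f is regulous on T if these points are dense in T and f
   extends continuously (by F) to T *)
Definition regulous_image (n m : nat) (S : set 'rV[R]_m) (T : set 'rV[R]_n) : Prop :=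
  exists (g h : 'I_m -> mpol n) (F : 'rV[R]_n -> 'rV[R]_m),
    (forall i, h i != 0) /\
    let D := [set x | T x /\ forall i, mev (h i) x != 0] in
    T `<=` closure D /\
    {within T, continuous F} /\
    (forall x, D x -> F x = rat_eval g h x) /\
    S = F @` T.

Definition inf_eq (P : nat -> Prop) (k : nat) : Prop :=
  (1 <= k)%N /\ P k /\ forall n, (1 <= n)%N -> P n -> (k <= n)%N.
Definition inf_finite (P : nat -> Prop) : Prop :=
  exists n, (1 <= n)%N /\ P n.

Definition rB_set (m : nat) (S : set 'rV[R]_m) : nat -> Prop :=
  fun n => regular_image S (@closed_ball1 n).
Definition rsB_set (m : nat) (S : set 'rV[R]_m) : nat -> Prop :=
  fun n => regulous_image S (@closed_ball1 n).
Definition rS_set (m : nat) (S : set 'rV[R]_m) : nat -> Prop :=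
  fun n => regular_image S (@sphere1 n).
Definition rsS_set (m : nat) (S : set 'rV[R]_m) : nat -> Prop :=
  fun n => regulous_image S (@sphere1 n).

(* real analytic on an open set U: locally the sum of an absolutely
   convergent power series (cube-ordered partial sums) *)
Definition pow_psum (n : nat) (c : ('I_n -> nat) -> R) (a y : 'rV[R]_n) (N : nat) : R :=
  \sum_(al : {ffun 'I_n -> 'I_N.+1})
     c (fun i => nat_of_ord (al i)) *
     \prod_(i < n) (y ord0 i - a ord0 i) ^+ (al i).

Definition abs_psum (n : nat) (c : ('I_n -> nat) -> R) (a y : 'rV[R]_n) (N : nat) : R :=
  \sum_(al : {ffun 'I_n -> 'I_N.+1})
     `|c (fun i => nat_of_ord (al i))| *
     \prod_(i < n) `|y ord0 i - a ord0 i| ^+ (al i).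

Definition analytic_on (n : nat) (U : set 'rV[R]_n) (f : 'rV[R]_n -> R) : Prop :=
  forall a, U a -> exists2 r : R, 0 < r &
    exists c : ('I_n -> nat) -> R, forall y, ball a r y ->
      (exists M : R, forall N, abs_psum c a y N <= M) /\
      (pow_psum c a y @ \oo --> f y).

Definition nash_on_open (n : nat) (U : set 'rV[R]_n) (f : 'rV[R]_n -> R) : Prop :=
  analytic_on U f /\
  exists P : {poly mpol n}, P != 0 /\
    forall x, U x -> (map_poly (fun q => mev q x) P).[f x] = 0.

Definition nash_on (n : nat) (S : set 'rV[R]_n) (f : 'rV[R]_n -> R) : Prop :=
  exists U : set 'rV[R]_n, open U /\ semialgebraic U /\ S `<=` U /\
    exists g, nash_on_open U g /\ forall x, S x -> g x = f x.

(* N(S) is an integral domain (nonzero ring without zero divisors;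
   elements of N(S) are functions on S, i.e. compared on S) *)
Definition sa_irreducible (n : nat) (S : set 'rV[R]_n) : Prop :=
  S !=set0 /\
  forall f g, nash_on S f -> nash_on S g ->
    (forall x, S x -> f x * g x = 0) ->
    (forall x, S x -> f x = 0) \/ (forall x, S x -> g x = 0).

(* R^m is identified with {x_0 = 1} in RP^m; a point of RP^m is represented
   by a nonzero vector of R^{m+1} (sets below are unions of lines minus 0) *)
Definition hlift (m : nat) (x : 'rV[R]_m) : 'rV[R]_m.+1 :=
  \row_(i < m.+1) (if unlift ord0 i is Some j then x ord0 j else 1).

Definition proj_zar_closure (m : nat) (S : set 'rV[R]_m) : set 'rV[R]_m.+1 :=
  [set v | v != 0 /\
     forall (d : nat) (P : mpol m.+1), is_homog d P ->
       (forall x, S x -> mev P (hlift x) = 0) -> mev P v = 0].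

Definition dehom (m : nat) (i : 'I_m.+1) (v : 'rV[R]_m.+1) : 'rV[R]_m :=
  \row_(j < m) (v ord0 (lift i j) / v ord0 i).
Definition chart (m : nat) (i : 'I_m.+1) (C : set 'rV[R]_m.+1) : set 'rV[R]_m :=
  dehom i @` [set w | C w /\ w ord0 i != 0].

Definition proj_local_part (m : nat) (C : set 'rV[R]_m.+1) (k : nat) :
  set 'rV[R]_m.+1 :=
  [set v | C v /\ exists i, v ord0 i != 0 /\ local_dim (chart i C) (dehom i v) k].

Definition proj_irreducible (m : nat) (C : set 'rV[R]_m.+1) : Prop :=
  C !=set0 /\
  forall (d e : nat) (P Q : mpol m.+1), is_homog d P -> is_homog e Q ->
    (forall v, C v -> mev P v * mev Q v = 0) ->
    (forall v, C v -> mev P v = 0) \/ (forall v, C v -> mev Q v = 0).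

(* projective dimension k <-> affine cone of dimension k+1 *)
Definition proj_dim (m : nat) (C : set 'rV[R]_m.+1) (k : nat) : Prop :=
  has_dim C k.+1.

Definition hev (m : nat) (phi : 'I_m.+1 -> mpol 2) (t : 'rV[R]_2) : 'rV[R]_m.+1 :=
  \row_(i < m.+1) mev (phi i) t.

(* C_(1) is the image of RP^1 under a birational map phi : RP^1 --> C.
   phi = (phi_0 : ... : phi_m), forms of a common degree with no common
   nontrivial real zero (so phi is defined on all of RP^1);
   psi = (psi_0 : psi_1) is a rational inverse: psi o phi = id. *)
Definition real_rational_curve (m : nat) (C : set 'rV[R]_m.+1) : Prop :=
  proj_irreducible C /\ proj_dim C 1 /\
  exists (d : nat) (phi : 'I_m.+1 -> mpol 2),
    (forall i, is_homog d (phi i)) /\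
    (forall t : 'rV[R]_2, t != 0 -> hev phi t != 0) /\
    (forall t : 'rV[R]_2, t != 0 -> proj_local_part C 1 (hev phi t)) /\
    (forall v, proj_local_part C 1 v ->
       exists2 t : 'rV[R]_2, t != 0 & exists lam : R, v = lam *: hev phi t) /\
    exists (e : nat) (psi0 psi1 : mpol m.+1),
      is_homog e psi0 /\ is_homog e psi1 /\
      (exists t : 'rV[R]_2,
         mev psi0 (hev phi t) != 0 \/ mev psi1 (hev phi t) != 0) /\
      (forall t : 'rV[R]_2,
         mev psi0 (hev phi t) * t ord0 1 = mev psi1 (hev phi t) * t ord0 0).

End Defs.

(* Main.v *)
(* A regulous map restricted to circles of the sphere is rational. Hence a regulous image S of a sphere is compact
   and has a dense subset any two points of which are joined, inside S, by a rational curve without real poles. A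
   function analytic along such a curve is zero on it or has isolated zeros there, so S is irreducible. As S has
   dimension 1, one of these curves is Zariski dense in S, and Lueroth's theorem makes it a birational
   parametrization of the Zariski closure.

   Conversely, let phi : RP^1 -> C be the parametrization. An irreducible S has no isolated point, so S is the image
   of J = phi^-1(S). Place a direction outside J at infinity, with T the affine parameter, and let c be a conductor:
   c p(T) is regular on S for every polynomial p. If t0 is not in J, there is a polynomial sigma in T, of the sign of
   T - t0 on J, with sigma^2 = 1 modulo c. Then sigma^2 and c sigma are regular on S, so c (|sigma| - sigma) and
   c (|sigma| + sigma) are Nash functions with product zero. Hence J lies on one side of t0, up to the zeros of c: it
   is an interval up to finitely many points, and S is the image of that interval. *)

Require Import Defs.
From HB Require Import structures.
From mathcomp Require Import all_boot all_order all_algebra.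
From mathcomp Require Import all_classical all_reals all_analysis.
From mathcomp Require Import (canonicals, coercions) mpoly.
From mathcomp Require Import ring lra zify.

Set Implicit Arguments.
Unset Strict Implicit.
Unset Printing Implicit Defensive.

Import Order.TTheory GRing.Theory Num.Theory.
Import numFieldNormedType.Exports.
Local Open Scope classical_set_scope.
Local Open Scope ring_scope.

(** * Polynomial functions and forms *)

Section PolyFun.
Variable R : realType.

(** The obstacle in the converse is that a function of the parameter need not descend to [S]:
    several parameters may have the same image. [c sigma] descends because of the conductor,
    [sigma^2 = 1 + c q] does too, and [|sigma|] is the square root of a positive function and hence
    Nash, although [sigma] itself may not be a function on [S]. The polynomial [sigma] comes from
    Chinese remaindering: it is 1 modulo the factor of the conductor with roots to the right of [t0]
    and -1 modulo the other one; a large multiple of its square times [T - t0] then forces the sign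
    on the compact set [J]. Descending means being polynomial on [S] after multiplication by a power
    of [E], a polynomial positive on [S] that vanishes only at the omitted direction.

    In the other direction, Lueroth's generator is a quotient of two forms in the coordinates of the
    curve. These two forms are the inverse map, and the coordinates written in terms of the
    generator are the parametrization. That the parametrization fills the whole one-dimensional part
    is a matter of compactness: its image is closed, and off the image both forms vanish, which
    leaves only points of local dimension 0. *)

Lemma mevE n (p : mpol R n) x :
  mev p x = \sum_(m <- mpoly.msupp p) mpoly.mcoeff m p * \prod_(i < n) x ord0 i ^+ (m i).
Proof. exact: mpoly.mevalE. Qed.

(** An induction principle for polynomial expressions. It serves for polynomial, homogenizable,
    continuous, algebraic and rational functions alike, so that substitution into a polynomial is
    treated once for all. *)
Lemma mev_closed (X : Type) (P : (X -> R) -> Prop)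
    (Pc : forall c, P (fun=> c))
    (PD : forall f g, P f -> P g -> P (fun x => f x + g x))
    (PM : forall f g, P f -> P g -> P (fun x => f x * g x))
    n (Q : mpol R n) (w : X -> 'rV[R]_n) :
  (forall i, P (fun x => w x ord0 i)) -> P (fun x => mev Q (w x)).
Proof.
move=> Pw; under eq_fun do rewrite mevE.
elim: (mpoly.msupp Q) => [|m s IHs].
  by under eq_fun do rewrite big_nil; exact: Pc.
under eq_fun do rewrite big_cons; apply: (PD) => //; apply: (PM); first exact: Pc.
elim: (index_enum _) => [|i r IHr].
  by under eq_fun do rewrite big_nil; exact: Pc.
under eq_fun do rewrite big_cons; apply: (PM) => //.
elim: (m i) => [|k IHk]; first by under eq_fun do rewrite expr0; exact: Pc.
by under eq_fun do rewrite exprS; exact: PM.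
Qed.

Definition polyfun n (f : 'rV[R]_n -> R) := exists Q : mpol R n, forall x, mev Q x = f x.

Lemma polyfun_mev n (Q : mpol R n) : polyfun (mev Q). Proof. by exists Q. Qed.

Lemma polyfun_cst n c : polyfun (fun _ : 'rV[R]_n => c).
Proof. by exists (@mpoly.mpolyC n R c) => x; rewrite /mev mpoly.mevalC. Qed.

Lemma polyfun_coord n i : polyfun (fun x : 'rV[R]_n => x ord0 i).
Proof. by exists (mpoly.mpolyX R (mpoly.mnm1 i)) => x; rewrite /mev mpoly.mevalXU. Qed.

Lemma polyfunD n (f g : 'rV[R]_n -> R) :
  polyfun f -> polyfun g -> polyfun (fun x => f x + g x).
Proof. by move=> [P PE] [Q QE]; exists (P + Q) => x; rewrite -PE -QE /mev mpoly.mevalD. Qed.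

Lemma polyfunM n (f g : 'rV[R]_n -> R) :
  polyfun f -> polyfun g -> polyfun (fun x => f x * g x).
Proof. by move=> [P PE] [Q QE]; exists (P * Q) => x; rewrite -PE -QE /mev mpoly.mevalM. Qed.

Lemma polyfunN n (f : 'rV[R]_n -> R) : polyfun f -> polyfun (fun x => - f x).
Proof. by move=> [P PE]; exists (- P) => x; rewrite -PE /mev mpoly.mevalN. Qed.

Lemma polyfunB n (f g : 'rV[R]_n -> R) :
  polyfun f -> polyfun g -> polyfun (fun x => f x - g x).
Proof. by move=> Pf Pg; apply: polyfunD => //; exact: polyfunN. Qed.

Lemma polyfunX n (f : 'rV[R]_n -> R) k : polyfun f -> polyfun (fun x => f x ^+ k).
Proof.
move=> Pf; elim: k => [|k IHk]; first by under eq_fun do rewrite expr0; exact: polyfun_cst.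
by under eq_fun do rewrite exprS; exact: polyfunM.
Qed.

Lemma polyfun_sum n (I : Type) (r : seq I) (P : pred I) (f : I -> 'rV[R]_n -> R) :
  (forall i, polyfun (f i)) -> polyfun (fun x => \sum_(i <- r | P i) f i x).
Proof.
move=> Pf; elim: r => [|i r IHr]; first by under eq_fun do rewrite big_nil; exact: polyfun_cst.
by under eq_fun do rewrite big_cons; case: (P i) => //; exact: polyfunD.
Qed.

Lemma polyfun_comp n k (f : 'rV[R]_k -> R) (w : 'rV[R]_n -> 'rV[R]_k) :
  polyfun f -> (forall i, polyfun (fun x => w x ord0 i)) -> polyfun (fun x => f (w x)).
Proof.
move=> [Q QE] Pw; under eq_fun do rewrite -QE.
by apply: (mev_closed (P := @polyfun n)) => //; [exact: polyfun_cst|exact: polyfunD|exact: polyfunM].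
Qed.

Lemma mev_poly1 k (Q : mpol R k) (N : 'I_k -> {poly R}) :
  exists G : {poly R}, forall t, G.[t] = mev Q (\row_i (N i).[t]).
Proof.
apply: (mev_closed (P := fun f : R -> R => exists G : {poly R}, forall t, G.[t] = f t)).
- by move=> c; exists c%:P => t; rewrite hornerC.
- by move=> f g [P PE] [G GE]; exists (P + G) => t; rewrite hornerD PE GE.
- by move=> f g [P PE] [G GE]; exists (P * G) => t; rewrite hornerM PE GE.
- by move=> i; exists (N i) => t; rewrite mxE.
Qed.

Lemma poly_inf0 (p : {poly R}) (A : set R) :
  infinite_set A -> (forall t, A t -> p.[t] = 0) -> p = 0.
Proof.
move=> iA pA; apply/eqP/negPn/negP => p0.
have [B BA sB] := infinite_set_fset (size p) iA.
have := max_poly_roots p0 (rs := finmap.enum_fset B).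
rewrite ltnNge sB => H; suff : false by [].
apply: H; last exact: finmap.fset_uniq.
by apply/allP => t tB; apply/rootP/pA/BA.
Qed.

Lemma finite_roots (p : {poly R}) : p != 0 -> finite_set [set t | p.[t] = 0].
Proof. by move=> p0; apply: contrapT => /poly_inf0/(_ (fun t H => H))/eqP; exact/negP. Qed.

Definition formfun n d (f : 'rV[R]_n -> R) :=
  exists P : mpol R n, is_homog d P /\ forall x, mev P x = f x.

Lemma formfun_mev n d (P : mpol R n) : is_homog d P -> formfun d (mev P).
Proof. by exists P. Qed.

Lemma formfun_polyfun n d (f : 'rV[R]_n -> R) : formfun d f -> polyfun f.
Proof. by move=> [P [_ PE]]; exists P. Qed.

Lemma formfun_cst n c : formfun 0 (fun _ : 'rV[R]_n => c).
Proof.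
exists (@mpoly.mpolyC n R c); split; last by move=> x; rewrite /mev mpoly.mevalC.
have -> : @mpoly.mpolyC n R c = c *: 1 by rewrite -mpoly.mul_mpolyC mulr1.
by apply: mpoly.dhomogZ; apply: mpoly.dhomog1.
Qed.

Lemma formfun_coord n i : formfun 1 (fun x : 'rV[R]_n => x ord0 i).
Proof.
exists (mpoly.mpolyX R (mpoly.mnm1 i)); split; last by move=> x; rewrite /mev mpoly.mevalXU.
by rewrite /is_homog mpoly.dhomogX; apply/eqP; exact: mpoly.mdeg1.
Qed.

Lemma formfun0 n d : formfun d (fun _ : 'rV[R]_n => 0).
Proof.
exists 0; split; last by move=> x; rewrite /mev mpoly.meval0.
exact: mpoly.dhomog0.
Qed.

Lemma formfunD n d (f g : 'rV[R]_n -> R) :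
  formfun d f -> formfun d g -> formfun d (fun x => f x + g x).
Proof.
move=> [P [hP PE]] [Q [hQ QE]]; exists (P + Q); split.
  exact: mpoly.dhomogD.
by move=> x; rewrite -PE -QE /mev mpoly.mevalD.
Qed.

Lemma formfunM n d e (f g : 'rV[R]_n -> R) :
  formfun d f -> formfun e g -> formfun (d + e) (fun x => f x * g x).
Proof.
move=> [P [hP PE]] [Q [hQ QE]]; exists (P * Q); split.
  exact: mpoly.dhomogM.
by move=> x; rewrite -PE -QE /mev mpoly.mevalM.
Qed.

Lemma formfunZ n d c (f : 'rV[R]_n -> R) : formfun d f -> formfun d (fun x => c * f x).
Proof. by move=> hf; rewrite -[d]add0n; apply: formfunM => //; exact: formfun_cst. Qed.

Lemma formfunB n d (f g : 'rV[R]_n -> R) :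
  formfun d f -> formfun d g -> formfun d (fun x => f x - g x).
Proof.
move=> hf hg; apply: formfunD => //.
by under eq_fun do rewrite -mulN1r; exact: formfunZ.
Qed.

Lemma formfunX n d k (f : 'rV[R]_n -> R) : formfun d f -> formfun (d * k) (fun x => f x ^+ k).
Proof.
move=> hf; elim: k => [|k IHk].
  by rewrite muln0; under eq_fun do rewrite expr0; exact: formfun_cst.
by rewrite mulnS; under eq_fun do rewrite exprS; exact: formfunM.
Qed.

Lemma formfun_sum n d (I : eqType) (r : seq I) (f : I -> 'rV[R]_n -> R) :
  (forall i, i \in r -> formfun d (f i)) -> formfun d (fun x => \sum_(i <- r) f i x).
Proof.
elim: r => [|i r IHr] hf; first by under eq_fun do rewrite big_nil; exact: formfun0.
under eq_fun do rewrite big_cons; apply: formfunD; first by apply: hf; rewrite mem_head.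
by apply: IHr => j jr; apply: hf; rewrite in_cons jr orbT.
Qed.

Lemma formfun_prod n (I : Type) (r : seq I) (d : I -> nat) (f : I -> 'rV[R]_n -> R) :
  (forall i, formfun (d i) (f i)) ->
  formfun (\sum_(i <- r) d i)%N (fun x => \prod_(i <- r) f i x).
Proof.
move=> hf; elim: r => [|i r IHr].
  rewrite big_nil (_ : (fun x => _) = (fun=> 1)); first exact: formfun_cst.
  by apply/funext => x; rewrite big_nil.
rewrite big_cons (_ : (fun x => _) = (fun x => f i x * \prod_(j <- r) f j x)).
  exact: formfunM.
by apply/funext => x; rewrite big_cons.
Qed.

Lemma formfun_comp n k d e (f : 'rV[R]_k -> R) (w : 'rV[R]_n -> 'rV[R]_k) :
  formfun e f -> (forall i, formfun d (fun x => w x ord0 i)) ->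
  formfun (d * e) (fun x => f (w x)).
Proof.
move=> [Q [hQ QE]] hw; under eq_fun do rewrite -QE mevE.
apply: formfun_sum => m mQ; apply: formfunZ.
have <- : mpoly.mdeg m = e by move/mpoly.dhomogP: hQ; apply.
rewrite mpoly.mdegE big_distrr /=.
by apply: formfun_prod => i; exact: formfunX.
Qed.

Lemma formfun_scale n d (f : 'rV[R]_n -> R) lam x :
  formfun d f -> f (lam *: x) = lam ^+ d * f x.
Proof.
move=> [Q [hQ QE]]; rewrite -!QE !mevE big_distrr /=.
rewrite !big_seq; apply: eq_bigr => m mQ.
have <- : mpoly.mdeg m = d by move/mpoly.dhomogP: hQ; apply.
rewrite mulrCA; congr (_ * _); rewrite mpoly.mdegE -prodrXr -big_split /=.
by apply: eq_bigr => i _; rewrite mxE exprMn.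
Qed.

Lemma homogenize m (f : 'rV[R]_m -> R) : polyfun f ->
  exists d g, formfun d g /\ forall v : 'rV[R]_m.+1,
    v ord0 ord0 != 0 -> g v = v ord0 ord0 ^+ d * f (dehom ord0 v).
Proof.
(* Forms are asked for in every degree from some [d0] on, so that two summands can be brought to a
   common degree. *)
pose P (f : 'rV[R]_m -> R) := exists d0, forall d, (d0 <= d)%N -> exists g, formfun d g /\
  forall v : 'rV[R]_m.+1, v ord0 ord0 != 0 -> g v = v ord0 ord0 ^+ d * f (dehom ord0 v).
suff PQ Q : P (mev Q).
  move=> [Q QE]; have [d0 /(_ d0 (leqnn _)) [g [hg gE]]] := PQ Q.
  by exists d0, g; split=> // v v0; rewrite gE // QE.
apply: (@mev_closed _ P _ _ _ _ Q id).
- move=> c; exists 0%N => d _; exists (fun v => v ord0 ord0 ^+ d * c); split=> //.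
  rewrite -[d]addn0; apply: formfunM; last exact: formfun_cst.
  by rewrite addn0 -[X in formfun X]mul1n; apply: formfunX; exact: formfun_coord.
- move=> {}f g [d0 hf] [e0 hg]; exists (maxn d0 e0) => d; rewrite geq_max => /andP[d0d e0d].
  have [f' [hf' fE]] := hf d d0d; have [g' [hg' gE]] := hg d e0d.
  exists (fun v => f' v + g' v); split; first exact: formfunD.
  by move=> v v0; rewrite fE // gE // mulrDr.
- move=> {}f g [d0 hf] [e0 hg]; exists (d0 + e0)%N => d ded.
  have [f' [hf' fE]] := hf d0 (leqnn _).
  have [|g' [hg' gE]] := hg (d - d0)%N; first by rewrite leq_subRL // (leq_trans (leq_addr _ _) ded).
  have dE : d = (d0 + (d - d0))%N by rewrite subnKC // (leq_trans (leq_addr _ _) ded).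
  exists (fun v => f' v * g' v); split; first by rewrite dE; exact: formfunM.
  by move=> v v0; rewrite fE // gE // [in RHS]dE exprD mulrACA.
- move=> i; exists 1%N => -[//|d] _.
  exists (fun v => v ord0 ord0 ^+ d * v ord0 (lift ord0 i)); split.
    rewrite -[X in formfun X]addn1; apply: formfunM; last exact: formfun_coord.
    by rewrite -[X in formfun X]mul1n; apply: formfunX; exact: formfun_coord.
  by move=> v v0; rewrite mxE exprSr -mulrA; congr (_ * _); rewrite mulrC divfK.
Qed.

Lemma hlift0 m (x : 'rV[R]_m) : hlift x ord0 ord0 = 1.
Proof. by rewrite mxE unlift_none. Qed.

Lemma hliftS m (x : 'rV[R]_m) j : hlift x ord0 (lift ord0 j) = x ord0 j.
Proof. by rewrite mxE liftK. Qed.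

Lemma hlift_neq0 m (x : 'rV[R]_m) : hlift x != 0.
Proof.
by apply/eqP => /rowP/(_ ord0); rewrite hlift0 mxE => /eqP; rewrite oner_eq0.
Qed.

Lemma dehom_hlift m (x : 'rV[R]_m) : dehom ord0 (hlift x) = x.
Proof. by apply/rowP => j; rewrite mxE hlift0 hliftS divr1. Qed.

Lemma hlift_dehom m (v : 'rV[R]_m.+1) :
  v ord0 ord0 != 0 -> v = v ord0 ord0 *: hlift (dehom ord0 v).
Proof.
move=> v0; apply/rowP => i; rewrite mxE; case: (unliftP ord0 i) => [j|] ->.
  by rewrite hliftS mxE mulrC divfK.
by rewrite hlift0 mulr1.
Qed.

Lemma polyfun_hlift m (f : 'rV[R]_m.+1 -> R) :
  polyfun f -> polyfun (fun x : 'rV[R]_m => f (hlift x)).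
Proof.
move=> Pf; apply: polyfun_comp => // i.
by case: (unliftP ord0 i) => [j|] ->;
   [under eq_fun do rewrite hliftS; exact: polyfun_coord
   |under eq_fun do rewrite hlift0; exact: polyfun_cst].
Qed.

End PolyFun.

(** * Gauss's lemma and Lueroth's theorem *)

Section Gauss.
Variable F : fieldType.
Implicit Types (l g : {poly F}) (M Q : {poly {poly F}}).

(** Induction through gcds. Let [g] be the gcd of [l] and the leading coefficient of [M]. If [g] is
    constant, [l] divides the leading coefficient of [Q], and that term of [Q] is dropped. Otherwise
    [M] loses its leading term modulo [g], so [g] divides [Q] by induction, and [l] and [Q] are both
    divided by [g]. *)
Lemma gauss_dvd l M Q : l != 0 ->
  (forall g, g %| l -> (forall i, g %| M`_i) -> size g = 1%N) ->
  (forall i, l %| (M * Q)`_i) -> forall i, l %| Q`_i.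
Proof.
have [n] := ubnP (size l + size M + size Q)%N.
elim: n l M Q => // n IHn l M Q; rewrite ltnS => le_n l0 prM lMQ.
have [->|Q0] := eqVneq Q 0; first by move=> i; rewrite coef0 dvdp0.
have [M0|M0] := eqVneq M 0.
  have l1 : size l = 1%N by apply: prM => // i; rewrite M0 coef0 dvdp0.
  by move=> i; apply: (@dvdp_trans _ 1); rewrite ?dvd1p // dvdp1 l1.
pose m := lead_coef M; pose g := gcdp l m.
have gl : g %| l by exact: dvdp_gcdl.
have gm : g %| m by exact: dvdp_gcdr.
have g0 : g != 0 by rewrite gcdp_eq0 negb_and l0.
have lMQle : l %| m * lead_coef Q by rewrite -lead_coefM lead_coefE lMQ.
have [g1|g1] := eqVneq (size g) 1%N.
  have lQ : l %| lead_coef Q by rewrite -(@Gauss_dvdpr _ _ m) // coprimep_def g1.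
  pose Q' := Q - (lead_coef Q)%:P * 'X^((size Q).-1).
  have sQ' : (size Q' < size Q)%N.
    rewrite [X in (_ < X)%N](polySpred Q0) ltnS.
    apply/leq_sizeP => j; rewrite leq_eqVlt => /predU1P[<-|jQ].
      by rewrite coefB coefCM coefXn eqxx mulr1 lead_coefE subrr.
    rewrite coefB coefCM coefXn gtn_eqF // mulr0 subr0 nth_default //.
    by rewrite (polySpred Q0).
  have lMQ' i : l %| (M * Q')`_i.
    rewrite mulrBr coefB dvdp_subr //.
    by rewrite mulrCA coefCM dvdp_mulr.
  have lQ' : forall i, l %| Q'`_i.
    by apply: (IHn l M Q') => //; apply: leq_trans le_n; rewrite ltn_add2l.
  by move=> i; have := lQ' i; rewrite coefB coefCM dvdp_subl // dvdp_mulr.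
pose M' := M - m%:P * 'X^((size M).-1).
have sM' : (size M' < size M)%N.
  rewrite [X in (_ < X)%N](polySpred M0) ltnS.
  apply/leq_sizeP => j; rewrite leq_eqVlt => /predU1P[<-|jQ].
    by rewrite coefB coefCM coefXn eqxx mulr1 /m lead_coefE subrr.
  rewrite coefB coefCM coefXn gtn_eqF // mulr0 subr0 nth_default //.
  by rewrite (polySpred M0).
have M'M d i : d %| g -> (d %| M'`_i) = (d %| M`_i).
  by move=> dg; rewrite coefB coefCM dvdp_subl // dvdp_mulr // (dvdp_trans dg).
have gQ i : g %| Q`_i.
  apply: (IHn g M' Q) => //.
  - apply: leq_trans le_n; rewrite ltn_add2r -addnS leq_add // dvdp_leq //.
  - move=> d dg dM'; apply: prM; first exact: dvdp_trans gl.
    by move=> j; rewrite -M'M.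
  - move=> j; rewrite mulrBl coefB dvdp_sub //.
      by apply: dvdp_trans (lMQ j).
    by rewrite -mulrA coefCM dvdp_mulr.
pose l' := l %/ g; have lE : l = l' * g by rewrite divpK.
pose Q' := map_poly (fun q => q %/ g) Q.
have QE : Q = g%:P * Q'.
  by apply/polyP => i; rewrite coefCM coef_map_id0 ?div0p // mulrC divpK.
have l'0 : l' != 0 by apply: contraNneq l0 => l'0; rewrite lE l'0 mul0r.
have g1' : (1 < size g)%N by rewrite ltn_neqAle eq_sym g1 size_poly_gt0.
have l'Q' : forall i, l' %| Q'`_i.
  apply: (IHn l' M Q') => //.
  - apply: leq_trans le_n; rewrite -!addSn leq_add ?size_poly // leq_add2r.
    have -> : size l = (size l' + size g).-1 by rewrite {1}lE size_mul.
    move: g1'; have : (0 < size l')%N by rewrite size_poly_gt0.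
    by move: (size l') (size g) => a c; lia.
  - move=> d dl' dM; apply: prM => //; apply: dvdp_trans dl' _.
    by rewrite lE dvdp_mulr.
  - move=> i; have := lMQ i; rewrite QE mulrCA coefCM [X in X %| _]lE mulrC.
    by rewrite dvdp_mul2l.
by move=> i; rewrite QE coefCM lE mulrC dvdp_mul.
Qed.

End Gauss.

Section Primitive.
Variable F : fieldType.

Definition primitive (M : {poly {poly F}}) :=
  forall g, (forall i, g %| M`_i) -> size g = 1%N.

(** Each division by a nonconstant common factor lowers the degree of the leading coefficient, so
    the extraction stops. *)
Lemma primitive_part (M : {poly {poly F}}) : M != 0 ->
  exists (D : {poly F}) (M' : {poly {poly F}}), [/\ D != 0, M = D%:P * M' & primitive M'].
Proof.
have [n] := ubnP (size (lead_coef M)); elim: n M => // n IHn M; rewrite ltnS => le_n M0.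
have [pM|] := pselect (primitive M); first by exists 1, M; rewrite oner_eq0 mul1r.
move=> /existsNP[g /not_implyP[gM /eqP sg]]; have {gM}gM : forall i, g %| M`_i by [].
have g0 : g != 0.
  by apply: contraNneq M0 => g0; have := gM (size M).-1; rewrite g0 dvd0p -lead_coefE lead_coef_eq0.
pose Q := map_poly (fun q => q %/ g) M.
have QE : M = g%:P * Q.
  by apply/polyP => i; rewrite coefCM coef_map_id0 ?div0p // mulrC divpK.
have Q0 : Q != 0 by apply: contraNneq M0 => Q0; rewrite QE Q0 mulr0.
have [|//|D [M' [D0 QE' pM']]] := IHn Q.
  apply: leq_trans le_n; rewrite QE lead_coefM lead_coefC size_mul ?lead_coef_eq0 //.
  have : (0 < size (lead_coef Q))%N by rewrite size_poly_gt0 lead_coef_eq0.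
  have : (0 < size g)%N by rewrite size_poly_gt0.
  by move: sg; move: (size g) (size (lead_coef Q)) => a c /eqP; lia.
by exists (g * D), M'; split=> //; rewrite ?mulf_neq0 // polyCM -mulrA -QE'.
Qed.

End Primitive.

Section Luroth.
Variables (F L : fieldType) (iota : {rmorphism {poly F} -> L}).
Hypothesis iota_inj : injective iota.
Let kappa (c : F) : L := iota c%:P.
Let s := iota 'X.

Local Notation "p ^k" := (map_poly (iota \o polyC) p) (at level 2, format "p ^k").

Lemma horner_kappa n : n^k.[s] = iota n.
Proof.
by rewrite map_poly_comp horner_map -[in RHS](comp_polyXr n).
Qed.

Lemma iota_eq0 p : (iota p == 0) = (p == 0).
Proof. by rewrite -(rmorph0 iota) (inj_eq iota_inj). Qed.

(** A field between [F] and [F(s)], given by its membership predicate; [Kfrac] says that it lies in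
    [F(s)]. *)
Variable K : L -> Prop.
Hypotheses (Kc : forall c, K (kappa c)) (KD : forall x y, K x -> K y -> K (x + y))
  (KM : forall x y, K x -> K y -> K (x * y)) (KV : forall x, K x -> K x^-1)
  (Kfrac : forall x, K x -> exists a b : {poly F}, b != 0 /\ x = iota a / iota b).

Let K0 : K 0. Proof. by rewrite -(rmorph0 iota) -polyC0; exact: Kc. Qed.
Let KN x : K x -> K (- x).
Proof.
move=> Kx; rewrite -mulN1r; apply: KM => //.
by rewrite -(rmorph1 iota) -(rmorphN iota) -polyCN; exact: Kc.
Qed.
Let Ksum (I : Type) (r : seq I) (f : I -> L) : (forall i, K (f i)) -> K (\sum_(i <- r) f i).
Proof. by move=> Kf; elim/big_ind: _. Qed.

Definition Kpol (c : {poly L}) := forall i, K c`_i.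

Lemma KpolM c e : Kpol c -> Kpol e -> Kpol (c * e).
Proof. by move=> Kc' Ke i; rewrite coefM; apply: Ksum => j; exact: KM. Qed.

Lemma KpolB c e : Kpol c -> Kpol e -> Kpol (c - e).
Proof. by move=> Kc' Ke i; rewrite coefB; apply: KD => //; exact: KN. Qed.

Lemma KpolZ x c : K x -> Kpol c -> Kpol (x *: c).
Proof. by move=> Kx Kc' i; rewrite coefZ; exact: KM. Qed.

Lemma Kpol_kappa p : Kpol p^k.
Proof. by move=> i; rewrite coef_map /=; exact: Kc. Qed.

Lemma KpolXn n : Kpol 'X^n.
Proof.
move=> i; rewrite coefXn; case: eqP => _ //.
by rewrite -(rmorph1 iota) -polyC1; exact: Kc.
Qed.

Lemma clear_denominators c : Kpol c ->
  exists (l : {poly F}) (M : {poly {poly F}}), l != 0 /\ map_poly iota M = iota l *: c.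
Proof.
elim/poly_ind: c => [|c x IHc] Kcx.
  by exists 1, 0; rewrite oner_eq0 rmorph0 scaler0.
have Kc' : Kpol c.
  by move=> i; have := Kcx i.+1; rewrite coefD coefMX coefC /= addr0.
have Kx : K x by have := Kcx 0%N; rewrite coefD coefMX coefC /= add0r.
have [l [M [l0 ME]]] := IHc Kc'; have [a [b [b0 xE]]] := Kfrac Kx.
exists (l * b), (b%:P * M * 'X + (a * l)%:P); split; first by rewrite mulf_neq0.
rewrite rmorphD !rmorphM /= !map_polyC map_polyX /= ME xE scalerDr; congr (_ + _).
  by rewrite -!mul_polyC polyCM; ring.
by rewrite -!mul_polyC -!polyCM; congr _%:P; field; rewrite iota_eq0.
Qed.

(** With [y = a / b] nonconstant, [a(X) - y b(X)] is nonzero, has coefficients in [K] and kills [s].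
    A relation of least size is, up to a scalar, the minimal polynomial of [s] over [K]. *)
Lemma minimal_relation y : K y -> (forall c, y <> kappa c) ->
  exists M : {poly L}, [/\ M != 0, Kpol M, M.[s] = 0 &
    forall c, Kpol c -> c.[s] = 0 -> (size c < size M)%N -> c = 0].
Proof.
move=> Ky ync.
pose Rel n := `[< exists M : {poly L}, [/\ M != 0, Kpol M, M.[s] = 0 & size M = n] >].
have exR : exists n, Rel n.
  have [a [b [b0 yE]]] := Kfrac Ky.
  pose M := a^k - y *: b^k.
  exists (size M); apply/asboolP; exists M; split=> //.
  - apply/negP => /eqP M0; pose i := (size b).-1.
    have bi : b`_i != 0 by rewrite -lead_coefE lead_coef_eq0.
    have : M`_i = 0 by rewrite M0 coef0.
    rewrite coefB coefZ !coef_map /= => /subr0_eq aE.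
    apply: (ync (a`_i / b`_i)); rewrite /kappa polyCM rmorphM /= aE -mulrA -rmorphM -polyCM.
    by rewrite divff // rmorph1 mulr1.
  - apply: KpolB; first exact: Kpol_kappa.
    by apply: KpolZ => //; exact: Kpol_kappa.
  - by rewrite hornerD hornerN hornerZ !horner_kappa yE divfK ?subrr // iota_eq0.
have [n /asboolP[M [M0 KM' Ms sM]] nmin] := ex_minnP exR.
exists M; split=> // c Kc' cs ltc; apply: contraTeq ltc => c0.
by rewrite -leqNgt sM; apply: nmin; apply/asboolP; exists c.
Qed.

(** Euclidean division by [M] with all coefficients kept in [K]; a nonzero remainder would
    contradict minimality. *)
Lemma minimal_relation_dvd M c : M != 0 -> Kpol M -> M.[s] = 0 ->
  (forall c, Kpol c -> c.[s] = 0 -> (size c < size M)%N -> c = 0) ->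
  Kpol c -> c.[s] = 0 -> exists2 Q, Kpol Q & c = M * Q.
Proof.
move=> M0 KM' Ms Mmin; have [n] := ubnP (size c); elim: n c => // n IHn c.
rewrite ltnS => le_n Kc' cs.
have [cM|Mc] := ltnP (size c) (size M).
  exists 0; first by move=> i; rewrite coef0.
  by rewrite mulr0; exact: Mmin.
have c0 : c != 0 by rewrite -size_poly_gt0 (leq_trans _ Mc) // size_poly_gt0.
pose T := (lead_coef c / lead_coef M) *: 'X^(size c - size M).
have KT : Kpol T.
  apply: KpolZ; last exact: KpolXn.
  by apply: KM; [exact: Kc'|apply: KV; exact: KM'].
have [||Q KQ QE] := IHn (c - M * T) _ (KpolB Kc' (KpolM KM' KT)).
- apply: leq_trans le_n; rewrite [X in (_ < X)%N](polySpred c0) ltnS.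
  apply/leq_sizeP => j; rewrite leq_eqVlt => /predU1P[<-|jc].
    rewrite coefB /T -scalerAr coefZ coefMXn ltnNge.
    have -> : ((size c).-1 - (size c - size M))%N = (size M).-1.
      by move: Mc c0 M0; rewrite -!size_poly_gt0; lia.
    have -> : (size c - size M <= (size c).-1)%N.
      by move: Mc c0 M0; rewrite -!size_poly_gt0; lia.
    by rewrite /= -!lead_coefE divfK ?subrr // lead_coef_eq0.
  rewrite coefB /T -scalerAr coefZ nth_default 1?(polySpred c0) // coefMXn.
  rewrite [M`__]nth_default; first by case: ifP; rewrite mulr0 subrr.
  move: jc Mc c0 M0; rewrite -!size_poly_gt0;  move: (size c) (size M) => a b; lia.
- by rewrite hornerD hornerN hornerM Ms mul0r cs subrr.
exists (Q + T); last by rewrite mulrDr -QE subrK.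
by move=> i; rewrite coefD; exact: KD.
Qed.

Definition Frac_of r z := exists P Q : {poly F}, Q^k.[r] != 0 /\ z = P^k.[r] / Q^k.[r].

Section FracOf.
Variable r : L.

Lemma Frac_of_kappa c : Frac_of r (kappa c).
Proof.
by exists c%:P, 1; rewrite rmorph1 hornerC oner_eq0 map_polyC hornerC divr1.
Qed.

Lemma Frac_of_gen : Frac_of r r.
Proof. by exists 'X, 1; rewrite rmorph1 hornerC oner_eq0 map_polyX hornerX divr1. Qed.

Lemma Frac_ofD x y : Frac_of r x -> Frac_of r y -> Frac_of r (x + y).
Proof.
move=> [P [Q [Q0 ->]]] [P' [Q' [Q0' ->]]].
exists (P * Q' + P' * Q), (Q * Q'); rewrite rmorphD !rmorphM !hornerE mulf_neq0 //.
by split=> //; field; rewrite Q0 Q0'.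
Qed.

Lemma Frac_ofM x y : Frac_of r x -> Frac_of r y -> Frac_of r (x * y).
Proof.
move=> [P [Q [Q0 ->]]] [P' [Q' [Q0' ->]]].
exists (P * P'), (Q * Q'); rewrite !(rmorphM (map_poly (iota \o polyC))) !hornerM mulf_neq0 //.
by split=> //; rewrite mulf_div.
Qed.

Lemma Frac_ofN x : Frac_of r x -> Frac_of r (- x).
Proof.
by move=> [P [Q [Q0 ->]]]; exists (- P), Q; rewrite rmorphN hornerN mulNr.
Qed.

Lemma Frac_ofV x : Frac_of r x -> Frac_of r x^-1.
Proof.
move=> [P [Q [Q0 ->]]]; have [P0|P0] := eqVneq P^k.[r] 0.
  by exists 0, 1; rewrite rmorph1 hornerC oner_eq0 rmorph0 horner0 P0 !mul0r invr0.
by exists Q, P; rewrite invf_div.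
Qed.

Lemma Frac_ofK z : K r -> Frac_of r z -> K z.
Proof.
move=> Kr [P [Q [Q0 ->]]].
have Kh (p : {poly F}) : K p^k.[r].
  elim/poly_ind: p => [|p c IHp]; first by rewrite rmorph0 horner0.
  rewrite rmorphD rmorphM /= map_polyX map_polyC !hornerE /=.
  by apply: KD; [exact: KM|exact: Kc].
by apply: KM => //; exact: KV.
Qed.

End FracOf.

(** Were all these ratios constant, [M] would be a multiple of a polynomial over [F], and [s] would
    be algebraic over [F], against the injectivity of [iota]. *)
Lemma nonconstant_coeff M : M != 0 -> M.[s] = 0 ->
  exists i, forall c, M`_i / lead_coef M <> kappa c.
Proof.
move=> M0 Ms; apply: contrapT => /forallNP H.
have /choice[c cE] : forall i, exists c, M`_i = lead_coef M * kappa c.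
  move=> i; have /existsNP[c /contrapT cE] := H i.
  by exists c; rewrite -cE mulrC divfK // lead_coef_eq0.
pose C := \poly_(i < size M) c i.
have ME : M = lead_coef M *: C^k.
  apply/polyP => i; rewrite coefZ coef_map coef_poly; case: ifP => [_|]; first exact: cE.
  by move=> /negbT; rewrite -leqNgt => iM; rewrite nth_default // /= rmorph0 mulr0.
have : M.[s] = lead_coef M * iota C by rewrite {1}ME hornerZ horner_kappa.
rewrite Ms => /esym/eqP; rewrite mulf_eq0 lead_coef_eq0 (negbTE M0) /= iota_eq0 => /eqP C0.
by move: M0; rewrite ME C0 rmorph0 scaler0 eqxx.
Qed.

Lemma coprime_frac x : K x -> exists p q : {poly F}, [/\ q != 0, coprimep p q & x = iota p / iota q].
Proof.
move=> /Kfrac[a [b [b0 xE]]].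
have [g [u [v [g0 uE vE uv]]]] : exists g u v, [/\ g != 0, a = u * g, b = v * g & coprimep u v].
  exists (gcdp a b), (a %/ gcdp a b), (b %/ gcdp a b).
  by rewrite !divpK ?dvdp_gcdl ?dvdp_gcdr // gcdp_eq0 negb_and b0 orbT coprimep_div_gcd ?b0 ?orbT.
have v0 : v != 0 by apply: contraNneq b0 => v0; rewrite vE v0 mul0r.
exists u, v; split=> //.
by rewrite xE uE vE !(rmorphM iota) -mulf_div divff ?mulr1 // iota_eq0.
Qed.

(** This is [p(X) q(s) - p(s) q(X)], with [X] as the outer and [s] as the inner variable. *)
Definition biform (p q : {poly F}) : {poly {poly F}} := q%:P * p^:P - p%:P * q^:P.

Lemma map_biform p q : q != 0 ->
  map_poly iota (biform p q) = iota q *: (p^k - (iota p / iota q) *: q^k).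
Proof.
move=> q0; rewrite /biform rmorphB !rmorphM /= !map_polyC /= -!map_poly_comp.
rewrite scalerBr scalerA mulrCA divff ?iota_eq0 // mulr1.
by rewrite !mul_polyC.
Qed.

Lemma sizeY_biform p q : (sizeY (biform p q) <= maxn (size p) (size q))%N.
Proof.
apply/bigmax_leqP => i _; rewrite coefB !coefCM !coef_map /=.
rewrite (leq_trans (size_polyD _ _)) // size_polyN ![_ * _%:P]mulrC !mul_polyC maxnC.
by rewrite geq_max !leq_max !size_scale_leq ?orbT.
Qed.

(** After exchange of the variables, [g] divides every [q_i p - p_i q]. As [p] and [q] are not
    proportional, two of these combinations recover nonzero multiples of [p] and of [q], so [g]
    divides their gcd. *)
Lemma biform_dvd p q g : q != 0 -> coprimep p q -> (forall c, p <> c *: q) ->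
  (exists M, biform p q = M * g^:P) -> size g = 1%N.
Proof.
move=> q0 pq pnq [M ME].
have gd i : g %| q`_i *: p - p`_i *: q.
  have -> : q`_i *: p - p`_i *: q = (swapXY (biform p q))`_i.
    rewrite rmorphB !rmorphM /= !swapXY_polyC !swapXY_map_polyC.
    by rewrite coefB !coefMC !coef_map /= !mul_polyC.
  by rewrite ME rmorphM /= swapXY_map_polyC coefMC dvdp_mull.
pose l := (size q).-1; have ql : q`_l != 0 by rewrite -lead_coefE lead_coef_eq0.
have [k kE] : exists k, q`_k * p`_l - p`_k * q`_l != 0.
  apply: contrapT => /forallNP H; apply: (pnq (p`_l / q`_l)); apply/polyP => k.
  have /negP/negPn := H k; rewrite subr_eq0 coefZ => /eqP e.
  by rewrite mulrAC [p`_l * _]mulrC e mulfK.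
have gp : g %| p.
  have : g %| p`_l *: (q`_k *: p - p`_k *: q) - p`_k *: (q`_l *: p - p`_l *: q).
    by apply: dvdp_sub; rewrite -mul_polyC dvdp_mull.
  rewrite !scalerBr !scalerA [p`_l * p`_k]mulrC opprB addrA addrNK -scalerBl.
  by rewrite mulrC dvdpZr.
have gq : g %| q.
  have : g %| q`_l *: (q`_k *: p - p`_k *: q) - q`_k *: (q`_l *: p - p`_l *: q).
    by apply: dvdp_sub; rewrite -mul_polyC dvdp_mull.
  rewrite !scalerBr !scalerA [q`_l * q`_k]mulrC opprB addrC addrA addrNK -scalerBl.
  by rewrite [q`_l * _]mulrC dvdpZr.
have : g %| gcdp p q by rewrite dvdp_gcd gp gq.
by move=> g1; move: pq; rewrite /coprimep -dvdp1 => h; have := dvdp_trans g1 h; rewrite dvdp1 => /eqP.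
Qed.

(* Let [r = p / q] be a nonconstant coefficient ratio of the minimal polynomial of [s] over [K]. That polynomial, made
   primitive in [F[s][X]], divides [p(X) q(s) - p(s) q(X)] by Gauss's lemma; comparing degrees in [s], it is equal to
   it up to a constant, so that [s] has the same degree over [F(r)] as over [K]. *)
Theorem luroth y0 : K y0 -> (forall c, y0 <> kappa c) ->
  exists2 r, K r & forall y, K y -> Frac_of r y.
Proof.
move=> Ky0 y0c; have [M [M0 KM' Ms Mmin]] := minimal_relation Ky0 y0c.
have [i rc] := nonconstant_coeff M0 Ms.
set r := M`_i / lead_coef M in rc.
have Kr : K r by apply: KM; [exact: KM'|apply: KV; exact: KM'].
have [p [q [q0 pq rE]]] := coprime_frac Kr.
have pnq c : p <> c *: q.
  move=> pE; apply: (rc c); rewrite rE pE -mul_polyC rmorphM /=.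
  by rewrite mulfK ?iota_eq0.
pose P := p^k - r *: q^k.
have KP : Kpol P by apply: KpolB; [|apply: KpolZ => //]; exact: Kpol_kappa.
have Ps : P.[s] = 0 by rewrite hornerD hornerN hornerZ !horner_kappa rE divfK ?subrr ?iota_eq0.
have PtE : map_poly iota (biform p q) = iota q *: P by rewrite map_biform // -rE.
have [Q KQ PE] := minimal_relation_dvd M0 KM' Ms Mmin KP Ps.
have [l0 [M' [l00 M'E]]] := clear_denominators KM'.
have [l1 [Q1 [l10 Q1E]]] := clear_denominators KQ.
have mi0 (u : {poly {poly F}}) : (map_poly iota u == 0) = (u == 0).
  have [->|u0] := eqVneq u 0; first by rewrite rmorph0 eqxx.
  by apply/negbTE; rewrite map_poly_eq0_id0 // iota_eq0 lead_coef_eq0.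
have mi_inj : injective (map_poly iota).
  by move=> u v /eqP; rewrite -subr_eq0 -rmorphB mi0 subr_eq0 => /eqP.
have M'0 : M' != 0 by rewrite -mi0 M'E scaler_eq0 iota_eq0 negb_or l00.
have [D [M1 [D0 M1E pM1]]] := primitive_part M'0.
(* Clearing denominators in [P = M Q] and extracting the content leaves an identity over [F[s]], to
   which Gauss's lemma applies. *)
have qDQ : M1 * ((q * D)%:P * Q1) = (l0 * l1)%:P * biform p q.
  have -> : M1 * ((q * D)%:P * Q1) = q%:P * (M' * Q1) by rewrite M1E polyCM; ring.
  apply: mi_inj; rewrite !(rmorphM (map_poly iota)) /= !map_polyC /= M'E Q1E PtE PE.
  by rewrite !(rmorphM iota) polyCM -!mul_polyC; ring.
have l01 : l0 * l1 != 0 by rewrite mulf_neq0.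
have lQ : forall i, l0 * l1 %| ((q * D)%:P * Q1)`_i.
  apply: (@gauss_dvd _ (l0 * l1) M1) => // [g _|j]; first exact: pM1.
  by rewrite qDQ coefCM dvdp_mulr.
pose Q3 := map_poly (fun u => u %/ (l0 * l1)) ((q * D)%:P * Q1).
have Q3E : (q * D)%:P * Q1 = (l0 * l1)%:P * Q3.
  by apply/polyP => j; rewrite [in RHS]coefCM coef_map_id0 ?div0p // [RHS]mulrC divpK.
have BE : biform p q = M1 * Q3.
  apply: (@mulfI _ (l0 * l1)%:P); first by rewrite polyC_eq0.
  by rewrite -qDQ Q3E mulrCA.
have iM1 j : iota M1`_j * (iota D * lead_coef M) = iota l0 * M`_j * lead_coef M.
  have := congr1 (fun u : {poly L} => u`_j) M'E.
  by rewrite M1E coef_map coefCM coefZ /= (rmorphM iota) => <-; ring.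
pose t := (size M).-1.
have iMt : M`_t = lead_coef M by [].
have lM0 : lead_coef M != 0 by rewrite lead_coef_eq0.
have M1r : M1`_i * q = M1`_t * p.
  apply: iota_inj; rewrite !(rmorphM iota).
  have iq : iota q != 0 by rewrite iota_eq0.
  have iD : iota D != 0 by rewrite iota_eq0.
  apply: (@mulIf _ (iota D * lead_coef M)); first by rewrite mulf_neq0.
  rewrite mulrAC iM1 [RHS]mulrAC iM1 iMt.
  have -> : iota p = r * iota q by rewrite rE divfK.
  by rewrite /r; field.
have p0 : p != 0 by apply/eqP => p0; apply: (pnq 0); rewrite scale0r.
have M1t0 : M1`_t != 0.
  apply/eqP => M1t; have := iM1 t; rewrite M1t rmorph0 mul0r iMt => /esym/eqP.
  by rewrite !mulf_eq0 iota_eq0 (negbTE l00) (negbTE lM0).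
have M1i0 : M1`_i != 0.
  apply: contraNneq M1t0 => M1i; have := M1r; rewrite M1i mul0r => /esym/eqP.
  by rewrite mulf_eq0 (negbTE p0) orbF.
(* From [M1_i q = M1_t p] and coprimality, [p] divides [M1_i] and [q] divides [M1_t]. So the degree
   of [M1] in [s] is at least that of [biform p q]. *)
have sp : (size p <= sizeY M1)%N.
  apply: leq_trans (max_size_coefXY M1 i); apply: dvdp_leq => //.
  rewrite -(@Gauss_dvdpl _ _ q) //; apply/dvdpP; exists M1`_t; exact: M1r.
have sq : (size q <= sizeY M1)%N.
  apply: leq_trans (max_size_coefXY M1 t); apply: dvdp_leq => //.
  rewrite -(@Gauss_dvdpl _ _ p) 1?coprimep_sym //; apply/dvdpP; exists M1`_i; exact/esym/M1r.
have B0 : biform p q != 0.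
  rewrite -mi0 PtE scaler_eq0 iota_eq0 (negbTE q0) /=; apply/eqP => P0.
  have := congr1 (fun u : {poly L} => u`_(size q).-1) P0.
  rewrite coef0 coefB coefZ !coef_map /= -lead_coefE => /eqP; rewrite subr_eq0 => /eqP e.
  apply: (rc (p`_(size q).-1 / lead_coef q)).
  apply: (@mulIf _ (iota (lead_coef q)%:P)); first by rewrite iota_eq0 polyC_eq0 lead_coef_eq0.
  by rewrite -e /kappa -rmorphM -polyCM divfK // lead_coef_eq0.
have M10 : M1 != 0 by apply: contraNneq B0 => M10; rewrite BE M10 mul0r.
have Q30 : Q3 != 0 by apply: contraNneq B0 => Q30; rewrite BE Q30 mulr0.
have sQ3 : (size (swapXY Q3) <= 1)%N.
  have := sizeY_biform p q; rewrite BE sizeYE rmorphM size_mul ?swapXY_eq0 // -!sizeYE.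
  have : (0 < sizeY M1)%N by rewrite lt0n sizeY_eq0.
  have : (maxn (size p) (size q) <= sizeY M1)%N by rewrite geq_max sp sq.
  by move: (sizeY M1) (sizeY Q3) (maxn _ _) => a c e; clear; lia.
(* The cofactor is free of [s], hence a polynomial in [X] alone, and [biform_dvd] makes it
   constant. *)
have Q3P : Q3 = ((swapXY Q3)`_0)^:P by rewrite -swapXY_polyC -(size1_polyC sQ3) swapXYK.
have g1 : size ((swapXY Q3)`_0) = 1%N.
  by apply: (biform_dvd q0 pq pnq); exists M1; rewrite -Q3P.
have [c c0 gE] : exists2 c, c != 0 & (swapXY Q3)`_0 = c%:P by apply/size_poly1P/eqP.
have sP : size P = size M.
  have sB : size (biform p q) = size M1.
    by rewrite BE Q3P gE map_polyC mulrC mul_polyC size_scale // polyC_eq0.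
  have s1 : size (map_poly iota (biform p q)) = size (biform p q).
    by rewrite size_map_poly_id0 // iota_eq0 lead_coef_eq0.
  have s2 : size (map_poly iota M') = size M'.
    by rewrite size_map_poly_id0 // iota_eq0 lead_coef_eq0.
  rewrite -(@size_scale _ (iota q)) ?iota_eq0 // -PtE s1 sB.
  rewrite -[RHS](@size_scale _ (iota l0)) ?iota_eq0 // -M'E s2 M1E.
  by rewrite mul_polyC size_scale.
have FP j : Frac_of r P`_j.
  rewrite coefB coefZ !coef_map /=; apply: Frac_ofD; first exact: Frac_of_kappa.
  by apply/Frac_ofN/Frac_ofM; [exact: Frac_of_gen|exact: Frac_of_kappa].
(* Division by [P], which has coefficients in [F(r)] and the size of [M], brings every polynomial in
   [s] below the minimal degree. *)
have red (n : {poly F}) : exists al : {poly L},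
    [/\ forall j, Frac_of r al`_j, (size al < size M)%N & al.[s] = iota n].
  elim/poly_ind: n => [|n e [al [Fal sal als]]].
    exists 0; rewrite size_poly0 size_poly_gt0 horner0 rmorph0; split=> // j.
    by rewrite coef0 -(rmorph0 iota) -polyC0; exact: Frac_of_kappa.
  pose be := al * 'X + (kappa e)%:P.
  have Fbe j : Frac_of r be`_j.
    rewrite coefD coefMX coefC; case: j => [|j] /=.
      by rewrite add0r; apply: (Frac_of_kappa r).
    by rewrite addr0.
  have P0 : P != 0 by rewrite -size_poly_gt0 sP size_poly_gt0.
  exists (be - (be`_(size P).-1 / lead_coef P) *: P); split.
  - move=> j; rewrite coefB coefZ; apply: Frac_ofD => //; apply/Frac_ofN/Frac_ofM => //.
    by apply: Frac_ofM => //; apply: Frac_ofV; exact: FP.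
  - rewrite -sP (polySpred P0) ltnS; apply/leq_sizeP => j.
    rewrite leq_eqVlt => /predU1P[<-|jP].
      by rewrite coefB coefZ -lead_coefE divfK ?subrr // lead_coef_eq0.
    rewrite coefB coefZ [P`__]nth_default; last by rewrite (polySpred P0).
    rewrite mulr0 subr0 nth_default // (leq_trans (size_polyD _ _)) //.
    rewrite geq_max (leq_trans (size_polyMleq _ _)); last first.
      by rewrite size_polyX addn2 /= (leq_trans sal) // -sP (polySpred P0).
    by rewrite (leq_trans (size_polyC_leq1 _)) // (leq_trans _ jP).
  - rewrite hornerD hornerN hornerZ Ps mulr0 subr0 !hornerE als.
    by rewrite rmorphD rmorphM.
exists r => // y Ky; have [n1 [n2 [n20 yE]]] := Kfrac Ky.
have [al [Fal sal als]] := red n1; have [be [Fbe sbe bes]] := red n2.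
have KF (h : {poly L}) : (forall j, Frac_of r h`_j) -> Kpol h by move=> Fc j; apply: (Frac_ofK Kr); exact: Fc.
(* This relation is shorter than [M], hence zero; comparing one coefficient then writes [y] as a
   quotient of elements of [F(r)]. *)
have alE : al - y *: be = 0.
  apply: Mmin.
  - by apply: KpolB; [exact: KF|apply: KpolZ => //; exact: KF].
  - by rewrite hornerD hornerN hornerZ als bes yE divfK ?subrr // iota_eq0.
  - rewrite (leq_ltn_trans (size_polyD _ _)) // size_polyN gtn_max sal.
    by rewrite (leq_ltn_trans (size_scale_leq _ _)).
have be0 : be != 0 by apply/eqP => be0; move: n20; rewrite -iota_eq0 -bes be0 horner0 eqxx.
have -> : y = al`_(size be).-1 / lead_coef be.
  have := congr1 (fun u : {poly L} => u`_(size be).-1) alE.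
  rewrite coef0 coefB coefZ -lead_coefE => /eqP; rewrite subr_eq0 => /eqP ->.
  by rewrite mulfK // lead_coef_eq0.
by apply: Frac_ofM; [exact: Fal|apply: Frac_ofV; exact: Fbe].
Qed.

End Luroth.

(** * Algebraic dependence *)

Section NonVanishing.
Variable R : realType.

Lemma infinite_injective (T : choiceType) (A : set T) (f : nat -> T) :
  injective f -> (forall n, A (f n)) -> infinite_set A.
Proof.
move=> finj fA /finite_seqP[r Ar].
have : (size [seq f n | n <- iota 0 (size r).+1] <= size r)%N.
  apply: uniq_leq_size; first by rewrite map_inj_uniq ?iota_uniq.
  by move=> x /mapP[n _ ->]; have := fA n; rewrite Ar.
by rewrite size_map size_iota ltnn.
Qed.

Lemma infinite_itvoo (a b : R) : a < b -> infinite_set [set x | a < x < b].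
Proof.
move=> ab; apply: (@infinite_injective _ _ (fun n => a + (b - a) / n.+2%:R)).
  move=> i j /addrI /(mulfI _) H.
  have /H/invr_inj/eqP : b - a != 0 by rewrite subr_eq0 gt_eqF.
  by rewrite eqr_nat => /eqP[].
move=> n /=; have ba : 0 < b - a by rewrite subr_gt0.
rewrite ltrDl divr_gt0 //= -ltrBrDl ltr_pdivrMr //.
by rewrite -[X in X < _]mulr1 ltr_pM2l // ltr1n.
Qed.

Lemma poly_all0 (p : {poly R}) : (forall t, p.[t] = 0) -> p = 0.
Proof.
move=> p0; apply/eqP/negPn/negP => pn0.
have := max_poly_roots pn0 (rs := [seq n%:R | n <- iota 0 (size p)]).
rewrite size_map size_iota ltnn => H; suff : false by [].
apply: H; first by apply/allP => t _; apply/rootP.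
rewrite map_inj_uniq ?iota_uniq // => i j /eqP; rewrite eqr_nat => /eqP; exact.
Qed.

(** Induction on the number of variables: [restr] drops the exponent of the last variable, and [c k]
    is the coefficient of its [k]-th power. *)
Lemma mev_eq0 n (p : mpol R n) : (forall x, mev p x = 0) -> p = 0.
Proof.
elim: n p => [|n IHn] p p0.
  rewrite (mpoly.nvar0_mpolyC p); have := p0 0.
  by rewrite {1}(mpoly.nvar0_mpolyC p) /mev mpoly.mevalC => ->; rewrite mpoly.mpolyC0.
pose restr (m : mpoly.multinom n.+1) : mpoly.multinom n :=
  mpoly.Multinom [tuple m (widen_ord (leqnSn n) i) | i < n].
have restrE (m m' : mpoly.multinom n.+1) : restr m = restr m' -> m ord_max = m' ord_max -> m = m'.
  move=> e1 e2; apply/mpoly.mnmP => i.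
  case: (unliftP ord_max i) => [j|] -> //.
  have := congr1 (fun u : mpoly.multinom n => u j) e1.
  rewrite !mpoly.mnmE => e; have -> : lift ord_max j = widen_ord (leqnSn n) j.
    by apply: val_inj; rewrite /= /bump leqNgt ltn_ord.
  by [].
pose c k : mpol R n :=
  \sum_(m <- mpoly.msupp p | m ord_max == k) mpoly.mcoeff m p *: mpoly.mpolyX R (restr m).
have c0 k : c k = 0.
  apply: IHn => v.
  pose N := (\max_(m <- mpoly.msupp p) m ord_max)%N.
  have : \poly_(k < N.+1) mev (c k) v = 0.
    apply: poly_all0 => t; rewrite horner_poly.
    transitivity (mev p (\row_(i < n.+1) (if unlift ord_max i is Some j then v ord0 j else t)));
      last exact: p0.
    rewrite mevE (eq_big_seq (fun m : mpoly.multinom n.+1 =>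
       \sum_(k < N.+1 | m ord_max == k) mpoly.mcoeff m p * (\prod_(i < n) v ord0 i ^+ restr m i) * t ^+ k)).
      rewrite (exchange_big_dep predT) //=; apply: eq_bigr => j _.
      rewrite /c /mev raddf_sum /= big_distrl /=; apply: eq_bigr => m _.
      by rewrite mpoly.mevalZ mpoly.mevalX.
    move=> m mp /=.
    have mN : (m ord_max < N.+1)%N by rewrite ltnS /N (big_rem m mp) leq_maxl.
    rewrite (big_pred1 (Ordinal mN)); last by move=> k'; rewrite eq_sym.
    rewrite -mulrA; congr (_ * _).
    rewrite big_ord_recr /= mxE unlift_none; congr (_ * _).
    apply: eq_bigr => i _; rewrite mxE.
    have -> : widen_ord (leqnSn n) i = lift ord_max i.
      by apply: val_inj; rewrite /= /bump leqNgt ltn_ord.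
    rewrite liftK mpoly.mnmE; congr (_ ^+ m _).
    by apply: val_inj; rewrite /= /bump leqNgt ltn_ord.
  move=> /polyP/(_ k); rewrite coef_poly coef0; case: ltnP => // Nk _.
  rewrite /c big_seq_cond big1 ?/mev ?mpoly.meval0 // => m /andP[mp /eqP mk].
  by move: Nk; rewrite -mk ltnNge /N (big_rem m mp) leq_maxl.
apply/mpoly.mpolyP => m0; rewrite mpoly.mcoeff0.
have [m0p|] := boolP (m0 \in mpoly.msupp p); last exact: mpoly.memN_msupp_eq0.
have := congr1 (mpoly.mcoeff (restr m0)) (c0 (m0 ord_max)).
rewrite mpoly.mcoeff0 /c raddf_sum /= big_mkcond (bigD1_seq m0) ?mpoly.msupp_uniq //= eqxx.
rewrite mpoly.mcoeffZ mpoly.mcoeffX eqxx mulr1 big1 ?addr0 // => m mn.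
case: eqP => // mm0; rewrite mpoly.mcoeffZ mpoly.mcoeffX.
by case: eqP => [e|_]; [rewrite (restrE _ _ e mm0) eqxx in mn|rewrite mulr0].
Qed.

Lemma mev_neq0 n (p : mpol R n) : p != 0 -> exists x, mev p x != 0.
Proof.
apply: contra_neqP => /forallNP H; apply: mev_eq0 => x.
by have /negP/negPn/eqP := H x.
Qed.

Lemma poly_neq0 (p : {poly R}) : p != 0 -> exists t, p.[t] != 0.
Proof.
apply: contra_neqP => /forallNP H; apply: poly_all0 => x.
by have /negP/negPn/eqP := H x.
Qed.

(** A value of [u] that is no root of the leading coefficient leaves a nonzero polynomial in [q]. In
    all plane relations [A.[q%:P].[u]], the outer variable stands for [q] and the inner one for
    [u]. *)
Lemma poly2_neq0 (A : {poly {poly R}}) : A != 0 -> exists u q, A.[q%:P].[u] != 0.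
Proof.
move=> A0; have /poly_neq0[u Au] : lead_coef A != 0 by rewrite lead_coef_eq0.
have /poly_neq0[q Aq] : map_poly (horner_eval u) A != 0.
  by apply/negP => /eqP/polyP/(_ (size A).-1)/eqP; rewrite coef_map coef0 -lead_coefE; exact/negP.
by exists u, q; rewrite -horner_evalE -(horner_map (horner_eval u)) /= horner_evalE hornerC.
Qed.

Definition row2 (a b : R) : 'rV[R]_2 := \row_(i < 2) (if i == ord0 then a else b).

Lemma mpol2_poly (p : mpol R 2) : p != 0 ->
  exists2 A : {poly {poly R}}, A != 0 & forall u q, A.[q%:P].[u] = mev p (row2 u q).
Proof.
move=> p0; pose P (f : R * R -> R) := exists A : {poly {poly R}}, forall x, A.[x.2%:P].[x.1] = f x.
have [A AE] : P (fun x => mev p (row2 x.1 x.2)).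
  apply: (@mev_closed _ _ P).
  - by move=> c; exists c%:P%:P => x; rewrite !hornerC.
  - by move=> f g [A AE] [B BE]; exists (A + B) => x; rewrite !hornerD AE BE.
  - by move=> f g [A AE] [B BE]; exists (A * B) => x; rewrite !hornerM AE BE.
  - move=> i; have [i0|i0] := eqVneq i ord0.
      by exists 'X%:P => x; rewrite hornerC hornerX mxE i0 eqxx.
    by exists 'X => x; rewrite hornerX hornerC mxE (negbTE i0).
exists A; last by move=> u q; rewrite (AE (u, q)).
apply/eqP => A0; have [x] := mev_neq0 p0; apply/negP/negPn.
have -> : x = row2 (x ord0 ord0) (x ord0 ord_max).
  apply/rowP => i; rewrite mxE; case: eqVneq => [->//|i0]; congr (x _ _).
  by apply: val_inj => /=; case: i i0 => -[|[|//]].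
by rewrite -(AE (_, _)) A0 !horner0.
Qed.

Lemma poly_mpol2 n (i j : 'I_n) (A : {poly {poly R}}) :
  polyfun (fun x : 'rV[R]_n => A.[(x ord0 j)%:P].[x ord0 i]).
Proof.
rewrite (_ : (fun _ => _) = fun x : 'rV[R]_n => \sum_(k < size A) (A`_k).[x ord0 i] * x ord0 j ^+ k).
  apply: polyfun_sum => k; apply: polyfunM; last by apply: polyfunX; exact: polyfun_coord.
  rewrite (_ : (fun _ => _) = fun x : 'rV[R]_n => \sum_(l < size A`_k) A`_k`_l * x ord0 i ^+ l).
    by apply: polyfun_sum => l; apply: polyfunM;
      [exact: polyfun_cst|apply: polyfunX; exact: polyfun_coord].
  by apply/funext => x; rewrite horner_coef.
apply/funext => x; rewrite [A.[_]]horner_coef horner_sum.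
by apply: eq_bigr => k _; rewrite hornerM -polyC_exp hornerC.
Qed.

End NonVanishing.

Section Algebraic.
Variables (R : realType) (X : Type) (u : X -> R).

(** Algebraic dependence of functions on a bare set [X], where no function field is at hand: one
    nonzero relation valid at every point. *)
Definition alg_over (q : X -> R) :=
  exists2 A : {poly {poly R}}, A != 0 & forall x, A.[(q x)%:P].[u x] = 0.

Lemma alg_cst c : alg_over (fun=> c).
Proof.
exists ('X - c%:P%:P); first by rewrite polyXsubC_eq0.
by move=> x; rewrite hornerXsubC subrr horner0.
Qed.

Lemma alg_self : alg_over u.
Proof.
exists ('X - 'X%:P); first by rewrite polyXsubC_eq0.
by move=> x; rewrite hornerXsubC hornerD hornerN hornerC hornerX subrr.
Qed.

Lemma algB f g : alg_over f -> alg_over g -> alg_over (fun x => f x - g x).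
Proof.
move=> [A A0 fA] [B B0 gB].
(* The factor ['X] makes both polynomials nonconstant in the outer variable, as the resultant
   requires. *)
have AX0 : A * 'X != 0 by rewrite mulf_neq0 // polyX_eq0.
have BX0 : B * 'X != 0 by rewrite mulf_neq0 // polyX_eq0.
exists (sub_annihilant (A * 'X) (B * 'X)); first exact: sub_annihilant_neq0.
have sAX : (1 < size (A * 'X)%R)%N by rewrite size_mulX // ltnS size_poly_gt0.
have sBX : (1 < size (B * 'X)%R)%N by rewrite size_mulX // ltnS size_poly_gt0.
have [uv _ uvE] := sub_annihilant_in_ideal sAX sBX => x.
rewrite polyCB; have := uvE (g x)%:P (f x - g x)%:P; rewrite polyCB => ->.
rewrite [(g x)%:P + _]addrC subrK !hornerM !hornerX hornerD !hornerM fA gB.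
by rewrite !(mul0r, mulr0) addr0.
Qed.

Lemma algD f g : alg_over f -> alg_over g -> alg_over (fun x => f x + g x).
Proof.
move=> Af Ag; rewrite (_ : (fun _ => _) = fun x => f x - (0 - g x)).
  by apply: algB => //; apply: algB => //; exact: alg_cst.
by apply/funext => x; rewrite sub0r opprK.
Qed.

Lemma algZ c f : alg_over f -> alg_over (fun x => c * f x).
Proof.
have [->|c0] := eqVneq c 0.
  by move=> _; under eq_fun do rewrite mul0r; exact: alg_cst.
move=> [A A0 fA]; exists (A \Po (c^-1%:P *: 'X)).
  rewrite -size_poly_eq0 size_comp_poly2 ?size_poly_eq0 //.
  by rewrite size_scale ?size_polyX // polyC_eq0 invr_eq0.
by move=> x; rewrite horner_comp hornerZ hornerX -polyCM mulrA mulVf // mul1r.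
Qed.

(** With [A(q) = E(q^2) + q O(q^2)], the product [A(q) A(-q)] equals [E^2 - q^2 O^2], a polynomial
    in [q^2]. *)
Lemma alg_sqr f : alg_over f -> alg_over (fun x => f x ^+ 2).
Proof.
move=> [A A0 fA]; pose E := even_poly A; pose O := odd_poly A.
have AE : A = E \Po 'X^2 + 'X * (O \Po 'X^2).
  by rewrite ['X * _]mulrC poly_even_odd.
exists (E * E - 'X * (O * O)).
  apply: contraNneq A0 => B0.
  have : (E * E - 'X * (O * O)) \Po 'X^2 = 0 by rewrite B0 comp_poly0.
  rewrite comp_polyB !comp_polyM comp_polyX => e.
  have : A * (A \Po - 'X) = 0.
    rewrite -e [in X in _ * X]AE comp_polyD comp_polyM comp_polyX -!comp_polyA comp_Xn_poly sqrrN.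
    rewrite [in X in X * _]AE.
    ring.
  move=> /eqP; rewrite mulf_eq0 => /orP[//|].
  by move=> /eqP e2; rewrite -size_poly_eq0 -(@size_comp_poly2 _ A (- 'X)) ?e2 ?size_poly0 // size_polyN size_polyX.
move=> x; have := fA x; rewrite {1}AE hornerD hornerM !horner_comp hornerX hornerXn -polyC_exp => e.
rewrite hornerD hornerN !hornerM !hornerX.
set a := E.[_] in e *; set b := O.[_] in e *.
have -> : a * a - (f x ^+ 2)%:P * (b * b) = (a + (f x)%:P * b) * (a - (f x)%:P * b).
  by rewrite polyC_exp; ring.
by rewrite hornerM e mul0r.
Qed.

(** Polarization reduces products to sums and squares. *)
Lemma algM f g : alg_over f -> alg_over g -> alg_over (fun x => f x * g x).
Proof.
move=> Af Ag; rewrite (_ : (fun _ => _) = fun x => 2^-1 * ((f x + g x) ^+ 2 - f x ^+ 2 - g x ^+ 2)).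
  apply: algZ; apply: algB; last exact: alg_sqr.
  by apply: algB; apply: alg_sqr => //; exact: algD.
by apply/funext => x; field.
Qed.

Lemma algV f : (forall x, f x != 0) -> alg_over f -> alg_over (fun x => (f x)^-1).
Proof.
move=> f0 [A A0 fA]; exists (\poly_(i < size A) A`_((size A).-1 - i)).
  apply/eqP => /polyP/(_ 0%N)/eqP; rewrite coef_poly size_poly_gt0 A0 coef0 subn0.
  by rewrite -lead_coefE lead_coef_eq0; exact/negP.
move=> x; apply: (@mulfI _ (f x ^+ (size A).-1)); first by rewrite expf_neq0.
rewrite mulr0 -[RHS](fA x) horner_poly [A.[_]]horner_coef.
rewrite !horner_sum big_distrr /= (reindex_inj rev_ord_inj) /=.
apply: eq_bigr => i _; rewrite !hornerM -!polyC_exp !hornerC.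
have iA : (i < size A)%N by [].
have -> : ((size A).-1 - (size A - i.+1))%N = i by rewrite -(subn1 (size A)) -subnDA add1n; lia.
rewrite mulrCA; congr (_ * _).
have -> : (size A).-1 = (size A - i.+1 + i)%N by move: iA; lia.
by rewrite exprD mulrAC -exprMn divff // expr1n mul1r.
Qed.

Lemma alg_mev n (Q : mpol R n) (w : X -> 'rV[R]_n) :
  (forall i, alg_over (fun x => w x ord0 i)) -> alg_over (fun x => mev Q (w x)).
Proof. by apply: mev_closed; [exact: alg_cst|exact: algD|exact: algM]. Qed.

End Algebraic.

(** * Analytic functions along rational curves *)

Section PolyNorm.
Variables (R : realType) (rho : R).
Hypothesis rho0 : 0 <= rho.

(** The majorant norm for radius [rho]: it is submultiplicative and bounds the values for
    [|t| <= rho]. *)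
Definition pnorm (p : {poly R}) : R := (map_poly Num.norm p).[rho].

Lemma coef_abs_poly (p : {poly R}) i : (map_poly Num.norm p)`_i = `|p`_i|.
Proof. by rewrite coef_map_id0 ?normr0. Qed.

Lemma pnorm_le (p q : {poly R}) : (forall i, `|p`_i| <= q`_i) -> pnorm p <= q.[rho].
Proof.
move=> pq; pose K := maxn (size (map_poly Num.norm p)) (size q).
rewrite /pnorm (@horner_coef_wide _ K) ?leq_maxl // (@horner_coef_wide _ K q) ?leq_maxr //.
by apply: ler_sum => i _; rewrite coef_abs_poly ler_wpM2r // exprn_ge0.
Qed.

Lemma pnorm_ge0 p : 0 <= pnorm p.
Proof.
rewrite /pnorm horner_coef sumr_ge0 // => i _.
by rewrite mulr_ge0 ?exprn_ge0 // coef_abs_poly.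
Qed.

Lemma pnormD p q : pnorm (p + q) <= pnorm p + pnorm q.
Proof.
rewrite -hornerD; apply: pnorm_le => i.
by rewrite !coefD !coef_abs_poly ler_normD.
Qed.

Lemma pnormM p q : pnorm (p * q) <= pnorm p * pnorm q.
Proof.
rewrite -hornerM; apply: pnorm_le => i.
rewrite !coefM (le_trans (ler_norm_sum _ _ _)) // ler_sum // => j _.
by rewrite !coef_abs_poly normrM.
Qed.

Lemma pnormC c : pnorm c%:P = `|c|.
Proof.
rewrite /pnorm (_ : map_poly _ _ = `|c|%:P) ?hornerC //.
by apply/polyP => i; rewrite coef_abs_poly !coefC; case: eqP; rewrite ?normr0.
Qed.

Lemma pnorm_expn p n : pnorm (p ^+ n) <= pnorm p ^+ n.
Proof.
elim: n => [|n IHn]; first by rewrite !expr0 pnormC normr1.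
by rewrite !exprS (le_trans (pnormM _ _)) // ler_wpM2l // pnorm_ge0.
Qed.

Lemma pnorm_sum (I : Type) (r : seq I) (F : I -> {poly R}) :
  pnorm (\sum_(i <- r) F i) <= \sum_(i <- r) pnorm (F i).
Proof.
elim: r => [|i r IHr]; first by rewrite !big_nil pnormC normr0.
by rewrite !big_cons (le_trans (pnormD _ _)) // lerD2l.
Qed.

Lemma pnorm_prod (I : Type) (r : seq I) (F : I -> {poly R}) :
  pnorm (\prod_(i <- r) F i) <= \prod_(i <- r) pnorm (F i).
Proof.
elim: r => [|i r IHr]; first by rewrite !big_nil pnormC normr1.
by rewrite !big_cons (le_trans (pnormM _ _)) // ler_wpM2l // pnorm_ge0.
Qed.

Lemma pnormMXn p n : pnorm (p * 'X^n) = pnorm p * rho ^+ n.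
Proof.
rewrite /pnorm (_ : map_poly _ _ = map_poly Num.norm p * 'X^n) ?hornerM ?hornerXn //.
apply/polyP => i; rewrite coef_abs_poly !coefMXn; case: ifP; rewrite ?normr0 //.
by rewrite coef_abs_poly.
Qed.

Lemma horner_pnorm p t : `|t| <= rho -> `|p.[t]| <= pnorm p.
Proof.
move=> tr; rewrite /pnorm (@horner_coef_wide _ (size p) (map_poly _ _)) ?size_poly //.
rewrite horner_coef (le_trans (ler_norm_sum _ _ _)) // ler_sum // => i _.
by rewrite normrM normrX coef_abs_poly ler_wpM2l // lerXn2r // nnegrE.
Qed.

End PolyNorm.

Lemma pnorm_homo (R : realType) (p : {poly R}) (a b : R) :
  0 <= a -> a <= b -> pnorm a p <= pnorm b p.
Proof.
move=> a0 ab; rewrite /pnorm !horner_coef ler_sum // => i _.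
rewrite coef_abs_poly ler_wpM2l // lerXn2r // nnegrE //; exact: le_trans ab.
Qed.

Section Order.
Variable R : realType.

Lemma poly_root0_factor (p : {poly R}) : p.[0] = 0 -> exists q, p = q * 'X.
Proof.
move=> p0; have /factor_theorem[q qE] : root p 0 by apply/rootP.
by exists q; rewrite qE subr0.
Qed.

Lemma horner_near0 (p : {poly R}) : exists2 C, 0 <= C &
  forall t, `|t| <= 1 -> `|p.[t] - p.[0]| <= C * `|t|.
Proof.
have [q qE] : exists q, p - p.[0]%:P = q * 'X.
  by apply: poly_root0_factor; rewrite hornerD hornerN hornerC subrr.
exists (pnorm 1 q); first exact: pnorm_ge0.
move=> t t1; have -> : p.[t] - p.[0] = q.[t] * t.
  by have := congr1 (horner^~ t) qE; rewrite /= hornerD hornerN hornerC hornerM hornerX.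
by rewrite normrM ler_wpM2r // horner_pnorm.
Qed.

(* The zeros accumulate at 0 faster than the order of vanishing allows. *)
Lemma poly_order (G : {poly R}) (C : R) n :
  (forall d : R, 0 < d -> exists t : R, [/\ 0 < `|t|, `|t| < d & `|G.[t]| <= C * `|t| ^+ n]) ->
  exists H, G = H * 'X^n.
Proof.
elim: n G => [|n IHn] G HG; first by exists G; rewrite expr0 mulr1.
have G0 : G.[0] = 0.
  apply/eqP; rewrite -normr_eq0; apply/eqP/le_anti; rewrite normr_ge0 andbT.
  have [K K0 HK] := horner_near0 G.
  have C0 : 0 <= C.
    have [t [t0 _ /(le_trans (normr_ge0 _))]] := HG 1 ltr01.
    by rewrite pmulr_lge0 // exprn_gt0.
  apply/ler_addgt0Pl => e e0; rewrite addr0.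
  have d0 : 0 < Num.min 1 (e / (K + C + 1)).
    by rewrite lt_min ltr01 divr_gt0 // -addrA ltr_wpDl // ltr_wpDl.
  have [t [t0 ]] := HG _ d0; rewrite lt_min => /andP[t1 te] Gt.
  have -> : G.[0] = G.[t] - (G.[t] - G.[0]) by rewrite subKr.
  rewrite (le_trans (ler_normB _ _)) //.
  have h1 : `|G.[t]| <= C * `|t|.
    rewrite (le_trans Gt) // ler_wpM2l // exprS -[X in _ <= X]mulr1 ler_wpM2l //.
    by rewrite exprn_ile1 // ltW.
  have h2 : `|G.[t] - G.[0]| <= K * `|t| by rewrite HK // ltW.
  have h3 : (K + C + 1) * `|t| <= e.
    by rewrite mulrC -ler_pdivlMr ?ltW // -addrA ltr_wpDl // ltr_wpDl.
  apply: le_trans (lerD h1 h2) _; apply: le_trans h3.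
  by rewrite -mulrDl ler_wpM2r // addrC lerDl.
have [G' GE] := poly_root0_factor G0.
have [|H HE] := IHn G'.
  move=> d d0; have [t [t0 td]] := HG d d0.
  rewrite GE hornerM hornerX normrM exprSr mulrA ler_pM2r // => Gt.
  by exists t.
by exists H; rewrite GE HE exprSr mulrA.
Qed.

End Order.

Section Cube.
Variables (R : realType) (n : nat).

Lemma cube_widen N N' (G : ('I_n -> nat) -> R) : (N <= N')%N ->
  \sum_(al : {ffun 'I_n -> 'I_N.+1}) G (fun i => al i) =
  \sum_(al : {ffun 'I_n -> 'I_N'.+1} | [forall i, (al i <= N)%N]) G (fun i => al i).
Proof.
move=> NN'.
pose h (al : {ffun 'I_n -> 'I_N.+1}) : {ffun 'I_n -> 'I_N'.+1} := [ffun i => inord (al i)].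
pose h' (al : {ffun 'I_n -> 'I_N'.+1}) : {ffun 'I_n -> 'I_N.+1} := [ffun i => inord (al i)].
have hE al i : h al i = al i :> nat.
  by rewrite ffunE inordK // (leq_trans (ltn_ord _)).
rewrite (reindex_onto h h') /=.
  apply: eq_big => [al|al _].
    apply/esym/andP; split; first by apply/forallP => i; rewrite hE -ltnS.
    by apply/eqP/ffunP => i; rewrite ffunE; apply: val_inj; rewrite /= inordK hE.
  by congr G; apply/funext => i; rewrite hE.
move=> al /forallP aN; apply/ffunP => i; apply: val_inj; rewrite /= hE ffunE inordK //.
by rewrite ltnS.
Qed.

End Cube.

Section Taylor.
Variables (R : realType) (n : nat).
Implicit Types (f : 'rV[R]_n -> R) (a y : 'rV[R]_n).

Lemma ball_row a (e : R) y : 0 < e ->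
  ball a e y <-> forall i, `|a ord0 i - y ord0 i| < e.
Proof.
move=> e0; split=> [ay i|ay].
  by case: ay => _ /(_ ord0 i).
by split=> // i j; rewrite ord1; exact: ay.
Qed.

(** A monomial outside the cube of side [N] has degree at least [N + 1], so the ratio [th]
    contributes the factor [th^(N+1)] relative to the absolute series at the corner [a + rho]. *)
Lemma pow_psum_dist (c : ('I_n -> nat) -> R) a y rho th N N' :
  (N <= N')%N -> 0 <= rho -> 0 <= th <= 1 ->
  (forall i, `|y ord0 i - a ord0 i| <= th * rho) ->
  `|pow_psum c a y N' - pow_psum c a y N| <=
    th ^+ N.+1 * abs_psum c a (\row_i (a ord0 i + rho)) N'.
Proof.
move=> NN' rho0 /andP[th0 th1] yth.
pose G (al : 'I_n -> nat) := c al * \prod_(i < n) (y ord0 i - a ord0 i) ^+ (al i).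
rewrite /pow_psum (cube_widen G NN') (bigID (fun al : {ffun 'I_n -> 'I_N'.+1} => [forall i, (al i <= N)%N])) /=.
rewrite addrAC subrr add0r (le_trans (ler_norm_sum _ _ _)) // /abs_psum big_distrr /=.
rewrite [leRHS](bigID (fun al : {ffun 'I_n -> 'I_N'.+1} => [forall i, (al i <= N)%N])) /=.
rewrite -[leLHS]add0r lerD //.
  rewrite sumr_ge0 // => al _; rewrite mulr_ge0 ?exprn_ge0 // mulr_ge0 // prodr_ge0 // => i _; exact: exprn_ge0.
apply: ler_sum => al /forallPn[i0]; rewrite -ltnNge => Ni0.
rewrite /G normrM mulrCA ler_wpM2l //.
rewrite normr_prod.
pose D := (\sum_(i < n) al i)%N.
have -> : th ^+ N.+1 * \prod_(i < n) `|(\row_i0 (a ord0 i0 + rho)) ord0 i - a ord0 i| ^+ al i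
   = th ^+ N.+1 * rho ^+ D.
  congr (_ * _); rewrite /D -prodrXr; apply: eq_bigr => i _.
  by rewrite mxE addrAC subrr add0r ger0_norm.
have : \prod_(i < n) `|(y ord0 i - a ord0 i) ^+ al i| <= th ^+ D * rho ^+ D.
  rewrite -exprMn /D -prodrXr; apply: ler_prod => i _.
  by rewrite normr_ge0 normrX /= lerXn2r // nnegrE mulr_ge0.
move=> /le_trans; apply; rewrite ler_wpM2r ?exprn_ge0 //.
by rewrite ler_wiXn2l // /D (bigD1 i0) //= (leq_trans Ni0) // leq_addr.
Qed.

Definition analytic_at f a := exists2 r : R, 0 < r &
  exists c : ('I_n -> nat) -> R, forall y, ball a r y ->
    (exists M : R, forall N, abs_psum c a y N <= M) /\
    (pow_psum c a y @ \oo --> f y).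

Lemma taylor f a : analytic_at f a ->
  exists (c : ('I_n -> nat) -> R) (rho M : R), [/\ 0 < rho,
    forall N, abs_psum c a (\row_i (a ord0 i + rho)) N <= M &
    forall (th : R) y, 0 <= th <= 1 -> (forall i, `|y ord0 i - a ord0 i| <= th * rho) ->
      forall N, `|f y - pow_psum c a y N| <= th ^+ N.+1 * M].
Proof.
(* Half the radius, so that the corner [a + rho], where the absolute series is bounded by [M], lies
   in the open ball. *)
move=> [r r0 [c Hc]]; pose rho := r / 2.
have rho0 : 0 < rho by rewrite divr_gt0.
have rhor : rho < r by rewrite ltr_pdivrMr // ltr_pMr // ltr1n.
have [|[M HM] _] := Hc (\row_i (a ord0 i + rho)).
  by apply/ball_row => // i; rewrite mxE opprD addrA subrr add0r normrN gtr0_norm.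
exists c, rho, M; split=> // th y thI yth N.
have [th0 th1] := andP thI.
have [|_ cy] := Hc y.
  apply/ball_row => // i; rewrite distrC (le_lt_trans (yth i)) //.
  by rewrite (le_lt_trans _ rhor) // ler_piMl // ltW.
apply/ler_addgt0Pl => e e0.
move/cvgrPdist_le: cy => /(_ e e0) [N0 _ HN0].
have := HN0 (maxn N N0) (leq_maxr _ _) => h1.
have h2 := pow_psum_dist c (leq_maxl N N0) (ltW rho0) thI yth.
have -> : f y - pow_psum c a y N = (f y - pow_psum c a y (maxn N N0)) +
  (pow_psum c a y (maxn N N0) - pow_psum c a y N) by rewrite addrA subrK.
rewrite (le_trans (ler_normD _ _)) // lerD // (le_trans h2) //.
by rewrite ler_wpM2l // exprn_ge0.
Qed.

End Taylor.

Section CurveZeros.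
Variables (R : realType) (n : nat).

(** A substitute for composing power series. If zeros accumulate at 0, the Taylor estimate at these
    zeros makes the numerator [G N] of the [N]-th partial sum divisible by [X^(N+1)]. Its majorant
    norm grows at most geometrically, so, as in Schwarz's lemma, its values at small [s] decay
    geometrically in [N], and [u] vanishes there. *)
Lemma analytic_curve_zeros (f : 'rV[R]_n -> R) a (d : 'I_n -> {poly R}) (b : {poly R}) :
  analytic_at f a -> (forall i, (d i).[0] = 0) -> b.[0] = 1 ->
  let u s := f (\row_i (a ord0 i + (d i).[s] / b.[s])) in
  (exists2 e : R, 0 < e & forall s : R, `|s| < e -> u s = 0) \/
  (exists2 e : R, 0 < e & forall s : R, 0 < `|s| < e -> u s != 0).
Proof.
move=> /taylor[c [r [M [r0 HM HT]]]] d0 b1 u.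
have [|nz] := pselect (exists2 e : R, 0 < e & forall s : R, 0 < `|s| < e -> u s != 0); first by right.
left.
have zs (e : R) : 0 < e -> exists s : R, [/\ 0 < `|s|, `|s| < e & u s = 0].
  move=> e0; apply: contrapT => H; apply: nz; exists e => // s /andP[s0 se].
  by apply/eqP => us; apply: H; exists s.
have M0 : 0 <= M.
  apply: le_trans (HM 0%N); rewrite sumr_ge0 // => al _; rewrite mulr_ge0 // prodr_ge0 //.
pose K := 1 + \sum_(i < n) pnorm 1 (d i) + pnorm 1 b.
have K1 : 1 <= K.
  by rewrite /K -addrA lerDl addr_ge0 ?pnorm_ge0 // sumr_ge0 // => i _; rewrite pnorm_ge0.
have K0 : 0 < K by rewrite (lt_le_trans _ K1).
have dK rho i : 0 <= rho <= 1 -> pnorm rho (d i) <= K * rho.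
  move=> /andP[rho0 rho1]; have [q qE] := poly_root0_factor (d0 i).
  rewrite qE -['X]expr1 pnormMXn // expr1 ler_wpM2r //.
  rewrite (le_trans (pnorm_homo _ _ rho1)) // -[pnorm 1 q]mulr1 -[X in _ * X](expr1 1).
  rewrite -pnormMXn // expr1 -qE /K -addrA addrCA (bigD1 i) //= -addrA lerDl.
  by rewrite !addr_ge0 ?pnorm_ge0 // sumr_ge0 // => j _; rewrite pnorm_ge0.
have [Kb Kb0 HKb] := horner_near0 b.
(* Since [d i] vanishes at 0, its norm at radius [rho] is at most [K * rho <= r], the radius at
   which the coefficients of [f] are summable. *)
pose rho := Num.min 1 (r / K).
have rho0 : 0 < rho by rewrite lt_min ltr01 divr_gt0.
have rho_ge0 := ltW rho0; have r_ge0 := ltW r0; have K_ge0 := ltW K0.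
have rho1 : rho <= 1 by rewrite ge_min lexx.
have rhor : K * rho <= r by rewrite mulrC -ler_pdivlMr // ge_min lexx orbT.
pose be := pnorm rho b.
have be1 : 1 <= be.
  by rewrite -[X in X <= _](normr1 R) -b1 horner_pnorm // ?normr0 ltW.
(* The [N]-th partial sum along the curve, multiplied by [b^(n N)]; this power suffices, as
   multi-indices in the cube have degree at most [n N]. *)
pose G N := \sum_(al : {ffun 'I_n -> 'I_N.+1})
  (c (fun i => al i))%:P * ((\prod_(i < n) d i ^+ al i) * b ^+ (n * N - \sum_(i < n) al i)).
have be_ge0 : 0 <= be by rewrite (le_trans ler01).
have alN N (al : {ffun 'I_n -> 'I_N.+1}) : (\sum_(i < n) al i <= n * N)%N.
  rewrite -[n in (n * _)%N]card_ord -sum_nat_const leq_sum // => i _.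
  by rewrite -ltnS.
have GE N (s : R) : b.[s] != 0 ->
  (G N).[s] = b.[s] ^+ (n * N) * pow_psum c a (\row_i (a ord0 i + (d i).[s] / b.[s])) N.
  move=> bs; rewrite /G horner_sum /pow_psum big_distrr /=; apply: eq_bigr => al _.
  rewrite !hornerM hornerC [RHS]mulrCA; congr (_ * _).
  rewrite -[in b.[s] ^+ (n * N)](subnK (alN N al)) exprD horner_exp -mulrA mulrC; congr (_ * _).
  rewrite horner_prod -prodrXr -big_split /=; apply: eq_bigr => i _.
  by rewrite mxE [a ord0 i + _]addrC addrK horner_exp -exprMn mulrC divfK.
have nG N : pnorm rho (G N) <= M * (be ^+ n) ^+ N.
  rewrite (le_trans (pnorm_sum _ _ _))  //.
  apply: (@le_trans _ _ (\sum_(al : {ffun 'I_n -> 'I_N.+1})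
     (`|c (fun i => al i)| * \prod_(i < n) r ^+ al i) * (be ^+ n) ^+ N)).
    apply: ler_sum => al _; rewrite (le_trans (pnormM _ _ _))  // pnormC -mulrA ler_wpM2l //.
    rewrite (le_trans (pnormM _ _ _))  // ler_pM ?pnorm_ge0  //.
      rewrite (le_trans (pnorm_prod _ _ _))  //; apply: ler_prod => i _.
      rewrite pnorm_ge0  //= (le_trans (pnorm_expn _ _ _))  //.
      rewrite lerXn2r ?nnegrE ?pnorm_ge0  // (le_trans _ rhor) // dK // rho1 andbT.
      exact: ltW.
    rewrite (le_trans (pnorm_expn _ _ _))  // -exprM ler_weXn2l //.
    by rewrite leq_subLR leq_addl.
  rewrite -big_distrl /= ler_wpM2r ?exprn_ge0 //.
  rewrite (le_trans _ (HM N)) // /abs_psum; apply: ler_sum => al _.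
  rewrite ler_wpM2l // ler_prod // => i _; rewrite exprn_ge0  //= mxE.
  by rewrite addrAC subrr add0r gtr0_norm.
pose e1 := Num.min rho (1 / (2 * (Kb + 1))).
have e10 : 0 < e1 by rewrite lt_min rho0 divr_gt0 // mulr_gt0 // ltr_wpDl.
have bs (s : R) : `|s| < e1 -> 2^-1 <= `|b.[s]|.
  rewrite lt_min => /andP[s1 s2].
  have sb : `|b.[s] - 1| <= Kb * `|s| by rewrite -b1 HKb // ltW // (lt_le_trans s1).
  have : Kb * `|s| <= 2^-1.
    rewrite (@le_trans _ _ ((Kb + 1) * `|s|)) ?ler_wpM2r ?lerDl //.
    have K1' : 0 < Kb + 1 by rewrite ltr_wpDl.
    rewrite mulrC -ler_pdivlMr //; apply: (le_trans (ltW s2)).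
    by rewrite invfM mul1r mulrC.
  have : 1 <= `|b.[s]| + `|b.[s] - 1|.
    by rewrite -[X in X <= _](normr1 R) -[X in `|X| <= _](subKr b.[s]) ler_normB.
  by move: sb; lra.
have e1rho : e1 <= rho by rewrite ge_min lexx.
clearbody e1.
(* With [|b| >= 1/2], the displacement [d i / b] is at most [2 K |s| = L |s| r], so [L |s|] plays
   the role of [th] in [taylor]. *)
pose L := 2 * K / r.
have L0 : 0 < L by rewrite divr_gt0 // mulr_gt0.
have L_ge0 := ltW L0.
have tay (s : R) N : `|s| < e1 -> L * `|s| <= 1 ->
    `|u s - pow_psum c a (\row_i (a ord0 i + (d i).[s] / b.[s])) N| <= (L * `|s|) ^+ N.+1 * M.
  move=> s1 Ls; apply: HT; first by rewrite Ls andbT mulr_ge0 // ltW.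
  move=> i; rewrite mxE addrAC subrr add0r normrM normfV.
  have b0 : 0 < `|b.[s]| by rewrite (lt_le_trans _ (bs _ s1)) // invr_gt0.
  have srho : `|s| <= 1.
    by rewrite ltW // (lt_le_trans s1) // (le_trans _ rho1).
  have ds : `|(d i).[s]| <= K * `|s|.
    by rewrite (le_trans (horner_pnorm _ _ (lexx _))) // dK // normr_ge0.
  rewrite ler_pdivrMr // (le_trans ds) // /L.
  have -> : 2 * K / r * `|s| * r * `|b.[s]| = K * `|s| * (2 * `|b.[s]|) by field; rewrite gt_eqF.
  rewrite ler_peMr ?mulr_ge0  //.
  by have := bs _ s1; lra.
have ord N : exists H, G N = H * 'X^(N.+1).
  apply: (@poly_order _ _ (be ^+ (n * N) * (L ^+ N.+1 * M))) => e e0.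
  have [|s [s0 + us]] := zs (Num.min e (Num.min e1 L^-1)).
    by rewrite !lt_min e0 e10 invr_gt0.
  rewrite !lt_min => /and3P[se s1 sL]; exists s; split=> //.
  have b0 : b.[s] != 0 by rewrite -normr_gt0 (lt_le_trans _ (bs _ s1)) // invr_gt0.
  rewrite GE // normrM normrX -mulrA ler_pM ?exprn_ge0 //.
    rewrite lerXn2r ?nnegrE ?normr_ge0 //.
    by rewrite horner_pnorm // ltW // (lt_le_trans s1).
  have := tay s N s1; rewrite us sub0r normrN => /(_ _)/le_trans; apply.
    by rewrite mulrC -ler_pdivlMr ?div1r // ltW.
  by rewrite exprMn mulrAC.
(* The growth rate in [N]: [be^n] comes from the norm of [G N], and [2^n] from dividing by
   [b^(n N)]. *)
pose B := 2 ^+ n * be ^+ n.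
have B0 : 0 < B.
  by rewrite mulr_gt0 ?exprn_gt0 // (lt_le_trans _ be1).
have B1 : 1 <= B.
  by rewrite -[X in X <= _]mulr1 ler_pM // exprn_ege1 // ler1n.
have B_ge0 := ltW B0.
pose e2 := Num.min e1 (Num.min (rho / (2 * B)) (2 * L)^-1).
have rB0 : 0 < rho / (2 * B) by rewrite divr_gt0 // mulr_gt0.
have L20 : 0 < (2 * L)^-1 by rewrite invr_gt0 mulr_gt0.
exists e2; first by rewrite !lt_min e10 rB0 L20.
move=> s; rewrite !lt_min => /and3P[s1 s2 s3].
have Ls : L * `|s| <= 2^-1.
  by rewrite mulrC -ler_pdivlMr // -invfM ltW.
have sB : `|s| / rho * B <= 2^-1.
  rewrite mulrAC ler_pdivrMr //.
  have B20 : 0 < 2 * B by rewrite mulr_gt0.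
  have : `|s| * (2 * B) <= rho by rewrite -ler_pdivlMr // ltW.
  by clearbody B; lra.
have small N : `|u s| <= 2 * M * 2^-1 ^+ N.+1.
  have [H HE] := ord N.
  have b0 : b.[s] != 0 by rewrite -normr_gt0 (lt_le_trans _ (bs _ s1)) // invr_gt0.
  have nH : pnorm rho H * rho ^+ N.+1 <= M * (be ^+ n) ^+ N.
    by rewrite -pnormMXn -?HE // ltW.
  have srho : `|s| <= rho by rewrite ltW // (lt_le_trans s1).
  have Gs : `|(G N).[s]| <= (`|s| / rho) ^+ N.+1 * (M * (be ^+ n) ^+ N).
    rewrite HE hornerM hornerXn normrM normrX expr_div_n mulrC -mulrA ler_wpM2l ?exprn_ge0 //.
    rewrite mulrC ler_pdivlMr ?exprn_gt0 // (le_trans _ nH) // ler_wpM2r ?exprn_ge0  //.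
    by rewrite horner_pnorm // ltW.
  have t1 : `|pow_psum c a (\row_i (a ord0 i + (d i).[s] / b.[s])) N| <= 2^-1 ^+ N.+1 * M.
    have bN0 : 0 < `|b.[s]| ^+ (n * N) by rewrite exprn_gt0 // normr_gt0.
    rewrite -(ler_pM2l bN0) -normrX -normrM -GE // (le_trans Gs) // normrX.
    have h2 : 2^-1 ^+ (n * N) <= `|b.[s]| ^+ (n * N).
      by rewrite lerXn2r ?nnegrE ?invr_ge0 ?normr_ge0 // bs.
    have ih0 : 0 <= 2^-1 :> R by rewrite invr_ge0.
    have h3 : 2^-1 ^+ (n * N) * (2^-1 ^+ N.+1 * M) <= `|b.[s]| ^+ (n * N) * (2^-1 ^+ N.+1 * M).
      by rewrite ler_wpM2r // mulr_ge0 // exprn_ge0.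
    apply: le_trans h3.
    have h4 : (`|s| / rho) ^+ N.+1 * B ^+ N <= 2^-1 ^+ N.+1.
      rewrite (@le_trans _ _ ((`|s| / rho) ^+ N.+1 * B ^+ N.+1)) //.
        by rewrite ler_wpM2l ?exprn_ge0 ?divr_ge0  // ler_weXn2l.
      by rewrite -exprMn lerXn2r // nnegrE // mulr_ge0 // divr_ge0.
    have -> : (`|s| / rho) ^+ N.+1 * (M * (be ^+ n) ^+ N) =
        2^-1 ^+ (n * N) * ((`|s| / rho) ^+ N.+1 * B ^+ N * M).
      set x := (_ / _) ^+ _; rewrite /B exprMn -!exprM; set y := be ^+ _.
      have : 2^-1 ^+ (n * N) * 2 ^+ (n * N) = 1 :> R by rewrite -exprMn mulVf ?expr1n.
      set z := 2^-1 ^+ _; set w := 2 ^+ (n * N) => zw.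
      have -> : z * (x * (w * y) * M) = (z * w) * (x * (M * y)) by ring.
      by rewrite zw mul1r.
    by rewrite ler_wpM2l ?exprn_ge0 ?invr_ge0 // ler_wpM2r.
  have := tay s N s1; rewrite (le_trans Ls) ?invf_le1 ?ler1n // => /(_ isT) t2.
  have t3 : (L * `|s|) ^+ N.+1 * M <= 2^-1 ^+ N.+1 * M.
    by rewrite ler_wpM2r // lerXn2r ?nnegrE ?mulr_ge0 ?invr_ge0 .
  have := ler_normD (u s - pow_psum c a (\row_i (a ord0 i + (d i).[s] / b.[s])) N)
    (pow_psum c a (\row_i (a ord0 i + (d i).[s] / b.[s])) N).
  by rewrite subrK; lra.
apply/eqP; rewrite -normr_le0 leNgt; apply/negP => us0.
pose N := Num.bound (2 * M / `|u s|).
have : 2 * M / `|u s| < N%:R by rewrite archi_boundP // divr_ge0 // mulr_ge0.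
rewrite ltr_pdivrMr // ltNge => /negP; apply.
have N2 : N%:R <= (2 : R) ^+ N.+1.
  by rewrite -natrX ler_nat (leq_trans (ltnW (ltn_expl N (ltnSn 1)))) // leq_exp2l.
apply: (le_trans (y := 2 ^+ N.+1 * `|u s|)); first by rewrite ler_wpM2r.
rewrite -ler_pdivlMl ?exprn_gt0 // mulrC -exprVn; exact: small.
Qed.

(* The parameters at which the composite vanishes identically nearby form an open and closed set. *)
Lemma analytic_curve_domain (f g : 'rV[R]_n -> R) (N : 'I_n -> {poly R}) (h : {poly R}) :
  (forall t, h.[t] != 0) ->
  let x t := \row_i ((N i).[t] / h.[t]) in
  (forall t, analytic_at f (x t)) -> (forall t, analytic_at g (x t)) ->
  (forall t, f (x t) * g (x t) = 0) ->
  (forall t, f (x t) = 0) \/ (forall t, g (x t) = 0).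
Proof.
move=> h0 x fx gx fg0.
have local (u : 'rV[R]_n -> R) t : analytic_at u (x t) ->
    (exists2 e : R, 0 < e & forall s : R, `|s - t| < e -> u (x s) = 0) \/
    (exists2 e : R, 0 < e & forall s : R, 0 < `|s - t| < e -> u (x s) != 0).
  move=> ut.
  (* The curve recentred at [t] and normalized, so that [d i] is 0 and [b] is 1 at the origin. *)
  pose d i := (h.[t])^-1 *: ((N i - (x t ord0 i)%:P * h) \Po ('X + t%:P)).
  pose b := (h.[t])^-1 *: (h \Po ('X + t%:P)).
  have xE s : \row_i (x t ord0 i + (d i).[s - t] / b.[s - t]) = x s.
    apply/rowP => i; rewrite !mxE /d /b !hornerZ !horner_comp !hornerE /= !mxE subrK.
    by field; rewrite !h0.
  have [||[e e0 ez]|[e e0 ez]] := analytic_curve_zeros ut (d := d) (b := b).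
  - by move=> i; rewrite hornerZ horner_comp !hornerE /= mxE; field; rewrite h0.
  - by rewrite hornerZ horner_comp !hornerE /= mulVf.
  - by left; exists e => // s st; rewrite -xE ez.
  - by right; exists e => // s st; rewrite -xE ez.
pose A := [set t | exists2 e : R, 0 < e & forall s : R, `|s - t| < e -> f (x s) = 0].
have Aopen : open A.
  rewrite openE => t [e e0 te]; apply/nbhs_ballP; exists (e / 2); first by rewrite /= divr_gt0.
  move=> t' tt'; exists (e / 2); first by rewrite divr_gt0.
  move=> s st'; apply: te; rewrite [e]splitr -(subrK t' s) -addrA.
  by rewrite (le_lt_trans (ler_normD _ _)) // ltrD // distrC.
have Aclosed : closed A.
  rewrite -openC openE => t nAt; have [//|[e e0 te]] := local f t (fx t).
  apply/nbhs_ballP; exists e => // t' tt' [e' e'0 te'].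
  have [tt|tt] := eqVneq t' t; first by apply: nAt; rewrite -tt; exists e'.
  have fz : f (x t') = 0 by apply: te'; rewrite subrr normr0.
  have t'e : `|t' - t| < e by rewrite distrC.
  by have := te t'; rewrite normr_gt0 subr_eq0 tt t'e => /(_ isT); rewrite fz eqxx.
have [A0|A0] := pselect (A !=set0).
  left=> t; have AT : A = setT.
    have : connected [set: R] by apply/connected_intervalP => a b _ _ c _.
    apply => //.
    - by exists A => //; rewrite setTI.
    - by exists A => //; rewrite setTI.
  have [e e0] : A t by rewrite AT.
  by apply; rewrite subrr normr0.
right=> t; have [At|[e e0 te]] := local f t (fx t); first by exfalso; apply: A0; exists t.
have [[e' e'0 te']|[e' e'0 te']] := local g t (gx t).
  by apply: te'; rewrite subrr normr0.
exfalso; pose s := t + Num.min e e' / 2.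
have m0 : 0 < Num.min e e' by rewrite lt_min e0.
have m2 : Num.min e e' / 2 < Num.min e e' by rewrite ltr_pdivrMr // ltr_pMr // ltr1n.
have st : `|s - t| = Num.min e e' / 2.
  by rewrite /s addrAC subrr add0r gtr0_norm // divr_gt0.
have s0 : 0 < `|s - t| by rewrite st divr_gt0.
have /negP[] : f (x s) * g (x s) != 0; last by rewrite fg0.
rewrite mulf_neq0 ?te ?te' // s0 st (lt_le_trans m2) // ge_min lexx ?orbT //.
Qed.

End CurveZeros.

Lemma sum_support (R : numDomainType) (I : eqType) (r s : seq I) (G : I -> R) :
  uniq r -> uniq s -> {subset s <= r} -> (forall m, m \notin s -> G m = 0) ->
  \sum_(m <- r) G m = \sum_(m <- s) G m.
Proof.
move=> ur us sr G0; rewrite (bigID (mem s)) /= [X in _ + X]big1 ?addr0 => [|m /G0 //].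
rewrite -big_filter; apply: perm_big; apply: uniq_perm; rewrite ?filter_uniq //.
by move=> m; rewrite mem_filter; case: (boolP (m \in s)) => // /sr.
Qed.

Lemma sum_support_le (R : numDomainType) (I : eqType) (r s : seq I) (G : I -> R) :
  uniq r -> uniq s -> (forall m, m \notin s -> G m = 0) -> (forall m, 0 <= G m) ->
  \sum_(m <- r) G m <= \sum_(m <- s) G m.
Proof.
move=> ur us G0 Gp; rewrite (bigID (mem s)) /= [X in _ + X]big1 ?addr0 => [|m /G0 //].
rewrite [leRHS](bigID (mem r)) /= -[leLHS]addr0 lerD ?sumr_ge0 //.
rewrite le_eqVlt; apply/orP; left; apply/eqP.
rewrite -big_filter -[RHS]big_filter; apply: perm_big; apply: uniq_perm; rewrite ?filter_uniq //.
by move=> m; rewrite !mem_filter andbC.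
Qed.

(** * Square roots of positive polynomials are Nash *)

Section MultiNorm.
Variables (R : realType) (n : nat) (rho : R).
Hypothesis rho0 : 0 <= rho.
Implicit Types p q : mpol R n.

Definition mnorm p : R :=
  \sum_(m <- mpoly.msupp p) `|mpoly.mcoeff m p| * rho ^+ mpoly.mdeg m.

Lemma mnormE p r : uniq r -> {subset mpoly.msupp p <= r} ->
  mnorm p = \sum_(m <- r) `|mpoly.mcoeff m p| * rho ^+ mpoly.mdeg m.
Proof.
move=> ur pr; apply/esym/sum_support => // m mp.
by rewrite mpoly.memN_msupp_eq0 // normr0 mul0r.
Qed.

Lemma mnorm_ge0 p : 0 <= mnorm p.
Proof. by rewrite sumr_ge0 // => m _; rewrite mulr_ge0 ?exprn_ge0. Qed.

Lemma mnormD p q : mnorm (p + q) <= mnorm p + mnorm q.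
Proof.
pose r := undup (mpoly.msupp p ++ mpoly.msupp q).
have ur : uniq r by exact: undup_uniq.
rewrite !(@mnormE _ r) //.
- rewrite -big_split /=; apply: ler_sum => m _.
  by rewrite mpoly.mcoeffD -mulrDl ler_wpM2r ?exprn_ge0 // ler_normD.
- by move=> m mq; rewrite mem_undup mem_cat mq orbT.
- by move=> m mp; rewrite mem_undup mem_cat mp.
- by move=> m /mpoly.msuppD_le; rewrite mem_undup.
Qed.

Lemma mnorm0 : mnorm 0 = 0.
Proof. by rewrite /mnorm mpoly.msupp0 big_nil. Qed.

Lemma mnorm_sum (I : Type) (r : seq I) (F : I -> mpol R n) :
  mnorm (\sum_(i <- r) F i) <= \sum_(i <- r) mnorm (F i).
Proof.
elim: r => [|i r IHr]; first by rewrite !big_nil mnorm0.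
by rewrite !big_cons (le_trans (mnormD _ _)) // lerD2l.
Qed.

Lemma mnormZX c m : mnorm (c *: mpoly.mpolyX R m) = `|c| * rho ^+ mpoly.mdeg m.
Proof.
rewrite (@mnormE _ [:: m]) ?big_seq1 ?mpoly.mcoeffZ ?mpoly.mcoeffX ?eqxx ?mulr1 //.
by move=> m' /mpoly.msuppZ_le; rewrite mpoly.msuppX.
Qed.

Lemma mnormM p q : mnorm (p * q) <= mnorm p * mnorm q.
Proof.
rewrite {1}(mpoly.mpolyE p) {1}(mpoly.mpolyE q) big_distrl /=.
rewrite (le_trans (mnorm_sum _ _)) // [leRHS]big_distrl /=; apply: ler_sum => a _.
rewrite big_distrr /= (le_trans (mnorm_sum _ _)) // [leRHS]big_distrr /=; apply: ler_sum => b _.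
rewrite -scalerAl -scalerAr scalerA -mpoly.mpolyXD mnormZX normrM mpoly.mdegD exprD.
by rewrite mulrACA.
Qed.

Lemma mnormZ c p : mnorm (c *: p) <= `|c| * mnorm p.
Proof.
rewrite -mpoly.mul_mpolyC (le_trans (mnormM _ _)) // ler_wpM2r ?mnorm_ge0 //.
rewrite /mnorm mpoly.msuppC; case: eqP => [->|_]; first by rewrite big_nil.
by rewrite big_seq1 mpoly.mdeg0 expr0 mulr1 mpoly.mcoeffC eqxx mulr1.
Qed.

Lemma mnormN p : mnorm (- p) <= mnorm p.
Proof. by rewrite -scaleN1r (le_trans (mnormZ _ _)) // normrN1 mul1r. Qed.

Lemma mev_mnorm p (z : 'rV[R]_n) : (forall i, `|z ord0 i| <= rho) -> `|mev p z| <= mnorm p.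
Proof.
move=> zr; rewrite mevE (le_trans (ler_norm_sum _ _ _)) // ler_sum // => m _.
rewrite normrM ler_wpM2l // normr_prod mpoly.mdegE -prodrXr ler_prod // => i _.
by rewrite normr_ge0 normrX lerXn2r // nnegrE.
Qed.

Definition mord k p := forall m, (mpoly.mdeg m < k)%N -> mpoly.mcoeff m p = 0.

Lemma mordD k p q : mord k p -> mord k q -> mord k (p + q).
Proof. by move=> kp kq m mk; rewrite mpoly.mcoeffD kp ?kq ?addr0. Qed.

Lemma mordZ k c p : mord k p -> mord k (c *: p).
Proof. by move=> kp m mk; rewrite mpoly.mcoeffZ kp ?mulr0. Qed.

Lemma mordM k l p q : mord k p -> mord l q -> mord (k + l) (p * q).
Proof.
move=> kp lq m mkl; apply/eqP; rewrite mpoly.mcoeff_eq0; apply/negP => /mpoly.msuppM_le.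
move=> /allpairsP[[a b] /= [ap bq mE]]; move: mkl; rewrite mE mpoly.mdegD ltnNge.
rewrite leq_add //.
  by rewrite leqNgt; apply: contraL ap => /kp ak; rewrite -mpoly.mcoeff_eq0 ak.
by rewrite leqNgt; apply: contraL bq => /lq bk; rewrite -mpoly.mcoeff_eq0 bk.
Qed.

Lemma mord0 p : mord 0 p. Proof. by []. Qed.

Lemma mord_le k l p : (k <= l)%N -> mord l p -> mord k p.
Proof. by move=> kl lp m mk; apply: lp; exact: leq_trans kl. Qed.

Definition cube_mnm N (al : {ffun 'I_n -> 'I_N.+1}) : mpoly.multinom n :=
  mpoly.Multinom [tuple (al i : nat) | i < n].

Lemma cube_mnmE N (al : {ffun 'I_n -> 'I_N.+1}) i : cube_mnm al i = al i.
Proof. by rewrite mpoly.mnmE. Qed.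

Lemma cube_mdeg N (al : {ffun 'I_n -> 'I_N.+1}) : mpoly.mdeg (cube_mnm al) = (\sum_(i < n) al i)%N.
Proof. by rewrite mpoly.mdegE; apply: eq_bigr => i _; rewrite cube_mnmE. Qed.

Lemma cube_mnm_inj N : injective (@cube_mnm N).
Proof.
move=> al be e; apply/ffunP => i; apply: val_inj => /=.
by rewrite -!cube_mnmE e.
Qed.

Definition cube_seq N := [seq @cube_mnm N al | al <- index_enum _].

Lemma cube_seq_uniq N : uniq (cube_seq N).
Proof. by rewrite map_inj_uniq ?index_enum_uniq //; exact: cube_mnm_inj. Qed.

Lemma mem_cube_seq N (m : mpoly.multinom n) : (mpoly.mdeg m <= N)%N -> m \in cube_seq N.
Proof.
move=> mN; apply/mapP; exists [ffun i => inord (m i)]; first by rewrite mem_index_enum.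
apply/mpoly.mnmP => i; rewrite cube_mnmE ffunE inordK // ltnS (leq_trans _ mN) //.
by rewrite mpoly.mdegE (bigD1 i) //= leq_addr.
Qed.

Lemma mev_cube N p (z : 'rV[R]_n) : (forall m, m \in mpoly.msupp p -> (mpoly.mdeg m <= N)%N) ->
  \sum_(al : {ffun 'I_n -> 'I_N.+1}) mpoly.mcoeff (cube_mnm al) p * \prod_(i < n) z ord0 i ^+ al i
  = mev p z.
Proof.
move=> pN; rewrite mevE.
pose G (m : mpoly.multinom n) := mpoly.mcoeff m p * \prod_(i < n) z ord0 i ^+ m i.
rewrite -(@sum_support _ _ (cube_seq N) _ G) //.
- rewrite big_map; apply: eq_bigr => al _; rewrite /G; congr (_ * _).
  by apply: eq_bigr => i _; rewrite cube_mnmE.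
- exact: cube_seq_uniq.
- by move=> m /pN; exact: mem_cube_seq.
- by move=> m mp; rewrite /G mpoly.memN_msupp_eq0 // mul0r.
Qed.

Lemma mnorm_cube N p : \sum_(al : {ffun 'I_n -> 'I_N.+1})
  `|mpoly.mcoeff (cube_mnm al) p| * rho ^+ (\sum_(i < n) al i)%N <= mnorm p.
Proof.
pose G (m : mpoly.multinom n) := `|mpoly.mcoeff m p| * rho ^+ mpoly.mdeg m.
rewrite (_ : \sum_(al : {ffun 'I_n -> 'I_N.+1}) _ = \sum_(m <- cube_seq N) G m); last first.
  by rewrite big_map; apply: eq_bigr => al _; rewrite /G cube_mdeg.
apply: sum_support_le.
- exact: cube_seq_uniq.
- exact: mpoly.msupp_uniq.
- by move=> m mp; rewrite /G mpoly.memN_msupp_eq0 // normr0 mul0r.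
- by move=> m; rewrite mulr_ge0 ?exprn_ge0.
Qed.

End MultiNorm.

Section SeriesAnalytic.
Variables (R : realType) (n : nat).

Lemma sum_half (K M : nat) : \sum_(K <= k < M) (2^-1 : R) ^+ k <= 2 * 2^-1 ^+ K.
Proof.
have [MK|KM] := leqP M K.
  by rewrite big_geq // mulr_ge0 // exprn_ge0 // invr_ge0.
suff : \sum_(K <= k < M) (2^-1 : R) ^+ k = 2 * 2^-1 ^+ K - 2 * 2^-1 ^+ M.
  by move=> ->; rewrite gerBl mulr_ge0 // exprn_ge0 // invr_ge0.
elim: M KM => // M IHM; rewrite ltnS => KM; rewrite big_nat_recr //=.
move: KM; rewrite leq_eqVlt => /predU1P[->|KM].
  by rewrite big_geq // exprS; field.
by rewrite IHM // exprS; field.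
Qed.

(** As [p k] has order at least [k], each Taylor coefficient receives finitely many contributions.
    The geometric bound on the norms gives absolute convergence and allows the rearrangement of the
    double sum. *)
Lemma series_analytic (p : nat -> mpol R n) (rho C : R) a f :
  (0 < n)%N -> 0 < rho -> 0 <= C ->
  (forall k, mord k (p k)) -> (forall k, mnorm rho (p k) <= C * 2^-1 ^+ k) ->
  (forall z : 'rV[R]_n, (forall i, `|z ord0 i| <= rho) -> forall K,
     `|f (a + z) - \sum_(k < K) mev (p k) z| <= C * 2^-1 ^+ K) ->
  analytic_at f a.
Proof.
move=> n0 rho0 C0 ordp nrmp fp; have rho_ge0 := ltW rho0.
exists rho => //.
pose mn (al : 'I_n -> nat) : mpoly.multinom n := mpoly.Multinom [tuple al i | i < n].
pose c (al : 'I_n -> nat) := \sum_(k < (\sum_(i < n) al i).+1) mpoly.mcoeff (mn al) (p k).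
have cE N (al : {ffun 'I_n -> 'I_N.+1}) :
    c (fun i => al i) = \sum_(k < (n * N).+1) mpoly.mcoeff (cube_mnm al) (p k).
  have alN : ((\sum_(i < n) al i).+1 <= (n * N).+1)%N.
    rewrite ltnS -[n in (n * _)%N]card_ord -sum_nat_const leq_sum // => i _.
    by rewrite -ltnS.
  rewrite /c (big_ord_widen _ (fun k => mpoly.mcoeff (mn (fun i => al i)) (p k)) alN) big_mkcond /=.
  apply: eq_bigr => k _; case: ifP => //.
  by move=> /negbT; rewrite -leqNgt => alk; rewrite ordp // cube_mdeg.
exists c => y /ball_row - /(_ rho0) ya.
pose z := y - a; have yE : y = a + z by rewrite addrC subrK.
have zE i : z ord0 i = y ord0 i - a ord0 i by rewrite !mxE.
have zr i : `|z ord0 i| <= rho by rewrite zE distrC ltW.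
split.
  exists (2 * C) => N.
  apply: (@le_trans _ _ (\sum_(k < (n * N).+1) mnorm rho (p k))).
    rewrite /abs_psum.
    apply: (@le_trans _ _ (\sum_(al : {ffun 'I_n -> 'I_N.+1}) \sum_(k < (n * N).+1)
       `|mpoly.mcoeff (cube_mnm al) (p k)| * rho ^+ (\sum_(i < n) al i)%N)).
      apply: ler_sum => al _; rewrite cE -big_distrl /= ler_pM ?prodr_ge0 //.
      - by rewrite (le_trans (ler_norm_sum _ _ _)).
      - rewrite -prodrXr ler_prod // => i _.
        by rewrite exprn_ge0 //= -zE lerXn2r // nnegrE.
    by rewrite exchange_big /=; apply: ler_sum => k _; exact: mnorm_cube.
  apply: (@le_trans _ _ (\sum_(k < (n * N).+1) C * 2^-1 ^+ k)).
    by apply: ler_sum => k _.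
  rewrite -big_distrr /= [2 * C]mulrC ler_wpM2l //.
  rewrite -(big_mkord predT (fun k => (2^-1 : R) ^+ k)).
  by rewrite (le_trans (sum_half _ _)) // expr0 mulr1.
pose T k N := \sum_(al : {ffun 'I_n -> 'I_N.+1})
  mpoly.mcoeff (cube_mnm al) (p k) * \prod_(i < n) z ord0 i ^+ al i.
have psumE N : pow_psum c a y N = \sum_(0 <= k < (n * N).+1) T k N.
  rewrite big_mkord /T exchange_big /=; apply: eq_bigr => al _.
  rewrite cE -big_distrl /=; congr (_ * _).
  by apply: eq_bigr => i _; rewrite zE.
have Tle k N : `|T k N| <= C * 2^-1 ^+ k.
  apply: le_trans (nrmp k); apply: le_trans (mnorm_cube rho_ge0 N (p k)).
  rewrite (le_trans (ler_norm_sum _ _ _)) //; apply: ler_sum => al _.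
  rewrite normrM ler_wpM2l // normr_prod -prodrXr ler_prod // => i _.
  by rewrite normr_ge0 normrX lerXn2r // nnegrE.
have TE k : exists N0, forall N, (N0 <= N)%N -> T k N = mev (p k) z.
  exists (\max_(m <- mpoly.msupp (p k)) mpoly.mdeg m)%N => N N0N; apply: mev_cube => m mp.
  by apply: leq_trans N0N; rewrite (big_rem m mp) leq_maxl.
have TEK K : exists N0, forall N k, (N0 <= N)%N -> (k < K)%N -> T k N = mev (p k) z.
  elim: K => [|K [N0 HN0]]; first by exists 0%N.
  have [N1 HN1] := TE K; exists (maxn N0 N1) => N k; rewrite geq_max => /andP[N0N N1N].
  by rewrite ltnS leq_eqVlt => /predU1P[->|kK]; [exact: HN1|exact: HN0].
apply/cvgrPdist_le => e e0; have e_ge0 := ltW e0.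
(* One [C] is for the distance from [f] to the first [K] terms, two for the geometric tail. *)
have [K HK] : exists K, 3 * C * 2^-1 ^+ K <= e.
  pose K := Num.bound (3 * C / e); exists K.
  have : 3 * C / e < K%:R by rewrite archi_boundP // divr_ge0 ?mulr_ge0.
  rewrite ltr_pdivrMr // => h; rewrite exprVn ler_pdivrMr ?exprn_gt0 //.
  rewrite (le_trans (ltW h)) // mulrC ler_wpM2l // -natrX ler_nat.
  exact/ltnW/ltn_expl.
have [N0 HN0] := TEK K.
exists (maxn N0 K) => // N /=; rewrite geq_max => /andP[N0N KN].
rewrite psumE.
have KnN : (K <= (n * N).+1)%N by rewrite leqW // (leq_trans KN) // leq_pmull.
rewrite (big_cat_nat _ _ (n := K)) //= opprD addrA.
rewrite (le_trans (ler_normD _ _)) // normrN.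
have h1 : `|f y - \sum_(0 <= k < K) T k N| <= C * 2^-1 ^+ K.
  rewrite big_mkord (eq_bigr (fun k : 'I_K => mev (p k) z)); last by move=> k _; exact: HN0.
  by rewrite yE; exact: fp.
have h2 : `|\sum_(K <= k < (n * N).+1) T k N| <= 2 * C * 2^-1 ^+ K.
  rewrite (le_trans (ler_norm_sum _ _ _)) //.
  rewrite (@le_trans _ _ (\sum_(K <= k < (n * N).+1) C * 2^-1 ^+ k)) ?ler_sum //.
  by rewrite -big_distrr /= [2 * C]mulrC -mulrA ler_wpM2l // sum_half.
by rewrite (le_trans (lerD h1 h2)) // (le_trans _ HK) // -mulrDl; lra.
Qed.

End SeriesAnalytic.

Section SqrtAnalytic.
Variables (R : realType) (n : nat).
Implicit Types p : mpol R n.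

Lemma mev0_coef p : mev p 0 = mpoly.mcoeff (mpoly.mnm0 : mpoly.multinom n) p.
Proof.
pose G (m : mpoly.multinom n) : R := mpoly.mcoeff m p * \prod_(i < n) (0 : 'rV[R]_n) ord0 i ^+ m i.
pose r := undup ((mpoly.mnm0 : mpoly.multinom n) :: mpoly.msupp p).
rewrite mevE -(@sum_support _ _ r _ G) ?undup_uniq //.
- rewrite (@sum_support _ _ r [:: (mpoly.mnm0 : mpoly.multinom n)] G) ?undup_uniq //.
  + rewrite big_seq1 /G big1 ?mulr1 // => i _.
    by rewrite mpoly.mnm0E expr0.
  + by move=> m; rewrite inE => /eqP ->; rewrite mem_undup mem_head.
  + move=> m; rewrite inE -mpoly.mdeg_eq0 mpoly.mdegE sum_nat_eq0 => /forallPn[i] /= mi.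
    by rewrite /G (bigD1 i) //= mxE expr0n (negbTE mi) mul0r mulr0.
- by move=> m mp; rewrite mem_undup in_cons mp orbT.
- by move=> m mp; rewrite /G mpoly.memN_msupp_eq0 // mul0r.
Qed.

Lemma mnorm_ord1 (rho : R) p : 0 <= rho <= 1 -> mord 1 p -> mnorm rho p <= rho * mnorm 1 p.
Proof.
move=> /andP[rho0 rho1] p1; rewrite /mnorm big_distrr /= big_seq [leRHS]big_seq.
apply: ler_sum => m mp; rewrite expr1n mulr1 mulrC ler_wpM2r //.
case: (mpoly.mdeg m) (p1 m) => [/(_ (ltnSn 0)) p0|k _].
  by move: mp; rewrite mpoly.mcoeff_msupp p0 eqxx.
by rewrite exprS ler_piMr // exprn_ile1.
Qed.

(** Fixed-point iteration for [(1 + v)^2 = 1 + u], rewritten as [v = (u - v^2) / 2]. *)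
Definition sqrt_iter (u : mpol R n) k : mpol R n :=
  iter k (fun v => 2^-1 *: (u - v * v)) 0.

Lemma sqrt_iterS u k :
  sqrt_iter u k.+1 = 2^-1 *: (u - sqrt_iter u k * sqrt_iter u k).
Proof. by []. Qed.

Lemma sqrt_iter_diff u k : sqrt_iter u k.+2 - sqrt_iter u k.+1 =
  - 2^-1 *: ((sqrt_iter u k.+1 - sqrt_iter u k) * (sqrt_iter u k.+1 + sqrt_iter u k)).
Proof.
rewrite (sqrt_iterS u k.+1) [X in _ - X](sqrt_iterS u k) -scalerBr scaleNr -scalerN.
by congr (_ *: _); ring.
Qed.

Lemma sqrt_iter_mord u k : mord 1 u -> mord 1 (sqrt_iter u k).
Proof.
move=> u1; elim: k => [|k IHk]; first by move=> m _; rewrite mpoly.mcoeff0.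
rewrite sqrt_iterS; apply/mordZ/mordD => //.
rewrite -scaleN1r; apply: mordZ; apply: mord_le (mordM IHk IHk) => //.
Qed.

(** Each difference is the previous one times a sum of iterates, which has no constant term; every
    step therefore gains one order. *)
Lemma sqrt_iter_diff_mord u k : mord 1 u -> mord k.+1 (sqrt_iter u k.+1 - sqrt_iter u k).
Proof.
move=> u1; elim: k => [|k IHk].
  rewrite -scaleN1r; apply: mordD; first exact: sqrt_iter_mord.
  by apply: mordZ; exact: sqrt_iter_mord.
rewrite sqrt_iter_diff; apply: mordZ; rewrite -addn1; apply: mordM => //.
by apply: mordD; exact: sqrt_iter_mord.
Qed.

Section Norms.
Variables (rho : R) (u : mpol R n).
Hypotheses (rho0 : 0 <= rho) (u4 : mnorm rho u <= 4^-1).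

(** The bound [4^-1] on [u] keeps the iterates in the ball of radius 1/2, because
    [(1/4 + 1/4) / 2 <= 1/2]; on this ball the iteration contracts by the factor 1/2. *)
Lemma sqrt_iter_norm k : mnorm rho (sqrt_iter u k) <= 2^-1.
Proof.
elim: k => [|k IHk]; first by rewrite mnorm0.
rewrite sqrt_iterS (le_trans (mnormZ _ _ _)) // ger0_norm //.
have h1 := mnormD rho0 u (- (sqrt_iter u k * sqrt_iter u k)).
have h2 := mnormN rho0 (sqrt_iter u k * sqrt_iter u k).
have h3 := mnormM rho0 (sqrt_iter u k) (sqrt_iter u k).
have h4 := mnorm_ge0 rho0 (sqrt_iter u k).
have h5 : mnorm rho (sqrt_iter u k) * mnorm rho (sqrt_iter u k) <= 2^-1 * 2^-1 by rewrite ler_pM.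
rewrite ler_piMr // (le_trans h1) // (le_trans (lerD u4 (le_trans h2 (le_trans h3 h5)))) //.
by lra.
Qed.

Lemma sqrt_iter_diff_norm k : mnorm rho (sqrt_iter u k.+1 - sqrt_iter u k) <= 2^-1 ^+ k * 8^-1.
Proof.
elim: k => [|k IHk].
  rewrite expr0 mul1r sqrt_iterS /= mul0r !subr0 (le_trans (mnormZ _ _ _)) // ger0_norm //.
  have -> : 8^-1 = 2^-1 * 4^-1 :> R by field.
  by rewrite ler_wpM2l.
rewrite sqrt_iter_diff (le_trans (mnormZ _ _ _)) // normrN ger0_norm // exprS -mulrA ler_wpM2l //.
rewrite (le_trans (mnormM _ _ _)) // -[leRHS]mulr1 ler_pM ?mnorm_ge0 //.
rewrite (le_trans (mnormD _ _ _)) //.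
by have := sqrt_iter_norm k; have := sqrt_iter_norm k.+1; lra.
Qed.

Lemma sqrt_iter_cvg (z : 'rV[R]_n) (ze : R) k : (forall i, `|z ord0 i| <= rho) ->
  ze = 2^-1 * (mev u z - ze * ze) -> `|ze| <= 2^-1 ->
  `|ze - mev (sqrt_iter u k) z| <= 2^-1 ^+ k.
Proof.
move=> zr zE z1; elim: k => [|k IHk].
  rewrite expr0 /mev mpoly.meval0 subr0 (le_trans z1) //; lra.
rewrite sqrt_iterS /mev mpoly.mevalZ mpoly.mevalB mpoly.mevalM -/(mev _ _) -/(mev _ _).
set w := mev (sqrt_iter u k) z in IHk *.
have -> : ze - 2^-1 * (mev u z - w * w) = - (2^-1 * ((ze - w) * (ze + w))).
  by rewrite {1}zE; ring.
rewrite normrN normrM ger0_norm // exprS ler_wpM2l // normrM -[leRHS]mulr1 ler_pM //.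
have h : `|w| <= 2^-1 by rewrite (le_trans (mev_mnorm _ _ zr)) // sqrt_iter_norm.
by rewrite (le_trans (ler_normD _ _)) //; lra.
Qed.

End Norms.

(** Near [a] write [B = B(a) (1 + u)] with [u] zero at [a]. The square root of [1 + u] is 1 plus the
    limit of the iterates, whose successive differences have growing order and geometrically
    decreasing norm. *)
Lemma analytic_sqrt (P A B : mpol R n) a : (0 < n)%N -> 0 < mev B a ->
  analytic_at (fun x => mev P x * Num.sqrt (mev B x) + mev A x) a.
Proof.
move=> n0 B0.
have trans (Q : mpol R n) : exists Q', forall z, mev Q' z = mev Q (a + z).
  have [Q' Q'E] : polyfun (fun z => mev Q (a + z)).
    apply: polyfun_comp; first exact: polyfun_mev.
    move=> i; under eq_fun do rewrite mxE.
    by apply: polyfunD; [exact: polyfun_cst|exact: polyfun_coord].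
  by exists Q'.
have [Pt PtE] := trans P; have [At AtE] := trans A; have [Bt BtE] := trans B.
set be := mev B a in B0; pose sb := Num.sqrt be.
have sb0 : 0 <= sb by exact: sqrtr_ge0.
pose u : mpol R n := be^-1 *: Bt - 1.
have uE z : mev u z = be^-1 * mev B (a + z) - 1.
  by rewrite -BtE /mev mpoly.mevalB mpoly.mevalZ mpoly.meval1.
have u1 : mord 1 u.
  move=> m; rewrite ltnS leqn0 mpoly.mdeg_eq0 => /eqP ->.
  by rewrite -mev0_coef uE addr0 mulVf ?subrr // gt_eqF.
(* Having no constant term, [u] has norm at most [rho * mnorm 1 u] at a radius [rho <= 1]. *)
pose rho := Num.min 1 (4^-1 / (mnorm 1 u + 1)).
have mu0 : 0 < mnorm 1 u + 1 by rewrite ltr_wpDl // mnorm_ge0.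
have rho0 : 0 < rho by rewrite lt_min ltr01 divr_gt0.
have rho1 : rho <= 1 by rewrite ge_min lexx.
have rho_ge0 := ltW rho0.
have u4 : mnorm rho u <= 4^-1.
  rewrite (le_trans (mnorm_ord1 _ u1)) ?rho_ge0 //.
  rewrite (@le_trans _ _ (rho * (mnorm 1 u + 1))) ?ler_wpM2l ?lerDl //.
  by rewrite -ler_pdivlMr // ge_min lexx orbT.
pose w := sqrt_iter u.
(* A telescoping series with partial sums [At + sb Pt (1 + w K)]. *)
pose p k := if k is k'.+1 then sb *: (Pt * (w k'.+1 - w k')) else At + sb *: Pt.
have psum K : \sum_(k < K.+1) p k = At + sb *: (Pt * (1 + w K)).
  elim: K => [|K IHK]; first by rewrite big_ord1 /= /w addr0 mulr1.
  rewrite big_ord_recr /= IHK -addrA -scalerDr -mulrDr; congr (_ + _ *: (_ * _)); ring.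
pose V := sb * mnorm rho Pt.
have V0 : 0 <= V by rewrite mulr_ge0 ?mnorm_ge0.
pose C := mnorm rho At + 2 * V.
have A0 : 0 <= mnorm rho At by rewrite mnorm_ge0.
have C0 : 0 <= C by rewrite addr_ge0 // mulr_ge0.
have nP : mnorm rho (sb *: Pt) <= V.
  by rewrite (le_trans (mnormZ _ _ _)) // ger0_norm.
apply: (series_analytic (p := p) (rho := rho) (C := C)) => //.
- case=> [|k]; first exact: mord0.
  by apply: mordZ; rewrite -[k.+1]add0n; apply: mordM; [exact: mord0|exact: sqrt_iter_diff_mord].
- case=> [|k].
    rewrite expr0 mulr1 (le_trans (mnormD _ _ _)) // lerD //.
    by rewrite (le_trans nP) // ler_peMl // ler1n.
  rewrite /p scalerAl (le_trans (mnormM _ _ _)) // exprS.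
  have := sqrt_iter_diff_norm rho_ge0 u4 k; have := mnorm_ge0 rho_ge0 (w k.+1 - w k).
  rewrite -/(w k.+1) -/(w k).
  set x := mnorm rho (w _ - _); set y := _ ^+ k => x0 xy.
  have y0 : 0 <= y by rewrite exprn_ge0 // invr_ge0.
  have h1 : mnorm rho (sb *: Pt) * x <= V * (y * 8^-1) by rewrite ler_pM ?mnorm_ge0.
  apply: le_trans h1 _.
  have h2 : 0 <= V * y by rewrite mulr_ge0.
  have h3 : 0 <= mnorm rho At * y by rewrite mulr_ge0.
  by rewrite /C; lra.
move=> z zr.
pose s := mev u z.
have s4 : `|s| <= 4^-1 by rewrite (le_trans (mev_mnorm _ _ zr)).
have s4' : - 4^-1 <= s <= 4^-1 by rewrite -ler_norml.
pose ze := Num.sqrt (1 + s) - 1.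
have s1 : 0 <= 1 + s by case/andP: s4' => ??; lra.
have sq : (1 + ze) ^+ 2 = 1 + s by rewrite /ze addrC subrK sqr_sqrtr.
have ze0 : 0 <= 1 + ze by rewrite /ze addrC subrK sqrtr_ge0.
have zeE : ze = 2^-1 * (mev u z - ze * ze).
  have key (x y : R) : (1 + x) ^+ 2 = 1 + y -> x = 2^-1 * (y - x * x).
    by rewrite expr2; lra.
  exact: key.
have ze1 : `|ze| <= 2^-1.
  have key (x y : R) : (1 + x) ^+ 2 = 1 + y -> 0 <= 1 + x -> - 4^-1 <= y <= 4^-1 ->
      - 2^-1 <= x <= 2^-1.
    by rewrite expr2 => e x0 /andP[yl yu]; apply/andP; split; rewrite leNgt; apply/negP => h; nra.
  by rewrite ler_norml; exact: key sq _ _.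
have sqB : Num.sqrt (mev B (a + z)) = sb * (1 + ze).
  have -> : mev B (a + z) = be * (1 + s).
    by rewrite /s uE [1 + _]addrC subrK mulrA mulfV ?mul1r // gt_eqF.
  by rewrite sqrtrM ?(ltW B0) // /ze addrCA subrr addr0.
have Pz : `|sb * mev Pt z| <= V by rewrite normrM ger0_norm // ler_wpM2l // mev_mnorm.
have Az : `|mev At z| <= mnorm rho At by rewrite mev_mnorm.
case=> [|K].
  rewrite big_ord0 subr0 expr0 mulr1 -PtE -AtE sqB.
  rewrite (le_trans (ler_normD _ _)) // /C addrC lerD // mulrCA mulrA mulrC normrM.
  rewrite ler_pM //; rewrite (le_trans (ler_normD _ _)) // normr1; lra.
have -> : \sum_(k < K.+1) mev (p k) z = mev At z + sb * (mev Pt z * (1 + mev (w K) z)).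
  have := congr1 (fun q : mpol R n => mev q z) (psum K).
  rewrite /mev mpoly.mevalD mpoly.mevalZ mpoly.mevalM mpoly.mevalD mpoly.meval1 => <-.
  by rewrite raddf_sum.
rewrite -PtE -AtE sqB.
have -> : mev Pt z * (sb * (1 + ze)) + mev At z - (mev At z + sb * (mev Pt z * (1 + mev (w K) z)))
  = (sb * mev Pt z) * (ze - mev (w K) z) by ring.
have h := sqrt_iter_cvg rho_ge0 u4 K zr zeE ze1.
rewrite normrM; apply: (@le_trans _ _ (V * 2^-1 ^+ K)); first by rewrite ler_pM.
rewrite exprS mulrA ler_wpM2r ?exprn_ge0 ?invr_ge0 // /C; lra.
Qed.

Lemma continuous_mev p : continuous (mev p : 'rV[R]_n -> R).
Proof.
apply: (@mev_closed _ _ (fun g : 'rV[R]_n -> R => continuous g) _ _ _ _ p id).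
- by move=> c; exact: cst_continuous.
- by move=> g h /= gc hc x; apply: continuousD; [exact: gc|exact: hc].
- by move=> g h /= gc hc x; apply: continuousM; [exact: gc|exact: hc].
- by move=> i; exact: coord_continuous.
Qed.

Lemma nash_sqrt (P A B : mpol R n) : (0 < n)%N ->
  nash_on [set x | 0 < mev B x] (fun x => mev P x * Num.sqrt (mev B x) + mev A x).
Proof.
move=> n0; pose f x := mev P x * Num.sqrt (mev B x) + mev A x; rewrite -[X in nash_on _ X]/f.
exists [set x | 0 < mev B x]; split.
  rewrite (_ : [set x | _] = mev B @^-1` [set r | 0 < r]) //.
  by apply: open_comp; [move=> x _; exact: continuous_mev|exact: open_gt].
split; first by exists (SAPos B).
split=> //; exists f; split=> //; split; first by move=> a; exact: analytic_sqrt.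
pose Q : {poly mpol R n} := ('X - A%:P) ^+ 2 - (P ^+ 2 * B)%:P.
exists Q; split.
  rewrite -size_poly_eq0 /Q size_polyDl ?size_exp_XsubC // size_polyN.
  by rewrite (leq_ltn_trans (size_polyC_leq1 _)).
move=> x /= Bx.
have -> : map_poly (fun q => mev q x) Q =
    ('X - (mev A x)%:P) ^+ 2 - (mev P x ^+ 2 * mev B x)%:P.
  rewrite -[map_poly _ _]/(map_poly (mpoly.meval (fun i => x ord0 i)) Q) /Q.
  rewrite rmorphB rmorphXn rmorphB /= map_polyX !map_polyC /=.
  by rewrite rmorphM rmorphXn.
rewrite !hornerE /f addrK exprMn sqr_sqrtr ?subrr //; exact: ltW.
Qed.

Lemma analytic_at_continuous (f : 'rV[R]_n -> R) a : analytic_at f a ->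
  forall e : R, 0 < e -> exists2 d : R, 0 < d & forall y, ball a d y -> `|f y - f a| < e.
Proof.
move=> /taylor[c [rho [M [rho0 _ HT]]]] e e0.
have p0 y : pow_psum c a y 0 = pow_psum c a a 0.
  rewrite /pow_psum; apply: eq_bigr => al _; congr (_ * _); apply: eq_bigr => i _.
  by rewrite (ord1 (al i)) !expr0.
have fa : f a = pow_psum c a a 0.
  apply/eqP; rewrite -subr_eq0 -normr_le0.
  have : `|f a - pow_psum c a a 0| <= 0 ^+ 1 * M.
    by apply: HT => [|i]; rewrite ?lexx ?ler01 // subrr normr0 mul0r.
  by rewrite expr1 mul0r.
have M0 : 0 < `|M| + 1 by rewrite ltr_wpDl.
pose th := Num.min 1 (e / (`|M| + 1) / 2).
have th0 : 0 < th by rewrite lt_min ltr01 !divr_gt0.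
have th1 : th <= 1 by rewrite ge_min lexx.
exists (th * rho); first by rewrite mulr_gt0.
move=> y /ball_row - /(_ (mulr_gt0 th0 rho0)) ya.
apply: (@le_lt_trans _ _ (th * M)).
  rewrite fa -(p0 y) -[th in leRHS]expr1; apply: HT; first by rewrite th1 ltW.
  by move=> i; rewrite distrC ltW.
apply: (@le_lt_trans _ _ (th * (`|M| + 1))).
  by rewrite ler_wpM2l ?(ltW th0) // (le_trans (ler_norm M)) // lerDl.
apply: (@le_lt_trans _ _ (e / 2)).
  rewrite -ler_pdivlMr // ge_min; apply/orP; right.
  by rewrite mulrAC.
by rewrite ltr_pdivrMr // ltr_pMr // ltr1n.
Qed.

End SqrtAnalytic.

(** * Regulous images of spheres *)

Section RationalFunctions.
Variable R : realType.

Definition ratfun (f : R -> R) := exists G H : {poly R},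
  (forall t, H.[t] != 0) /\ forall t, f t = G.[t] / H.[t].

Lemma ratfun_cst c : ratfun (fun=> c).
Proof. by exists c%:P, 1; split=> t; rewrite ?hornerC ?oner_eq0 ?divr1. Qed.

Lemma ratfunD f g : ratfun f -> ratfun g -> ratfun (fun t => f t + g t).
Proof.
move=> [G [H [H0 fE]]] [G' [H' [H'0 gE]]].
exists (G * H' + G' * H), (H * H'); split=> t; first by rewrite hornerM mulf_neq0.
by rewrite fE gE !hornerE; field; rewrite H0 H'0.
Qed.

Lemma ratfunM f g : ratfun f -> ratfun g -> ratfun (fun t => f t * g t).
Proof.
move=> [G [H [H0 fE]]] [G' [H' [H'0 gE]]].
exists (G * G'), (H * H'); split=> t; first by rewrite hornerM mulf_neq0.
by rewrite fE gE mulf_div !hornerM.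
Qed.

Lemma ratfun_inf0 f (A : set R) : ratfun f -> infinite_set A ->
  (forall t, A t -> f t = 0) -> forall t, f t = 0.
Proof.
move=> [G [H [H0 fE]]] iA fA t; rewrite fE (@poly_inf0 _ G A) ?horner0 ?mul0r //.
by move=> s /fA; rewrite fE => /eqP; rewrite mulf_eq0 invr_eq0 (negbTE (H0 s)) orbF => /eqP.
Qed.

Lemma ratfun_zeros f t0 : ratfun f -> f t0 != 0 -> finite_set [set t | f t = 0].
Proof.
move=> Rf f0; apply: contrapT => iA; move/negP: f0; apply; apply/eqP.
exact: ratfun_inf0 iA _ _.
Qed.

Lemma ratfun_mev n (Q : mpol R n) (w : R -> 'rV[R]_n) :
  (forall i, ratfun (fun t => w t ord0 i)) -> ratfun (fun t => mev Q (w t)).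
Proof. by apply: mev_closed; [exact: ratfun_cst|exact: ratfunD|exact: ratfunM]. Qed.

Lemma continuous_cofinite0 (u : R -> R) (A : set R) : continuous u -> finite_set A ->
  (forall t, ~ A t -> u t = 0) -> forall t, u t = 0.
Proof.
move=> cu fA uA t; apply/eqP/negPn/negP => ut.
have /cvgrPdist_lt/(_ `|u t|) := cu t; rewrite normr_gt0 => /(_ ut).
move=> /nbhs_ballP[e /= e0 He].
apply: (@infinite_itvoo R t (t + e)); first by rewrite ltrDl.
apply: sub_finite_set fA => s /= /andP[ts se]; apply: contrapT => /uA us.
have : ball t e s by rewrite /ball /= distrC gtr0_norm ?subr_gt0 // ltrBlDl.
by move/He; rewrite us subr0 ltxx.
Qed.

(** In lowest terms [A' / B'], the identity [u B' = A'] extends to all [t] by continuity. A real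
    zero of [B'] would then be one of [A'], against coprimality. *)
Lemma cofinite_quotient (u : R -> R) (A B : {poly R}) (Z : set R) :
  continuous u -> B != 0 -> finite_set Z -> (forall t, ~ Z t -> u t * B.[t] = A.[t]) ->
  ratfun u.
Proof.
move=> cu B0 fZ uZ; have g0 : gcdp A B != 0 by rewrite gcdp_eq0 negb_and B0 orbT.
pose A' := A %/ gcdp A B; pose B' := B %/ gcdp A B.
have AE : A = A' * gcdp A B by rewrite divpK ?dvdp_gcdl.
have BE : B = B' * gcdp A B by rewrite divpK ?dvdp_gcdr.
have cop : coprimep A' B' by rewrite coprimep_div_gcd ?B0 ?orbT.
have uB t : u t * B'.[t] - A'.[t] = 0.
  apply: (@continuous_cofinite0 (fun t => u t * B'.[t] - A'.[t]) (Z `|` [set t | (gcdp A B).[t] = 0])).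
  - move=> s; apply: cvgB; last exact: continuous_horner.
    by apply: cvgM; [exact: cu|exact: continuous_horner].
  - by rewrite finite_setU; split=> //; exact: finite_roots.
  - move=> s /not_orP[/uZ us /eqP gs]; apply/eqP; rewrite subr_eq0; apply/eqP.
    by apply: (mulIf gs); rewrite -mulrA -!hornerM -BE -AE us.
exists A', B'; split=> t; last first.
  have B't : B'.[t] != 0.
    apply/eqP => Bt; have := uB t; rewrite Bt mulr0 sub0r => /eqP; rewrite oppr_eq0 => At.
    have := @coprimep_root _ A' B' t cop At; by rewrite /root Bt eqxx.
  by apply: (mulIf B't); rewrite divfK //; apply/eqP; rewrite -subr_eq0 uB.
apply/eqP => Bt; have := uB t; rewrite Bt mulr0 sub0r => /eqP; rewrite oppr_eq0 => At.
by have := @coprimep_root _ A' B' t cop At; rewrite /root Bt eqxx.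
Qed.

Definition curve n (N : 'I_n -> {poly R}) (h : {poly R}) t : 'rV[R]_n := \row_i ((N i).[t] / h.[t]).

Lemma ratfun_curve n (f : R -> 'rV[R]_n) : (forall i, ratfun (fun t => f t ord0 i)) ->
  exists N (h : {poly R}), (forall t, h.[t] != 0) /\ forall t, f t = curve N h t.
Proof.
move=> /choice[G] /choice[H] HG.
exists (fun i => G i * \prod_(j | j != i) H j), (\prod_j H j).
have H0 t j : (H j).[t] != 0 by case: (HG j).
split=> t; first by rewrite horner_prod; apply/prodf_neq0 => j _.
apply/rowP => i; rewrite mxE; have [_ ->] := HG i.
rewrite hornerM !horner_prod.
have -> : \prod_j (H j).[t] = (H i).[t] * \prod_(j | j != i) (H j).[t] by rewrite (bigD1 i).
rewrite -mulf_div divff ?mulr1 //.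
by apply/prodf_neq0 => j _.
Qed.

Lemma curve_ratfun n (N : 'I_n -> {poly R}) h i :
  (forall t, h.[t] != 0) -> ratfun (fun t => curve N h t ord0 i).
Proof. by move=> h0; exists (N i), h; split=> // t; rewrite mxE. Qed.

End RationalFunctions.

Section Circles.
Variables (R : realType) (n : nat).
Implicit Types x y p q : 'rV[R]_n.

Definition dotp x y : R := \sum_(i < n) x ord0 i * y ord0 i.

Lemma dotpxx x : dotp x x = sqnorm x.
Proof. by apply: eq_bigr => i _; rewrite expr2. Qed.

Lemma dotpC x y : dotp x y = dotp y x.
Proof. by apply: eq_bigr => i _; rewrite mulrC. Qed.

Lemma dotpD x y z : dotp (x + y) z = dotp x z + dotp y z.
Proof. by rewrite -big_split; apply: eq_bigr => i _; rewrite mxE mulrDl. Qed.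

Lemma dotpZ a x y : dotp (a *: x) y = a * dotp x y.
Proof. by rewrite /dotp big_distrr /=; apply: eq_bigr => i _; rewrite mxE mulrA. Qed.

Lemma dotpZr a x y : dotp x (a *: y) = a * dotp x y.
Proof. by rewrite dotpC dotpZ dotpC. Qed.

Lemma sqnorm_ge0 x : 0 <= sqnorm x.
Proof. by rewrite sumr_ge0 // => i _; rewrite sqr_ge0. Qed.

Lemma sqnorm_eq0 x : sqnorm x = 0 -> x = 0.
Proof.
move=> /eqP; rewrite psumr_eq0 => [/allP H|i _]; last exact: sqr_ge0.
apply/rowP => i; rewrite mxE; apply/eqP; rewrite -sqrf_eq0.
by have := H i (mem_index_enum i).
Qed.

Lemma sqnormD x y : sqnorm (x + y) = sqnorm x + 2 * dotp x y + sqnorm y.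
Proof.
by rewrite -!dotpxx dotpD ![dotp _ (x + y)]dotpC !dotpD [dotp y x]dotpC; ring.
Qed.

Lemma sqnormZ a x : sqnorm (a *: x) = a ^+ 2 * sqnorm x.
Proof. by rewrite -!dotpxx dotpZ dotpZr mulrA. Qed.

(** The half-angle parametrization of the great circle through the orthonormal vectors [p] and [q]:
    it is at [q] for [t = 0], at [p] for [t = 1], and misses only [-q]. *)
Definition circle p q (t : R) : 'rV[R]_n :=
  (1 + t ^+ 2)^-1 *: ((2 * t) *: p + (1 - t ^+ 2) *: q).

Lemma circle_den (t : R) : 1 + t ^+ 2 != 0.
Proof. by rewrite gt_eqF // ltr_pwDl // sqr_ge0. Qed.

Lemma sqnorm_circle p q t : sqnorm p = 1 -> sqnorm q = 1 -> dotp p q = 0 ->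
  sqnorm (circle p q t) = 1.
Proof.
move=> p1 q1 pq; rewrite /circle sqnormZ sqnormD !sqnormZ p1 q1 dotpZ dotpZr pq.
by field; exact: circle_den.
Qed.

Lemma circle_ratfun p q i : ratfun (fun t => circle p q t ord0 i).
Proof.
exists ((2 * p ord0 i) *: 'X + (q ord0 i) *: (1 - 'X^2)), (1 + 'X^2); split=> t.
  by rewrite !hornerE circle_den.
by rewrite !mxE !hornerE; field; exact: circle_den.
Qed.

End Circles.

Lemma circle_through (R : realType) n (x y : 'rV[R]_n.+2) : sqnorm x = 1 -> sqnorm y = 1 ->
  exists p q t1 t2, [/\ sqnorm p = 1, sqnorm q = 1, dotp p q = 0,
    circle p q t1 = x & circle p q t2 = y].
Proof.
move=> x1 y1.
suff [q [c [s [q1 xq s0 yE]]]] : exists q c s, [/\ sqnorm q = 1, dotp x q = 0, 0 <= s &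
    y = c *: x + s *: q].
  (* Taking [s >= 0] keeps [y] away from the missed point [-q], and makes the parameter
     [c / (1 + s)] meaningful. *)
  exists x, q, 1, (c / (1 + s)); split=> //.
    by rewrite /circle expr1n subrr scale0r addr0 scalerA mulr1 mulVf ?scale1r.
  have cs : c ^+ 2 + s ^+ 2 = 1.
    by move: y1; rewrite yE sqnormD !sqnormZ x1 q1 dotpZ dotpZr xq !mulr0 addr0 !mulr1.
  have s1 : 1 + s != 0 by rewrite gt_eqF // ltr_pwDl.
  have c2 : c ^+ 2 = 1 - s ^+ 2 by rewrite -cs addrK.
  have e1 : 1 + (c / (1 + s)) ^+ 2 = 2 / (1 + s).
    by rewrite expr_div_n c2; field.
  rewrite /circle e1 scalerDr !scalerA yE; congr (_ *: _ + _ *: _); first by field; rewrite ?s1 ?pnatr_eq0.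
  by rewrite expr_div_n c2; field; rewrite ?s1 ?pnatr_eq0.
pose c := dotp x y; pose w := y - c *: x.
have xw : dotp x w = 0.
  by rewrite dotpC dotpD -scaleN1r scalerA dotpZ dotpxx x1 mulr1 mulN1r dotpC subrr.
have yE : y = c *: x + w by rewrite addrC subrK.
have [w0|w0] := eqVneq w 0; last first.
  pose s := Num.sqrt (sqnorm w).
  have s0 : s != 0.
    by rewrite sqrtr_eq0 -ltNge lt_neqAle sqnorm_ge0 andbT eq_sym; apply: contraNneq w0 => /sqnorm_eq0 ->.
  exists (s^-1 *: w), c, s; split.
  - by rewrite sqnormZ -[sqnorm w]sqr_sqrtr ?sqnorm_ge0 // -exprMn mulVf ?expr1n.
  - by rewrite dotpZr xw mulr0.
  - exact: sqrtr_ge0.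
  - by rewrite scalerA mulfV // scale1r.
(* Here [y] is a multiple of [x], and any unit vector orthogonal to [x] completes the circle; it
   exists because there are at least two coordinates. *)
suff [q [q1 xq]] : exists q : 'rV[R]_n.+2, sqnorm q = 1 /\ dotp x q = 0.
  by exists q, c, 0; rewrite scale0r addr0 lexx {1}yE w0 addr0.
pose j : 'I_n.+2 := lift ord0 ord0.
suff [q [q0 xq]] : exists q : 'rV[R]_n.+2, q != 0 /\ dotp x q = 0.
  pose s := Num.sqrt (sqnorm q).
  have s0 : s != 0.
    by rewrite sqrtr_eq0 -ltNge lt_neqAle sqnorm_ge0 andbT eq_sym; apply: contraNneq q0 => /sqnorm_eq0 ->.
  exists (s^-1 *: q); rewrite sqnormZ -[sqnorm q]sqr_sqrtr ?sqnorm_ge0 // -exprMn mulVf ?expr1n //.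
  by rewrite dotpZr xq mulr0.
have [x0|x0] := eqVneq (x ord0 ord0) 0.
  exists (delta_mx ord0 ord0); split.
    by apply/eqP => /rowP/(_ ord0)/eqP; rewrite !mxE !eqxx oner_eq0.
  rewrite /dotp (bigD1 ord0) //= x0 mul0r add0r big1 // => i i0.
  by rewrite mxE (negbTE i0) andbF mulr0.
exists (\row_i (if i == ord0 then - x ord0 j else if i == j then x ord0 ord0 else 0)); split.
  by apply/eqP => /rowP/(_ j)/eqP; rewrite !mxE eqxx /= (negbTE x0).
rewrite /dotp (bigD1 ord0) //= (bigD1 j) //= big1 ?addr0; last first.
  by move=> i /andP[i0 ij]; rewrite mxE (negbTE i0) (negbTE ij) mulr0.
by rewrite !mxE eqxx /= mulrN [_ * x ord0 ord0]mulrC addNr.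
Qed.

Section RegulousCurves.
Variables (R : realType) (m : nat).
Implicit Types S : set 'rV[R]_m.

(** Endpoints are restricted to [S0], the curves only to [S]. For a regulous image, [S0] is the
    image of the points where no denominator vanishes, which the circles may leave. *)
Definition rat_connected (S0 S : set 'rV[R]_m) := forall p q, S0 p -> S0 q ->
  exists (N : 'I_m -> {poly R}) (h : {poly R}) t1 t2, [/\ forall t, h.[t] != 0,
    forall t, S (curve N h t), curve N h t1 = p & curve N h t2 = q].

Lemma polyfun_continuous n (f : 'rV[R]_n -> R) : polyfun f -> continuous f.
Proof. by move=> [Q QE]; rewrite (_ : f = mev Q); [exact: continuous_mev|exact/funext]. Qed.

Lemma polyfun_sqnorm n : polyfun (@sqnorm R n).
Proof. by apply: polyfun_sum => i; apply: polyfunX; exact: polyfun_coord. Qed.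

Lemma coord_sqnorm n (x : 'rV[R]_n) i : x ord0 i ^+ 2 <= sqnorm x.
Proof. by rewrite /sqnorm (bigD1 i) //= lerDl sumr_ge0 // => j _; rewrite sqr_ge0. Qed.

Lemma mx_norm_le n (x : 'rV[R]_n) (e : R) : 0 <= e ->
  (forall i, `|x ord0 i| <= e) -> `|x| <= e.
Proof.
move=> e0 xe; rewrite /Num.norm /= mx_normrE; apply: bigmax_le => // -[i j] _ /=.
by rewrite (ord1 i).
Qed.

Lemma sphere_compact n : compact (@sphere1 R n).
Proof.
apply: bounded_closed_compact.
  exists 1; split => // M M1 x /= x1; rewrite (le_trans _ (ltW M1)) //.
  apply: mx_norm_le => // i; rewrite -ler_sqr ?nnegrE // expr1n real_normK ?num_real //.
  by rewrite -x1 coord_sqnorm.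
rewrite (_ : @sphere1 R n = @sqnorm R n.+1 @^-1` [set 1]) //.
apply: closed_comp; last exact: closed_eq.
by move=> x _; apply: polyfun_continuous; exact: polyfun_sqnorm.
Qed.

Lemma cvg_row (T : topologicalType) n (f : T -> 'rV[R]_n) x :
  (forall i, {for x, continuous (fun t => f t ord0 i)}) -> {for x, continuous f}.
Proof.
move=> cf; apply/cvg_ballP => e e0.
have H i : \forall s \near x, ball (f x ord0 i) e (f s ord0 i).
  by move: (cf i) => /cvg_ballP; apply.
apply: (filterS _ (@filter_forall _ _ (fun i s => ball (f x ord0 i) e (f s ord0 i)) _ (nbhs_filter x) H)).
by move=> s Hs; apply/ball_row.
Qed.

Lemma ratfun_continuous (f : R -> R) : ratfun f -> continuous f.
Proof.
move=> [G [H [H0 fE]]]; have -> : f = fun t => G.[t] / H.[t] by apply/funext.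
move=> t; apply: cvgM; first exact: continuous_horner.
by apply: cvgV => //; exact: continuous_horner.
Qed.

Lemma regulous_sphere n S : regulous_image S (@sphere1 R n.+1) ->
  [/\ compact S, S !=set0 & exists S0, [/\ S0 `<=` S, S `<=` closure S0 & rat_connected S0 S]].
Proof.
move=> [g [h [F [h0 [TD [cF [FE SE]]]]]]].
set D := [set x | _] in TD FE; set T := @sphere1 R n.+1 in TD cF SE *.
have DT : D `<=` T by move=> x [].
split.
- by rewrite SE; apply: continuous_compact => //; exact: sphere_compact.
- rewrite SE; exists (F (delta_mx ord0 ord0)); exists (delta_mx ord0 ord0) => //.
  rewrite /T /sphere1 /= /sqnorm (bigD1 ord0) //= mxE !eqxx expr1n big1 ?addr0 // => i i0.
  by rewrite mxE (negbTE i0) andbF expr0n.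
have cF' := (subspace_continuousP T F).1 cF.
exists (F @` D); split.
- by rewrite SE; exact: image_subset.
- rewrite SE => _ [x Tx <-] B BF.
  have /TD/(_ _ (cF' x Tx B BF)) [y [Dy yB]] := Tx.
  by exists (F y); split; [exists y|apply: yB; exact: DT].
move=> _ _ [x Dx <-] [y Dy <-].
have [p [q [t1 [t2 [p1 q1 pq t1x t2y]]]]] := circle_through (DT _ Dx) (DT _ Dy).
pose ga := circle p q.
have gaT t : T (ga t) by exact: sqnorm_circle.
have cga : continuous ga.
  by move=> t; apply: cvg_row => i; apply: ratfun_continuous; exact: circle_ratfun.
have cFga : continuous (F \o ga).
  move=> t; apply: (@cvg_trans _ (F @ within T (nbhs (ga t)))); last exact: cF'.
  move=> B /= BF; have /nbhs_ballP[e e0 He] := cga t _ BF.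
  by apply/nbhs_ballP; exists e => // s /He /=; apply; exact: gaT.
have Rg i : ratfun (fun t => mev (g i) (ga t)) by apply: ratfun_mev => j; exact: circle_ratfun.
have Rh i : ratfun (fun t => mev (h i) (ga t)) by apply: ratfun_mev => j; exact: circle_ratfun.
(* Finite, because no [h i] vanishes at the endpoint [x] of the circle. *)
pose Z := \bigcup_(i in [set: 'I_m]) [set t | mev (h i) (ga t) = 0].
have fZ : finite_set Z.
  apply: bigcup_finite => [|i _]; first exact: finite_finset.
  apply: (@ratfun_zeros _ _ t1) => //.
  by case: Dx => _; rewrite -t1x; apply.
have Zga t : ~ Z t -> D (ga t).
  by move=> Zt; split=> [|i]; [exact: gaT|apply/eqP => hi; apply: Zt; exists i].
have RF i : ratfun (fun t => F (ga t) ord0 i).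
  have [G [H [H0 gE]]] := Rg i; have [G' [H' [H'0 hE]]] := Rh i.
  apply: (@cofinite_quotient _ _ (G * H') (G' * H) Z) => //.
  - move=> t; apply: (@continuous_comp _ _ _ (F \o ga) (fun v : 'rV[R]_m => v ord0 i)).
      exact: cFga.
    exact: coord_continuous.
  - have hx : mev (h i) (ga t1) != 0 by case: Dx => _; rewrite -t1x; apply.
    have H0' : H != 0 by apply/eqP => H00; have := H0 0; rewrite H00 horner0 eqxx.
    rewrite mulf_neq0 //; apply: contraNneq hx => G'0.
    by rewrite hE G'0 horner0 mul0r.
  - move=> t Zt; rewrite (FE _ (Zga _ Zt)) mxE gE hE !hornerM; field.
    rewrite H0 H'0 /=; case: (Zga _ Zt) => _ /(_ i); rewrite hE mulf_eq0 negb_or.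
    by case/andP => ->.
have [N [d [d0 NE]]] := ratfun_curve RF.
exists N, d, t1, t2; split=> //.
- by move=> t; rewrite -NE SE; exists (ga t).
- by rewrite -NE -t1x.
- by rewrite -NE -t2y.
Qed.

End RegulousCurves.

(** * Irreducibility and the Zariski closure *)

Section RatConnected.
Variables (R : realType) (m : nat) (S0 S : set 'rV[R]_m).
Hypotheses (dense : S `<=` closure S0) (Sne : S !=set0)
  (conn : rat_connected S0 S).

Lemma dense_analytic_neq0 (f : 'rV[R]_m -> R) x :
  analytic_at f x -> S x -> f x != 0 -> exists2 y, S0 y & f y != 0.
Proof.
move=> fx Sx nz; have [|d d0 Hd] := analytic_at_continuous fx (e := `|f x|).
  by rewrite normr_gt0.
have [y [S0y /Hd fy]] := dense Sx (nbhsx_ballx x d d0).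
by exists y => //; apply: contraTneq fy => ->; rewrite sub0r normrN ltxx.
Qed.

(** By continuity, points where [f], respectively [g], is nonzero can be found in [S0]; along a
    curve joining them, one of the two functions would have to vanish identically. *)
Lemma rat_connected_irreducible : sa_irreducible S.
Proof.
split=> // f g [U [_ [_ [SU [F [[Fan _] Ff]]]]]] [V [_ [_ [SV [G [[Gan _] Gg]]]]]] fg0.
apply: contrapT => /not_orP[/existsNP[x /not_implyP[Sx /eqP fx]] /existsNP[y /not_implyP[Sy /eqP gy]]].
have [|p S0p Fp] := @dense_analytic_neq0 F x (Fan _ (SU _ Sx)) Sx; first by rewrite Ff.
have [|q S0q Gq] := @dense_analytic_neq0 G y (Gan _ (SV _ Sy)) Sy; first by rewrite Gg.
have [N [h [t1 [t2 [h0 cS c1 c2]]]]] := conn S0p S0q.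
have [t|t|t|F0|G0] := @analytic_curve_domain _ _ F G N h h0.
- exact/Fan/SU/cS.
- exact/Gan/SV/cS.
- by rewrite Ff ?Gg ?fg0; [|exact: cS..].
- by move: Fp; rewrite -c1 [F _]F0 eqxx.
- by move: Gq; rewrite -c2 [G _]G0 eqxx.
Qed.

Lemma dense_polyfun0 (f : 'rV[R]_m -> R) : polyfun f ->
  (forall x, S0 x -> f x = 0) -> forall x, S x -> f x = 0.
Proof.
move=> Pf f0 x Sx; apply: contrapT => /eqP fx.
have /cvgrPdist_lt/(_ `|f x|) := @polyfun_continuous _ _ _ Pf x.
rewrite normr_gt0 => /(_ fx) /(dense Sx) [y [S0y /=]].
by rewrite (f0 y S0y) subr0 ltxx.
Qed.

Lemma ratfun_polyfun (f : 'rV[R]_m -> R) N (h : {poly R}) : (forall t, h.[t] != 0) ->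
  polyfun f -> ratfun (fun t => f (curve N h t)).
Proof.
move=> h0 [Q QE]; under eq_fun do rewrite -QE; apply: ratfun_mev => i.
exact: curve_ratfun.
Qed.

Lemma ratfun_range (u : R -> R) t1 t2 : ratfun u -> u t1 != u t2 -> infinite_set (range u).
Proof.
move=> Ru u12 fr.
have fib r : finite_set [set t | u t = r].
  have Ru' : ratfun (fun t => u t + - r) by apply: ratfunD => //; exact: ratfun_cst.
  have [t ut] : exists t, u t + - r != 0.
    have [u1|u1] := eqVneq (u t1) r; last by exists t1; rewrite subr_eq0.
    by exists t2; rewrite subr_eq0 -u1 eq_sym.
  apply: sub_finite_set (ratfun_zeros Ru' ut) => s /= ->; exact: subrr.
apply: (@infinite_itvoo R 0 1) => //.
apply: (@sub_finite_set _ _ (\bigcup_(r in range u) [set t | u t = r])).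
  by move=> t _; exists (u t) => //; exists t.
exact: bigcup_finite.
Qed.

Hypothesis dim1 : has_dim S 1.

Lemma dim1_nonconstant : exists j x y, [/\ S x, S y & x ord0 j != y ord0 j].
Proof.
have [[j [_ jind]] _] := dim1; have [x0 Sx0] := Sne.
have [p] : exists p : mpol R 1, forall v : 'rV_1, mev p v = v ord0 ord0 - x0 ord0 (j ord0).
  by apply: polyfunB; [exact: polyfun_coord|exact: polyfun_cst].
have [p0 pE|pn0 pE] := eqVneq p 0.
  have := pE (\row__ (x0 ord0 (j ord0) + 1)); rewrite p0 /mev mpoly.meval0 mxE addrAC subrr add0r.
  by move=> /esym/eqP; rewrite oner_eq0.
have [x [Sx]] := jind p pn0; rewrite pE mxE subr_eq0 => xj.
by exists (j ord0), x, x0.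
Qed.

Lemma dim1_algebraic j i :
  alg_over (fun x : {x | S x} => sval x ord0 j) (fun x => sval x ord0 i).
Proof.
have [->|ij] := eqVneq i j; first exact: alg_self.
pose j2 (l : 'I_2) := if l == ord0 then j else i.
have [_ /(_ 2%N j2)] := dim1; rewrite ltnn => H.
have j2inj : injective j2.
  move=> a b; rewrite /j2; case: eqVneq => [->|a0]; case: eqVneq => [->//|b0] e.
  - by move: ij; rewrite e eqxx.
  - by move: ij; rewrite e eqxx.
  - by apply: val_inj; case: a b a0 b0 {e} => -[|[|//]] ? [[|[|//]] ?].
have /existsNP[p /not_implyP[p0 /forallNP Hp]] : ~ coord_indep j2 S by move=> /(H j2inj).
have [A A0 AE] := mpol2_poly p0.
exists A => // -[x Sx] /=; rewrite AE; apply/eqP; rewrite -[_ == _]negbK; apply/negP => nz.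
apply: (Hp x); split=> //; rewrite (_ : \row_l _ = row2 (x ord0 j) (x ord0 i)) //.
by apply/rowP => l; rewrite !mxE /j2; case: ifP.
Qed.

(** A curve along which some coordinate [j] is nonconstant is Zariski dense. Suppose [f] vanishes on
    it but not at some point of [S]. In dimension 1, [x_j] and [f] satisfy a relation [A]; after
    removal of the powers of [f], the remaining factor [B] still vanishes on [S]. On the curve this
    reads [B(x_j, 0) = 0] for infinitely many [x_j], against [B(., 0) != 0]. *)
Theorem zariski_curve : exists N (h : {poly R}) j t1 t2, [/\ forall t, h.[t] != 0,
  forall t, S (curve N h t), curve N h t1 ord0 j != curve N h t2 ord0 j &
  forall f : 'rV[R]_m -> R, polyfun f -> (forall t, f (curve N h t) = 0) ->
    forall x, S x -> f x = 0].
Proof.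
have [j [x1 [x2 [Sx1 Sx2 x12]]]] := dim1_nonconstant.
have [p [q [S0p S0q pq]]] : exists p q, [/\ S0 p, S0 q & p ord0 j != q ord0 j].
  have [p [S0p _]] := dense Sx1 (nbhsx_ballx x1 1 ltr01).
  apply: contrapT => H.
  have H0 : forall x, S x -> x ord0 j - p ord0 j = 0.
    apply: dense_polyfun0; first by apply: polyfunB; [exact: polyfun_coord|exact: polyfun_cst].
    move=> q S0q; apply/eqP/negPn/negP; rewrite subr_eq0 => qp.
    by apply: H; exists q, p.
  by move: x12; rewrite (subr0_eq (H0 _ Sx1)) (subr0_eq (H0 _ Sx2)) eqxx.
have [N [h [t1 [t2 [h0 cS c1 c2]]]]] := conn S0p S0q.
exists N, h, j, t1, t2; split=> //; first by rewrite c1 c2.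
move=> f Pf fc x Sx; apply: contrapT => /eqP fx.
have [q0 S0q0 fq0] : exists2 q0, S0 q0 & f q0 != 0.
  apply: contrapT => H; move/eqP: fx; apply; apply: dense_polyfun0 Sx => // y S0y.
  by apply/eqP/negPn/negP => fy; apply: H; exists y.
have [A A0 AE] : alg_over (fun x : {x | S x} => sval x ord0 j) (fun x => f (sval x)).
  have [Q QE] := Pf.
  rewrite (_ : (fun x => f (sval x)) = fun x => mev Q (sval x)); last first.
    by apply/funext => y; rewrite QE.
  by apply: alg_mev => i; exact: dim1_algebraic.
have [k [B]] := multiplicity_XsubC A 0; rewrite A0 /= subr0 => B0 AB.
pose w (x : 'rV[R]_m) := B.[(f x)%:P].[x ord0 j].
have Pw : polyfun w.
  have P2 := poly_mpol2 (ord0 : 'I_2) ord_max B.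
  rewrite (_ : w = fun x => (fun v : 'rV[R]_2 => B.[(v ord0 ord_max)%:P].[v ord0 ord0])
     (row2 (x ord0 j) (f x))); last by apply/funext => y; rewrite !mxE.
  apply: polyfun_comp P2 _ => i; under eq_fun do rewrite mxE.
  by case: (i == ord0); [exact: polyfun_coord|exact: Pf].
have w0 : forall x, S x -> w x = 0.
  apply: dense_polyfun0 => // y S0y.
  (* Along a curve from [y] to a point with [f != 0], the zeros of [f] are finite in number; off
     them [w] is zero, hence it is zero at [y] as well. *)
  have [N' [h' [t1' [t2' [h0' cS' c1' c2']]]]] := conn S0y S0q0.
  have Rw := ratfun_polyfun N' h0' Pw; have Rf := ratfun_polyfun N' h0' Pf.
  rewrite -c1'; apply: (@ratfun_inf0 _ _ ([set: R] `\` [set t | f (curve N' h' t) = 0]) Rw).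
    apply: infinite_setD; last by apply: (ratfun_zeros Rf (t0 := t2')); rewrite c2'.
    by apply: sub_infinite_set (infinite_itvoo (@ltr01 R)) => ? _.
  move=> t [_ /eqP ft]; have := AE (exist _ _ (cS' t)); rewrite /= AB hornerM hornerM.
  rewrite hornerXn -polyC_exp hornerC => /eqP; rewrite mulf_eq0 expf_eq0 (negbTE ft) andbF orbF.
  by move/eqP.
have Rj : ratfun (fun t => curve N h t ord0 j) by exact: curve_ratfun.
move/negP: B0; apply.
apply/rootP; apply: (@poly_inf0 _ _ (range (fun t => curve N h t ord0 j))).
  by apply: (ratfun_range (t1 := t1) (t2 := t2) Rj); rewrite c1 c2.
by move=> _ [t _ <-]; have := w0 _ (cS t); rewrite /w fc.
Qed.

End RatConnected.

(** * The birational parametrization *)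

Section Hom2.
Variable R : realType.

Definition hom2 d (p : {poly R}) (v : 'rV[R]_2) : R :=
  \sum_(k < d.+1) p`_k * (v ord0 ord0 ^+ k * v ord0 ord_max ^+ (d - k)).

Lemma formfun_hom2 d p : formfun d (hom2 d p).
Proof.
apply: formfun_sum => k _; apply: formfunZ.
have kd : (k <= d)%N by rewrite -ltnS.
rewrite -[X in formfun X](subnKC kd); apply: formfunM.
  by rewrite -[X in formfun X]mul1n; apply: formfunX; exact: formfun_coord.
by rewrite -[X in formfun X]mul1n; apply: formfunX; exact: formfun_coord.
Qed.

Lemma hom2E d (p : {poly R}) (v : 'rV[R]_2) : (size p <= d.+1)%N -> v ord0 ord_max != 0 ->
  hom2 d p v = v ord0 ord_max ^+ d * p.[v ord0 ord0 / v ord0 ord_max].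
Proof.
move=> pd v0; rewrite (horner_coef_wide _ pd) big_distrr; apply: eq_bigr => k _ /=.
rewrite [RHS]mulrCA; congr (_ * _).
rewrite expr_div_n [RHS]mulrCA; congr (_ * _).
have kd : (k <= d)%N by rewrite -ltnS.
have -> : v ord0 ord_max ^+ d = v ord0 ord_max ^+ (d - k) * v ord0 ord_max ^+ k.
  by rewrite -exprD subnK.
by rewrite mulfK // expf_neq0.
Qed.

Lemma hom2_inf d p (v : 'rV[R]_2) : v ord0 ord_max = 0 -> hom2 d p v = p`_d * v ord0 ord0 ^+ d.
Proof.
move=> v0; rewrite /hom2 big_ord_recr /= subnn expr0 mulr1 big1 ?add0r // => k _.
by rewrite v0 expr0n subn_eq0 leqNgt ltn_ord !mulr0.
Qed.

Lemma row2_eta (v : 'rV[R]_2) : v = row2 (v ord0 ord0) (v ord0 ord_max).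
Proof.
apply/rowP => i; rewrite mxE; case: eqVneq => [->//|i0]; congr (v _ _).
by apply: val_inj => /=; case: i i0 => -[|[|//]].
Qed.

Lemma row2_0 (a b : R) : row2 a b ord0 ord0 = a. Proof. by rewrite mxE. Qed.
Lemma row2_1 (a b : R) : row2 a b ord0 ord_max = b. Proof. by rewrite mxE. Qed.

Lemma ratio_infinite (G H : {poly R}) (I : set R) : (forall c, G <> c *: H) ->
  infinite_set I -> (forall s, I s -> H.[s] != 0) ->
  infinite_set [set G.[s] / H.[s] | s in I].
Proof.
move=> GH iI H0 fV; apply: iI.
apply: (@sub_finite_set _ _ (\bigcup_(c in [set G.[s] / H.[s] | s in I]) [set s | (G - c *: H).[s] = 0])).
  move=> s Is; exists (G.[s] / H.[s]); first by exists s.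
  by rewrite /= hornerD hornerN hornerZ divfK ?subrr // H0.
apply: bigcup_finite => // c _; apply: finite_roots; rewrite subr_eq0.
by apply/eqP; exact: GH.
Qed.

Lemma form2_eq0 D (f : 'rV[R]_2 -> R) (I : set R) : formfun D f -> infinite_set I ->
  (forall x, I x -> f (row2 x 1) = 0) -> forall v, f v = 0.
Proof.
move=> ff iI fI; have [P [_ PE]] := ff.
have [q qE] := mev_poly1 P (fun i => if i == ord0 then 'X else 1).
have qE' x : q.[x] = f (row2 x 1).
  rewrite qE PE; congr f; apply/rowP => i; rewrite !mxE.
  by case: ifP; rewrite ?hornerX ?hornerC.
have q0 : q = 0 by apply: poly_inf0 iI _ => x Ix; rewrite qE' fI.
have f0 (v : 'rV[R]_2) : v ord0 ord_max != 0 -> f v = 0.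
  move=> v0; have -> : v = v ord0 ord_max *: row2 (v ord0 ord0 / v ord0 ord_max) 1.
    rewrite {1}[v]row2_eta; apply/rowP => i; rewrite !mxE; case: ifP => _.
      by rewrite mulrC divfK.
    by rewrite mulr1.
  by rewrite (formfun_scale _ _ ff) -qE' q0 horner0 mulr0.
move=> v; have [v0|] := eqVneq (v ord0 ord_max) 0; last exact: f0.
have [r rE] := mev_poly1 P (fun i => if i == ord0 then (v ord0 ord0)%:P else 'X).
have rE' x : r.[x] = f (row2 (v ord0 ord0) x).
  rewrite rE PE; congr f; apply/rowP => i; rewrite !mxE.
  by case: ifP; rewrite ?hornerX ?hornerC.
have r0 : r = 0.
  apply: (poly_inf0 (infinite_itvoo (@ltr01 R))) => x /andP[x0 _].
  by rewrite rE' f0 // row2_1 gt_eqF.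
by rewrite [v]row2_eta v0 -rE' r0 horner0.
Qed.

End Hom2.

Lemma cross_ratio (F : fieldType) (x x0 q y y0 z z0 : F) : x0 != 0 -> q != 0 -> y0 != 0 ->
  x / x0 = y / q -> x0 / x0 = y0 / q -> y * z0 = y0 * z -> x * z0 = x0 * z.
Proof.
move=> x00 q0 y00 xE x0E yz.
have y0E : y0 = q by apply/esym/(mulIf (x := q^-1)); rewrite ?invr_eq0 // -x0E !divff.
have -> : x = x0 * (y / q) by rewrite -xE mulrC divfK.
by rewrite y0E in yz; rewrite -mulrA; congr (_ * _); rewrite mulrAC yz mulrAC divff ?mul1r.
Qed.

Section LurothParam.
Variables (R : realType) (m : nat) (M : 'I_m.+1 -> {poly R}).
Hypothesis M00 : forall s, (M ord0).[s] != 0.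
Variable j : 'I_m.+1.
Hypothesis Mj : forall c, M j <> c *: M ord0.

Definition mvec (s : R) : 'rV[R]_m.+1 := \row_i (M i).[s].

(** The degree is recorded because the numerator and denominator of Lueroth's generator must come
    from forms of one degree in order to define a map on the projective closure. *)
Definition in_alg d (a : {poly R}) := exists f, formfun d f /\ forall s, a.[s] = f (mvec s).

Lemma in_algC c : in_alg 0 c%:P.
Proof. by exists (fun=> c); split=> [|s]; [exact: formfun_cst|rewrite hornerC]. Qed.

Lemma in_algD d a b : in_alg d a -> in_alg d b -> in_alg d (a + b).
Proof.
move=> [f [ff aE]] [g [fg bE]]; exists (fun x => f x + g x); split; first exact: formfunD.
by move=> s; rewrite hornerD aE bE.
Qed.

Lemma in_algM d e a b : in_alg d a -> in_alg e b -> in_alg (d + e) (a * b).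
Proof.
move=> [f [ff aE]] [g [fg bE]]; exists (fun x => f x * g x); split; first exact: formfunM.
by move=> s; rewrite hornerM aE bE.
Qed.

Lemma in_alg_gen i : in_alg 1 (M i).
Proof.
exists (fun x => x ord0 i); split; first exact: formfun_coord.
by move=> s; rewrite mxE.
Qed.

Local Notation L := {fraction {poly R}}.
Local Notation tf := (@FracField.tofrac {poly R}).

Lemma tf_inj : injective tf.
Proof. by move=> a b /eqP; rewrite tofrac_eq => /eqP. Qed.

Definition in_field (z : L) := exists d (a b : {poly R}),
  [/\ in_alg d a, in_alg d b, b != 0 & z = tf a / tf b].

Lemma tf_eq0 (a : {poly R}) : (tf a == 0) = (a == 0).
Proof. exact: tofrac_eq0. Qed.

Lemma in_fieldC c : in_field (tf c%:P).
Proof.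
exists 0%N, c%:P, 1; split; [exact: in_algC| |exact: oner_neq0|by rewrite rmorph1 divr1].
by rewrite -polyC1; exact: in_algC.
Qed.

Lemma in_fieldD x y : in_field x -> in_field y -> in_field (x + y).
Proof.
move=> [d [a [b [ia ib b0 ->]]]] [e [a' [b' [ia' ib' b0' ->]]]].
exists (d + e)%N, (a * b' + a' * b), (b * b'); split.
- by apply: in_algD; [exact: in_algM|rewrite addnC; exact: in_algM].
- exact: in_algM.
- by rewrite mulf_neq0.
- by rewrite addf_div ?tf_eq0 // rmorphD !rmorphM.
Qed.

Lemma in_fieldM x y : in_field x -> in_field y -> in_field (x * y).
Proof.
move=> [d [a [b [ia ib b0 ->]]]] [e [a' [b' [ia' ib' b0' ->]]]].
exists (d + e)%N, (a * a'), (b * b'); split; [exact: in_algM|exact: in_algM| |].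
  by rewrite mulf_neq0.
by rewrite mulf_div !rmorphM.
Qed.

Lemma in_fieldV x : in_field x -> in_field x^-1.
Proof.
move=> [d [a [b [ia ib b0 ->]]]]; rewrite invf_div.
have [->|a0] := eqVneq a 0; last by exists d, b, a.
by rewrite rmorph0 invr0 mulr0 -(rmorph0 tf) -polyC0; exact: in_fieldC.
Qed.

Lemma in_field_frac x : in_field x -> exists a b : {poly R}, b != 0 /\ x = tf a / tf b.
Proof. by move=> [d [a [b [_ _ b0 xE]]]]; exists a, b. Qed.

Lemma M00p : M ord0 != 0.
Proof. by apply/eqP => M0; have := M00 0; rewrite M0 horner0 eqxx. Qed.

Lemma in_field_gen i : in_field (tf (M i) / tf (M ord0)).
Proof.
exists 1%N, (M i), (M ord0); split=> //; [exact: in_alg_gen|exact: in_alg_gen|exact: M00p].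
Qed.

Lemma common_denominator (I : finType) (P Q : I -> {poly R}) (r : L) :
  (forall i, (map_poly (tf \o polyC) (Q i)).[r] != 0) ->
  exists (p : I -> {poly R}) (q : {poly R}), (map_poly (tf \o polyC) q).[r] != 0 /\
    forall i, (map_poly (tf \o polyC) (P i)).[r] / (map_poly (tf \o polyC) (Q i)).[r] =
      (map_poly (tf \o polyC) (p i)).[r] / (map_poly (tf \o polyC) q).[r].
Proof.
move=> Q0; exists (fun i => P i * \prod_(l | l != i) Q l), (\prod_l Q l).
have prodE (A : pred I) : (map_poly (tf \o polyC) (\prod_(l | A l) Q l)).[r] =
    \prod_(l | A l) (map_poly (tf \o polyC) (Q l)).[r].
  by rewrite rmorph_prod horner_prod.
split; first by rewrite prodE; apply/prodf_neq0 => i _.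
move=> i; rewrite rmorphM hornerM !prodE [\prod_l _](bigD1 i) //= -mulf_div divff ?mulr1 //.
by apply/prodf_neq0 => l _.
Qed.

(** Common real roots are divided out one at a time, which lowers the size of [p i0] and leaves all
    ratios unchanged. *)
Lemma no_common_root (I : finType) (p : I -> {poly R}) (i0 : I) (r : L) :
  (map_poly (tf \o polyC) (p i0)).[r] != 0 ->
  exists p' : I -> {poly R}, [/\ (map_poly (tf \o polyC) (p' i0)).[r] != 0,
    forall i, (map_poly (tf \o polyC) (p i)).[r] * (map_poly (tf \o polyC) (p' i0)).[r] =
      (map_poly (tf \o polyC) (p i0)).[r] * (map_poly (tf \o polyC) (p' i)).[r] &
    forall x, exists i, (p' i).[x] != 0].
Proof.
have [n] := ubnP (size (p i0)); elim: n p => // n IHn p; rewrite ltnS => le_n p0.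
have [H|/existsNP[x /forallNP Hx]] := pselect (forall x, exists i, (p i).[x] != 0).
  by exists p; split=> // i; rewrite mulrC.
have /choice[q qE] : forall i, exists q, p i = q * ('X - x%:P).
  move=> i; have /negP/negPn/eqP px := Hx i.
  by apply/factor_theorem/rootP.
pose u := (map_poly (tf \o polyC) ('X - x%:P)).[r].
have pE i : (map_poly (tf \o polyC) (p i)).[r] = (map_poly (tf \o polyC) (q i)).[r] * u.
  by rewrite qE rmorphM hornerM.
have q0 : (map_poly (tf \o polyC) (q i0)).[r] != 0.
  by apply: contraNneq p0 => q0; rewrite pE q0 mul0r.
have [|p' [p'0 p'E Hp']] := IHn q _ q0.
  have qn0 : q i0 != 0 by apply: contraNneq q0 => ->; rewrite rmorph0 horner0.
  by apply: leq_trans le_n; rewrite qE size_Mmonic ?monicXsubC // size_XsubC addn2.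
exists p'; split=> // i; rewrite !pE.
by rewrite mulrAC p'E mulrAC.
Qed.

Lemma hom2_frac d (p a b : {poly R}) : (size p <= d.+1)%N -> b != 0 ->
  tf b ^+ d * (map_poly (tf \o polyC) p).[tf a / tf b] =
  tf (\sum_(k < d.+1) p`_k *: (a ^+ k * b ^+ (d - k))).
Proof.
move=> pd b0; have sp : (size (map_poly (tf \o polyC) p) <= d.+1)%N.
  exact: leq_trans (size_poly _ _) pd.
rewrite (horner_coef_wide _ sp) big_distrr /= rmorph_sum; apply: eq_bigr => k _ /=.
rewrite coef_map /= -mul_polyC !rmorphM !rmorphXn /= mulrCA; congr (_ * _).
rewrite expr_div_n mulrCA; congr (_ * _).
have -> : tf b ^+ d = tf b ^+ (d - k) * tf b ^+ k by rewrite -exprD subnK // -ltnS.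
by rewrite mulfK // expf_neq0 // tf_eq0.
Qed.

(** Lueroth's generator is [r = a / b], where [a] and [b] are forms [psi0] and [psi1] in the
    coordinates. The coordinate ratios are rational in [r]; a common denominator, removal of common
    real roots and homogenization turn them into the forms [phi]. *)
Theorem luroth_param : exists d (phi : 'I_m.+1 -> 'rV[R]_2 -> R) e psi0 psi1 (a b : {poly R}),
  [/\ forall i, formfun d (phi i), forall t, t != 0 -> exists i, phi i t != 0,
      formfun e psi0 & formfun e psi1] /\
  [/\ b != 0, forall c, a <> c *: b,
      forall s i, (M i).[s] * phi ord0 (row2 a.[s] b.[s]) = (M ord0).[s] * phi i (row2 a.[s] b.[s]),
      forall s, a.[s] = psi0 (mvec s) & forall s, b.[s] = psi1 (mvec s)].
Proof.
have y0c c : tf (M j) / tf (M ord0) <> tf c%:P.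
  move=> e; apply: (@Mj c); apply/eqP; rewrite -tofrac_eq -mul_polyC rmorphM /= -e divfK //.
  by rewrite tf_eq0 M00p.
have [r [e [a [b [[psi0 [f0 aE]] [psi1 [f1 bE]] b0 rE]]]] Hr] := luroth tf_inj
  in_fieldC in_fieldD in_fieldM in_fieldV in_field_frac (in_field_gen j) y0c.
have /choice[P /choice[Q PQ]] : forall i, exists P Q : {poly R},
    (map_poly (tf \o polyC) Q).[r] != 0 /\
    tf (M i) / tf (M ord0) = (map_poly (tf \o polyC) P).[r] / (map_poly (tf \o polyC) Q).[r].
  by move=> i; exact: Hr (in_field_gen i).
have [p1 [q [q0 p1E]]] := common_denominator P (fun i => (PQ i).1).
have yE i : tf (M i) / tf (M ord0) = (map_poly (tf \o polyC) (p1 i)).[r] / (map_poly (tf \o polyC) q).[r].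
  by have [_ ->] := PQ i; rewrite p1E.
have tM0 : tf (M ord0) != 0 by rewrite tf_eq0 M00p.
have p10 : (map_poly (tf \o polyC) (p1 ord0)).[r] != 0.
  apply/eqP => p10; have := yE ord0; rewrite p10 mul0r => /eqP.
  by rewrite mulf_eq0 invr_eq0 (negbTE tM0).
have [p [p0 pE nroot]] := no_common_root p10.
have Mp i : tf (M i) * (map_poly (tf \o polyC) (p ord0)).[r] =
    tf (M ord0) * (map_poly (tf \o polyC) (p i)).[r].
  exact: (cross_ratio tM0 q0 p10 (yE i) (yE ord0) (pE i)).
(* The largest degree occurring, so that some coefficient of degree [d] is nonzero and [phi] does
   not vanish at [(1 : 0)]. *)
pose d := (\max_i size (p i)).-1.
have pd i : (size (p i) <= d.+1)%N.
  apply: (leq_trans (n := \max_i size (p i))); first exact: leq_bigmax.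
  by rewrite /d; case: (\max_i _).
have aNb c : a <> c *: b.
  move=> ab; have tb0 : tf b != 0 by rewrite tf_eq0.
  have rc : r = (tf \o polyC) c.
    by rewrite rE ab -mul_polyC tofracM; exact: (mulfK tb0).
  have [Qj0 yj] := PQ j; apply: (@y0c ((P j).[c] / (Q j).[c])).
  have hE (u : {poly R}) : (map_poly (tf \o polyC) u).[r] = tf u.[c]%:P.
    by rewrite rc horner_map.
  rewrite hE tf_eq0 polyC_eq0 in Qj0; rewrite yj !hE.
  apply: (mulIf (x := tf (Q j).[c]%:P)); first by rewrite tf_eq0 polyC_eq0.
  have -> : tf ((P j).[c] / (Q j).[c])%:P * tf (Q j).[c]%:P = tf (P j).[c]%:P.
    by rewrite -tofracM -polyCM (divfK Qj0).
  by apply: divfK; rewrite tf_eq0 polyC_eq0.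
exists d, (fun i => hom2 d (p i)), e, psi0, psi1, a, b; split; split=> //.
- by move=> i; exact: formfun_hom2.
- move=> t t0; have [t1|t1] := eqVneq (t ord0 ord_max) 0; last first.
    have [i pi] := nroot (t ord0 ord0 / t ord0 ord_max).
    by exists i; rewrite hom2E // mulf_neq0 // expf_neq0.
  have t00 : t ord0 ord0 != 0.
    apply: contraNneq t0 => t00; rewrite [t]row2_eta t00 t1; apply/eqP/rowP => i.
    by rewrite !mxE; case: ifP.
  have [i iE] : exists i, size (p i) = d.+1.
    have [|i iE] := @bigop.eq_bigmax 'I_m.+1 (fun i => size (p i)); first by rewrite card_ord.
    have p00 : p ord0 != 0 by apply: contraNneq p0 => ->; rewrite rmorph0 horner0.
    exists i; rewrite /d iE prednK // -iE.
    by apply: leq_trans (leq_bigmax ord0); rewrite size_poly_gt0.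
  by exists i; rewrite hom2_inf // mulf_neq0 ?expf_neq0 // -[d]/(d.+1.-1) -iE lead_coef_eq0
    -size_poly_gt0 iE.
move=> s i.
have : M i * \sum_(k < d.+1) (p ord0)`_k *: (a ^+ k * b ^+ (d - k)) =
       M ord0 * \sum_(k < d.+1) (p i)`_k *: (a ^+ k * b ^+ (d - k)).
  apply: tf_inj; rewrite !tofracM -(hom2_frac a (pd ord0) b0) -(hom2_frac a (pd i) b0) -rE.
  by rewrite mulrCA Mp mulrCA.
move=> /(congr1 (horner^~ s)); rewrite !hornerM !horner_sum /hom2.
under eq_bigr do rewrite hornerZ hornerM !horner_exp.
under [X in _ = _ * X -> _]eq_bigr do rewrite hornerZ hornerM !horner_exp.
by under [X in _ -> _ * X = _]eq_bigr do rewrite row2_0 row2_1;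
   under [X in _ -> _ = _ * X]eq_bigr do rewrite row2_0 row2_1.
Qed.

End LurothParam.

Section PlanePolynomials.
Variable R : realType.

Lemma horner2E (A : {poly {poly R}}) (q u : R) :
  A.[q%:P].[u] = \sum_(k < size A) \sum_(l < size A`_k) A`_k`_l * (u ^+ l * q ^+ k).
Proof.
rewrite [A.[_]]horner_coef horner_sum; apply: eq_bigr => k _.
rewrite hornerM -polyC_exp hornerC horner_coef big_distrl /=.
by apply: eq_bigr => l _; rewrite mulrA.
Qed.

Lemma polyfun_poly n (f : 'rV[R]_n -> R) (N : 'I_n -> {poly R}) : polyfun f ->
  exists G : {poly R}, forall t, G.[t] = f (\row_i (N i).[t]).
Proof.
move=> [Q QE]; have [G GE] := mev_poly1 Q N; exists G => t.
by rewrite GE QE.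
Qed.

Lemma coord_indep1 n (Y : set 'rV[R]_n) k : infinite_set [set y ord0 k | y in Y] ->
  exists jj : 'I_1 -> 'I_n, injective jj /\ coord_indep jj Y.
Proof.
move=> iY; exists (fun=> k); split; first by move=> a b _; rewrite !ord1.
move=> p p0; have [G GE] := mev_poly1 p (fun=> 'X).
have GE' t : G.[t] = mev p (\row__ t).
  by rewrite GE; congr mev; apply/rowP => i; rewrite !mxE hornerX.
have G0 : G != 0.
  have [x px] := mev_neq0 p0; apply: contraNneq px => G0.
  have -> : x = \row__ x ord0 ord0 by apply/rowP => i; rewrite mxE ord1.
  by rewrite -GE' G0 horner0.
have [_ [[y Yy <-] /eqP Gy]] := infinite_setN0 (infinite_setD iY (finite_roots G0)).
by exists y; split=> //; rewrite -[mev _ _]/(mev p (\row__ (y ord0 k))) -GE'.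
Qed.

Lemma poly2_mpol n (i0 i1 : 'I_n) (A : {poly {poly R}}) : A != 0 -> i0 != i1 ->
  exists2 p : mpol R n, p != 0 & forall x, mev p x = A.[(x ord0 i1)%:P].[x ord0 i0].
Proof.
move=> A0 i01; have [p pE] := poly_mpol2 i0 i1 A; exists p => //.
apply/eqP => p0; have [u [q]] := poly2_neq0 A0; apply/negP/negPn.
have := pE (\row_i (if i == i0 then u else q)).
by rewrite p0 /mev mpoly.meval0 !mxE eqxx eq_sym (negbTE i01) => <-.
Qed.

End PlanePolynomials.

(** * The projective closure of a rational curve and its one-dimensional part *)

Section RationalCurve.
Variables (R : realType) (m : nat) (S : set 'rV[R]_m).
Variables (N : 'I_m -> {poly R}) (h : {poly R}) (j : 'I_m) (t1 t2 : R).
Hypotheses (h0 : forall t, h.[t] != 0) (cS : forall t, S (curve N h t))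
  (cj : curve N h t1 ord0 j != curve N h t2 ord0 j)
  (zar : forall f : 'rV[R]_m -> R, polyfun f -> (forall t, f (curve N h t) = 0) ->
    forall x, S x -> f x = 0).

Let C := proj_zar_closure S.
Let M (i : 'I_m.+1) := if unlift ord0 i is Some k then N k else h.

Let mvecE s : mvec M s = h.[s] *: hlift (curve N h s).
Proof.
apply/rowP => i; rewrite !mxE /M; case: (unlift ord0 i) => [k|]; last by rewrite mulr1.
by rewrite mxE mulrC divfK.
Qed.

Let M00 s : (M ord0).[s] != 0. Proof. by rewrite /M unlift_none. Qed.

Let Mj c : M (lift ord0 j) <> c *: M ord0.
Proof.
rewrite /M unlift_none liftK => e; move/negP: cj; apply.
by rewrite !mxE e !hornerZ !mulfK.
Qed.

Lemma zar_form d (f : 'rV[R]_m.+1 -> R) : formfun d f -> (forall s, f (mvec M s) = 0) ->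
  forall v, C v -> f v = 0.
Proof.
move=> ff fM v [_ Cv]; have [P [hP PE]] := ff; rewrite -PE; apply: Cv hP _ => x Sx.
rewrite PE; apply: (zar (f := fun x => f (hlift x))) Sx.
  by apply: polyfun_hlift; exact: formfun_polyfun ff.
move=> s; have := fM s; rewrite mvecE (formfun_scale _ _ ff) => /eqP.
by rewrite mulf_eq0 expf_eq0 (negbTE (h0 s)) andbF => /eqP.
Qed.

Lemma zar_mvec s : C (mvec M s).
Proof.
split.
  by apply/eqP => /rowP/(_ ord0)/eqP; rewrite !mxE; exact/negP/M00.
move=> d P hP PS; rewrite mvecE (formfun_scale _ _ (formfun_mev hP)) PS ?mulr0 //.
Qed.

Lemma zar_scale v lam : C v -> lam != 0 -> C (lam *: v).
Proof.
move=> [v0 Cv] lam0; split; first by rewrite scaler_eq0 negb_or lam0.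
by move=> d P hP PS; rewrite (formfun_scale _ _ (formfun_mev hP)) (Cv d P) ?mulr0.
Qed.

Variables (d : nat) (phi : 'I_m.+1 -> 'rV[R]_2 -> R) (e : nat)
  (psi0 psi1 : 'rV[R]_m.+1 -> R) (a b : {poly R}).
Hypotheses (fphi : forall i, formfun d (phi i))
  (phi0 : forall t, t != 0 -> exists i, phi i t != 0)
  (fpsi0 : formfun e psi0) (fpsi1 : formfun e psi1) (b0 : b != 0)
  (ab : forall c, a <> c *: b)
  (Mphi : forall s i, (M i).[s] * phi ord0 (row2 a.[s] b.[s]) =
     (M ord0).[s] * phi i (row2 a.[s] b.[s]))
  (aE : forall s, a.[s] = psi0 (mvec M s)) (bE : forall s, b.[s] = psi1 (mvec M s)).

Let tau s := row2 a.[s] b.[s].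
Let phiv t : 'rV[R]_m.+1 := \row_i phi i t.
Let lam s := phi ord0 (tau s) / h.[s].

Let phiv_neq0 t : t != 0 -> phiv t != 0.
Proof.
by move=> /phi0[i pi]; apply/eqP => /rowP/(_ i)/eqP; rewrite !mxE; exact/negP.
Qed.

Let phi_tau s i : phi i (tau s) = lam s * (M i).[s].
Proof.
have := Mphi s i; rewrite /M unlift_none -/(M i) => e1; rewrite /lam mulrAC [_ * (M i).[s]]mulrC.
by rewrite e1 mulrAC divff ?mul1r.
Qed.

Let phiv_tau s : phiv (tau s) = lam s *: mvec M s.
Proof. by apply/rowP => i; rewrite !mxE phi_tau. Qed.

Let tau_neq0 s : b.[s] != 0 -> tau s != 0.
Proof.
by move=> bs; apply/eqP => /rowP/(_ ord_max)/eqP; rewrite row2_1 mxE; exact/negP.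
Qed.

Let lam_neq0 s : b.[s] != 0 -> lam s != 0.
Proof.
move=> bs; have [i] := phi0 (tau_neq0 bs); apply: contraNneq => l0.
by rewrite phi_tau l0 mul0r.
Qed.

Let b_inf : infinite_set [set s | b.[s] != 0].
Proof.
have iR : infinite_set [set: R] by apply: sub_infinite_set (infinite_itvoo (@ltr01 R)).
apply: sub_infinite_set (infinite_setD iR (finite_roots b0)) => s [_ /= /eqP]; exact.
Qed.

(** The quotient [a / b] is nonconstant and so takes infinitely many values. *)
Lemma form_tau D f : formfun D f -> (forall s, b.[s] != 0 -> f (tau s) = 0) -> forall v, f v = 0.
Proof.
move=> ff f0; apply: (form2_eq0 ff (ratio_infinite ab b_inf (fun s H => H))).
move=> _ [s bs <-]; have -> : row2 (a.[s] / b.[s]) 1 = b.[s]^-1 *: tau s.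
  by apply/rowP => i; rewrite !mxE; case: ifP => _; rewrite mulrC ?mulfV.
by rewrite (formfun_scale _ _ ff) f0 ?mulr0.
Qed.

Lemma formfun_phiv D f : formfun D f -> formfun (d * D) (fun t => f (phiv t)).
Proof.
move=> ff; apply: formfun_comp ff _ => i.
by rewrite (_ : (fun _ => _) = phi i) //; apply/funext => t; rewrite mxE.
Qed.

Lemma zar_phi t : t != 0 -> C (phiv t).
Proof.
move=> t0; split; first exact: phiv_neq0.
move=> D P hP PS; apply: (form_tau (formfun_phiv (formfun_mev hP))) => s bs.
rewrite phiv_tau (formfun_scale _ _ (formfun_mev hP)).
by have [_ /(_ D P hP PS) ->] := zar_mvec s; rewrite mulr0.
Qed.

Lemma zar_star D f : formfun D f -> (forall t, t != 0 -> f (phiv t) = 0) ->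
  forall v, C v -> f v = 0.
Proof.
move=> ff f0; apply: (zar_form ff) => s.
have [G GE] := polyfun_poly M (formfun_polyfun ff).
rewrite -[f _]GE (_ : G = 0) ?horner0 //.
apply: (poly_inf0 b_inf) => s' bs; rewrite GE.
have := f0 _ (tau_neq0 bs); rewrite phiv_tau (formfun_scale _ _ ff) => /eqP.
by rewrite mulf_eq0 expf_eq0 (negbTE (lam_neq0 bs)) andbF => /eqP.
Qed.

Lemma zar_irreducible : proj_irreducible C.
Proof.
split; first by exists (mvec M 0); exact: zar_mvec.
move=> d1 d2 P Q hP hQ PQ.
have fP := formfun_mev hP; have fQ := formfun_mev hQ.
have [GP GPE] := polyfun_poly M (formfun_polyfun fP).
have [GQ GQE] := polyfun_poly M (formfun_polyfun fQ).
have : GP * GQ = 0.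
  apply: poly_all0 => s; rewrite hornerM GPE GQE; apply: PQ; exact: zar_mvec.
move=> /eqP; rewrite mulf_eq0 => /orP[/eqP G0|/eqP G0]; [left|right].
  by apply: (zar_form fP) => s; rewrite -[mev _ _]GPE G0 horner0.
by apply: (zar_form fQ) => s; rewrite -[mev _ _]GQE G0 horner0.
Qed.

(* The coordinate s of the parametrization is algebraic over M_k / M_i, hence so is every rational function of s. *)
Lemma zar_dependent D (f : 'rV[R]_m.+1 -> R) i k : formfun D f ->
  (exists2 v, C v & v ord0 i != 0) ->
  exists A : {poly {poly R}}, [/\ A != 0,
    forall v, C v -> v ord0 i != 0 -> A.[(f v / v ord0 i ^+ D)%:P].[v ord0 k / v ord0 i] = 0 &
    (exists2 v, C v & f v != 0) -> A`_0 != 0].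
Proof.
move=> ff [v0 Cv0 v0i].
have [fM fME] := polyfun_poly M (formfun_polyfun ff).
have [fM0|fMn0] := eqVneq fM 0.
  have f0 : forall v, C v -> f v = 0.
    by apply: (zar_form ff) => s; rewrite -[f _]fME fM0 horner0.
  exists 'X; split; first by rewrite polyX_eq0.
    by move=> v Cv vi; rewrite hornerX hornerC f0 // mul0r.
  by move=> [v Cv]; rewrite f0 // eqxx.
have Mi0 : M i != 0.
  apply: contraNneq v0i => Mi0; apply/eqP; apply: (zar_form (formfun_coord R i) _ Cv0) => s.
  by rewrite mxE Mi0 horner0.
pose X := {s : R | (M i * fM).[s] != 0}.
pose u (s : X) : R := (M k).[sval s] / (M i).[sval s].
have Mis (s : X) : (M i).[sval s] != 0.
  by case: s => s /=; rewrite hornerM mulf_eq0 negb_or => /andP[].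
have fMs (s : X) : fM.[sval s] != 0.
  by case: s => s /=; rewrite hornerM mulf_eq0 negb_or => /andP[].
have algs : alg_over u (fun s => sval s).
  exists ((M k)^:P - 'X%:P * (M i)^:P).
    apply/eqP => /polyP/(_ (size (M i)).-1)/eqP; rewrite coefB coefCM !coef_map coef0 subr_eq0.
    move=> /eqP/(congr1 (coefp 1)); rewrite /= coefC coefXM coefC /= => /esym/eqP.
    by rewrite -lead_coefE lead_coef_eq0; exact/negP.
  move=> s; rewrite hornerD hornerN hornerM hornerC.
  have hP (p : {poly R}) x : (p^:P).[x%:P] = p.[x]%:P by rewrite horner_map.
  by rewrite !hP !hornerE /= /u divfK ?subrr.
have algp (p : {poly R}) : alg_over u (fun s => p.[sval s]).
  elim/poly_ind: p => [|p c IHp].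
    by under eq_fun do rewrite horner0; exact: alg_cst.
  under eq_fun do rewrite hornerD hornerM hornerX hornerC.
  by apply: algD; [exact: algM|exact: alg_cst].
have [A A0 AE] : alg_over u (fun s => fM.[sval s] * ((M i) ^+ D).[sval s]^-1).
  apply: algM => //; apply: algV => // s.
  by rewrite horner_exp expf_neq0.
(* Removing the power of the outer variable makes the constant coefficient nonzero: where [f]
   vanishes, the relation remains a nontrivial equation for [v_k / v_i]. *)
have [n [B]] := multiplicity_XsubC A 0; rewrite A0 /= subr0 => B0 AB.
have B00 : B`_0 != 0 by rewrite -horner_coef0.
exists B; split=> //; first by apply: contraNneq B00 => ->; rewrite coef0.
pose K := (sizeY B + D * size B)%N.
(* The relation homogenized in degree [K], so that its validity on the curve carries over to [C]. *)
pose G (v : 'rV[R]_m.+1) := \sum_(n < size B) \sum_(l < size B`_n)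
   B`_n`_l * (v ord0 k ^+ l * f v ^+ n * v ord0 i ^+ (K - (l + D * n))).
have leK (n' : 'I_(size B)) (l : 'I_(size B`_n')) : (l + D * n' <= K)%N.
  rewrite leq_add // ?leq_mul2l ?(ltnW (ltn_ord n')) ?orbT //.
  by rewrite (leq_trans (ltnW (ltn_ord l))) // max_size_coefXY.
have fG : formfun K G.
  apply: formfun_sum => n' _; apply: formfun_sum => l _; apply: formfunZ.
  rewrite -[X in formfun X](subnKC (leK n' l)); apply: formfunM.
    apply: formfunM; last exact: formfunX.
    by rewrite -[X in formfun X]mul1n; apply: formfunX; exact: formfun_coord.
  by rewrite -[X in formfun X]mul1n; apply: formfunX; exact: formfun_coord.
have GE (v : 'rV[R]_m.+1) : v ord0 i != 0 ->
    G v = v ord0 i ^+ K * B.[(f v / v ord0 i ^+ D)%:P].[v ord0 k / v ord0 i].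
  move=> vi; rewrite horner2E big_distrr /=; apply: eq_bigr => n' _.
  rewrite big_distrr /=; apply: eq_bigr => l _.
  rewrite [RHS]mulrCA; congr (_ * _).
  have -> : v ord0 i ^+ K = v ord0 i ^+ (K - (l + D * n')) * (v ord0 i ^+ l * v ord0 i ^+ (D * n')).
    by rewrite -!exprD subnK.
  rewrite exprM !expr_div_n; field.
  by rewrite !expf_neq0.
have G0 : forall v, C v -> G v = 0.
  apply: (zar_form fG) => s.
  have [g gE] := polyfun_poly M (formfun_polyfun fG).
  rewrite -[G _]gE (_ : g = 0) ?horner0 //.
  have MfM0 : M i * fM != 0 by rewrite mulf_neq0.
  have iR : infinite_set [set: R] by apply: sub_infinite_set (infinite_itvoo (@ltr01 R)).
  apply: (poly_inf0 (infinite_setD iR (finite_roots MfM0))) => s' [_ /= /eqP s'0].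
  pose x : X := exist _ s' s'0.
  have vi : mvec M s' ord0 i != 0 by rewrite mxE; exact: (Mis x).
  rewrite gE GE //; have := AE x; rewrite AB hornerM hornerXn -polyC_exp hornerM hornerC /=.
  rewrite fME -/(mvec M s') horner_exp /u /= !mxE => /eqP.
  rewrite mulf_eq0 expf_eq0 mulf_eq0 invr_eq0 expf_eq0.
  rewrite (negbTE (Mis x)) andbF orbF -fME (negbTE (fMs x)) andbF orbF => /eqP ->.
  by rewrite mulr0.
move=> v Cv vi; have := G0 v Cv; rewrite GE // => /eqP.
by rewrite mulf_eq0 expf_eq0 (negbTE vi) andbF => /eqP.
Qed.

Lemma zar_chart_upper i (Y : set 'rV[R]_m) k' (jj : 'I_k' -> 'I_m) :
  (exists2 v, C v & v ord0 i != 0) -> Y `<=` chart i C -> injective jj ->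
  coord_indep jj Y -> (k' <= 1)%N.
Proof.
move=> Ci Yc jinj jind; rewrite leqNgt; apply/negP => k1.
pose l0 : 'I_k' := Ordinal (ltnW k1); pose l1 : 'I_k' := Ordinal k1.
have [A [A0 AE _]] := zar_dependent (lift i (jj l0)) (formfun_coord R (lift i (jj l1))) Ci.
have [//|p p0 pE] := @poly2_mpol R k' l0 l1 A A0.
have [x [/Yc [w [Cw wi] <-]]] := jind p p0; apply/negP/negPn/eqP.
by rewrite pE !mxE; have := AE w Cw wi; rewrite expr1.
Qed.

Lemma zar_dim : proj_dim C 1.
Proof.
have Cm0 i : mvec M 0 ord0 i = (M i).[0] by rewrite mxE.
split.
  pose j2 (l : 'I_2) := if l == ord0 then ord0 else lift ord0 j.
  exists j2; split.
    move=> x y; rewrite /j2; case: eqVneq => [->|x0]; case: eqVneq => [->//|y0] //.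
    by move=> _; apply: val_inj; case: x y x0 y0 => -[|[|//]] ? [[|[|//]] ?].
  move=> p p0; have [A A0 AE] := mpol2_poly p0.
  apply: contrapT => /forallNP Hp.
  have pv v : C v -> A.[(v ord0 (lift ord0 j))%:P].[v ord0 ord0] = 0.
    move=> Cv; rewrite AE; apply/eqP/negPn/negP => pv; apply: (Hp v); split=> //.
    rewrite (_ : \row_l _ = row2 (v ord0 ord0) (v ord0 (lift ord0 j))) //.
    by apply/rowP => l; rewrite !mxE /j2; case: ifP.
  have cinf := ratfun_range (curve_ratfun N j h0) cj.
  (* The points of the cone over the curve with first coordinate [la] have infinitely many values of
     the other coordinate; varying [la] then kills every coefficient of [A]. *)
  have Aev la : la != 0 -> map_poly (horner_eval la) A = 0.
    move=> la0; apply: (@poly_inf0 _ _ [set la * c | c in range (fun t => curve N h t ord0 j)]).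
      move=> fl; apply: cinf.
      apply: (@sub_finite_set _ _ ((fun c => la^-1 * c) @` [set la * c | c in range (fun t => curve N h t ord0 j)])).
        by move=> c Rc; exists (la * c); [exists c|rewrite mulKf].
      exact: finite_image.
    move=> _ [_ [s _ <-] <-].
    have Cv : C (la *: (h.[s]^-1 *: mvec M s)).
      by apply: zar_scale => //; apply: zar_scale; [exact: zar_mvec|rewrite invr_eq0].
    have := pv _ Cv; rewrite !mxE /M liftK unlift_none mulVf // mulr1.
    rewrite [h.[s]^-1 * _]mulrC => e1.
    have := horner_map (horner_eval la) A (la * ((N j).[s] / h.[s]))%:P.
    by rewrite /= !horner_evalE hornerC e1.
  move/negP: A0; apply; apply/eqP/polyP => k; rewrite coef0.
  apply: (poly_inf0 (infinite_itvoo (@ltr01 R))) => la /andP[la0 _].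
  have /polyP/(_ k) := Aev la (lt0r_neq0 la0).
  by rewrite coef_map coef0.
move=> k' jj jinj jind; rewrite leqNgt; apply/negP => k2.
pose l0 : 'I_k' := Ordinal (leq_trans (isT : (0 < 3)%N) k2).
pose l1 : 'I_k' := Ordinal (leq_trans (isT : (1 < 3)%N) k2).
pose l2 : 'I_k' := Ordinal k2.
have [C0|Cn0] := pselect (exists2 v, C v & v ord0 (jj l0) != 0); last first.
  have [p pE] := @polyfun_coord R k' l0.
  have p0 : p != 0.
    apply/eqP => p0; have := pE (const_mx 1); rewrite p0 /mev mpoly.meval0 mxE => /esym/eqP.
    by rewrite oner_eq0.
  have [v [Cv]] := jind p p0; rewrite pE mxE => v0.
  by apply: Cn0; exists v.
have [A [A0 AE _]] := zar_dependent (jj l1) (formfun_coord R (jj l2)) C0.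
pose K := (sizeY A + size A)%N.
(* The extra factor makes the relation hold also at the points of the cone where the coordinate [l0]
   is zero. *)
pose G (v : 'rV[R]_k') := v ord0 l0 * \sum_(n < size A) \sum_(l < size A`_n)
   A`_n`_l * (v ord0 l1 ^+ l * v ord0 l2 ^+ n * v ord0 l0 ^+ (K - (l + n))).
have leK (n' : 'I_(size A)) (l : 'I_(size A`_n')) : (l + n' <= K)%N.
  rewrite leq_add // ?(ltnW (ltn_ord n')) //.
  by rewrite (leq_trans (ltnW (ltn_ord l))) // max_size_coefXY.
have [p pE] : polyfun G.
  apply: polyfunM; first exact: polyfun_coord.
  apply: polyfun_sum => n; apply: polyfun_sum => l; apply: polyfunM; first exact: polyfun_cst.
  by apply: polyfunM; [apply: polyfunM|]; apply: polyfunX; exact: polyfun_coord.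
have GE (v : 'rV[R]_k') : v ord0 l0 != 0 ->
    G v = v ord0 l0 ^+ K.+1 * A.[(v ord0 l2 / v ord0 l0)%:P].[v ord0 l1 / v ord0 l0].
  move=> vi; rewrite /G exprS -mulrA; congr (_ * _).
  rewrite horner2E big_distrr /=; apply: eq_bigr => n' _.
  rewrite big_distrr /=; apply: eq_bigr => l _.
  rewrite [RHS]mulrCA; congr (_ * _).
  have -> : v ord0 l0 ^+ K = v ord0 l0 ^+ (K - (l + n')) * (v ord0 l0 ^+ l * v ord0 l0 ^+ n').
    by rewrite -!exprD subnK.
  rewrite !expr_div_n; field.
  by rewrite !expf_neq0.
have p0 : p != 0.
  apply/eqP => p0; have [u [q]] := poly2_neq0 A0; apply/negP/negPn.
  have := pE (\row_i (if i == l0 then 1 else if i == l1 then u else q)).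
  rewrite GE; last by rewrite !mxE eqxx oner_neq0.
  by rewrite p0 /mev mpoly.meval0 !mxE /= expr1n mul1r !divr1 => <-.
have [v [Cv]] := jind p p0; rewrite pE; apply/negP/negPn.
have [v0|v0] := eqVneq (v ord0 (jj l0)) 0; first by rewrite /G mxE v0 mul0r.
rewrite GE; last by rewrite mxE.
rewrite !mxE; have := AE v Cv v0; rewrite expr1 => ->; by rewrite mulr0.
Qed.

(** If all [phi k] were multiples of [phi i], the coordinates [M k] would be proportional too,
    against [Mj]. *)
Lemma phi_nonconstant i t : phi i t != 0 -> exists k, forall c, exists t', phi (lift i k) t' != c * phi i t'.
Proof.
move=> pi; apply: contrapT => /forallNP H.
have /choice[c cE] : forall k, exists c, forall t', phi k t' = c * phi i t'.
  move=> k; case: (unliftP i k) => [k'|] ->; last by exists 1 => t'; rewrite mul1r.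
  have /existsNP[c /forallNP cE] := H k'; exists c => t'.
  by have /negP/negPn/eqP := cE t'.
have Mc k s : b.[s] != 0 -> (M k).[s] = c k * (M i).[s].
  move=> bs; apply: (mulfI (lam_neq0 bs)); rewrite -phi_tau cE phi_tau; ring.
have c0 : c ord0 != 0.
  have [s bs] := infinite_setN0 b_inf.
  by apply/eqP => c0; have := M00 s; rewrite (Mc _ _ bs) c0 mul0r eqxx.
apply: (@Mj (c (lift ord0 j) / c ord0)); apply/eqP; rewrite -subr_eq0; apply/eqP.
apply: (poly_inf0 b_inf) => s bs; rewrite hornerD hornerN hornerZ.
by rewrite (Mc (lift ord0 j) _ bs) (Mc ord0 _ bs) mulrA divfK // subrr.
Qed.

Lemma phi_chart_lower i t0 (eps : R) : phi i t0 != 0 -> t0 != 0 -> 0 < eps ->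
  exists jj : 'I_1 -> 'I_m, injective jj /\
    coord_indep jj (chart i C `&` ball (dehom i (phiv t0)) eps).
Proof.
move=> pi t00 eps0; have [k Hk] := phi_nonconstant pi.
(* [t0] turned by a right angle: the line [t0 + s w] avoids the origin and crosses infinitely many
   directions near that of [t0]. *)
pose w := row2 (- t0 ord0 ord_max) (t0 ord0 ord0).
pose Ln (l : 'I_2) : {poly R} := (t0 ord0 l)%:P + w ord0 l *: 'X.
pose pt s : 'rV[R]_2 := \row_l (Ln l).[s].
have /choice[G GE] : forall k, exists G : {poly R}, forall s, G.[s] = phi k (pt s).
  by move=> k'; apply: polyfun_poly; exact: formfun_polyfun (fphi k').
have ptE s l : pt s ord0 l = t0 ord0 l + w ord0 l * s by rewrite mxE !hornerE.
have pt0 : pt 0 = t0 by apply/rowP => l; rewrite ptE mulr0 addr0.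
have n2 : 0 < t0 ord0 ord0 ^+ 2 + t0 ord0 ord_max ^+ 2.
  rewrite lt_neqAle addr_ge0 ?sqr_ge0 // andbT eq_sym paddr_eq0 ?sqr_ge0 // !sqrf_eq0.
  apply: contra t00 => /andP[/eqP e0 /eqP e1]; rewrite [t0]row2_eta e0 e1.
  by apply/eqP/rowP => l; rewrite !mxE; case: ifP.
have GH c : G (lift i k) <> c *: G i.
  move=> GcG; have [t' /negP] := Hk c; apply; rewrite -subr_eq0; apply/eqP.
  pose f t := phi (lift i k) t - c * phi i t.
  have ff : formfun d f by apply: formfunB => //; exact: formfunZ.
  have det : forall c, Ln ord0 <> c *: Ln ord_max.
    move=> c' e'; have e0 := congr1 (fun p : {poly R} => p`_0) e'.
    have e1 := congr1 (fun p : {poly R} => p`_1) e'.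
    move: e0 e1; rewrite /Ln /= !coefZ !coefD !coefC !coefZ !coefX /= !mulr0 !mulr1 !addr0 !add0r.
    rewrite row2_0 row2_1 => e0 e1; move: n2.
    have -> : t0 ord0 ord0 ^+ 2 + t0 ord0 ord_max ^+ 2 =
      t0 ord0 ord0 * (t0 ord0 ord0) - t0 ord0 ord_max * (- t0 ord0 ord_max) by ring.
    by rewrite {1}e0 e1 (_ : _ - _ = 0) ?ltxx //; ring.
  have Lm0 : Ln ord_max != 0.
    apply/eqP => e'; have e0 := congr1 (fun p : {poly R} => p`_0) e'.
    have e1 := congr1 (fun p : {poly R} => p`_1) e'.
    move: e0 e1; rewrite /Ln /= !coefD !coefC !coefZ !coefX ?coef0 /= !mulr0 !mulr1 !addr0 !add0r.
    by rewrite row2_1 => e0 e1; move: n2; rewrite e0 e1 expr0n addr0 ltxx.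
  have iR : infinite_set [set: R] by apply: sub_infinite_set (infinite_itvoo (@ltr01 R)).
  have iI : infinite_set [set s | (Ln ord_max).[s] != 0].
    apply: sub_infinite_set (infinite_setD iR (finite_roots Lm0)) => s [_ /= /eqP]; exact.
  apply: (form2_eq0 ff (ratio_infinite det iI (fun s H => H))) => _ [s Ls <-].
  have -> : row2 ((Ln ord0).[s] / (Ln ord_max).[s]) 1 = (Ln ord_max).[s]^-1 *: pt s.
    rewrite [in RHS](row2_eta (pt s)); apply/rowP => l; rewrite !mxE.
    by case: ifP => _; rewrite mulrC ?mulfV.
  rewrite (formfun_scale _ _ ff) /f -!GE GcG hornerZ subrr mulr0 //.
have Gi0 : (G i).[0] != 0 by rewrite GE pt0.
have nearG : \forall s \near (0 : R), (G i).[s] != 0 /\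
    forall l, ball (dehom i (phiv t0) ord0 l) eps (dehom i (phiv (pt s)) ord0 l).
  have n1 : \forall s \near (0 : R), (G i).[s] != 0.
    have := @continuous_horner R (G i) 0 => /cvgrPdist_lt /(_ `|(G i).[0]|).
    rewrite normr_gt0 => /(_ Gi0); apply: filterS => s.
    by apply: contraTneq => ->; rewrite subr0 ltxx.
  have n3 l : \forall s \near (0 : R), ball (dehom i (phiv t0) ord0 l) eps (dehom i (phiv (pt s)) ord0 l).
    have cq : (fun s => (G (lift i l)).[s] / (G i).[s]) @ (0 : R) --> (G (lift i l)).[0] / (G i).[0].
      apply: cvgM; first exact: continuous_horner.
      by apply: cvgV => //; exact: continuous_horner.
    move/cvg_ballP: cq => /(_ eps eps0); apply: filterS => s.
    by rewrite !mxE !GE pt0.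
  apply: filterS2 n1 (filter_forall _ n3) => s gs bs; split=> //.
move/nbhs_ballP: nearG => [de /= de0 Hde].
apply: (@coord_indep1 _ _ _ k).
have := @ratio_infinite R (G (lift i k)) (G i) [set s | 0 < s < de] GH (infinite_itvoo de0) _.
have sb s : 0 < s < de -> ball (0 : R) de s.
  by move=> /andP[s0 sd]; rewrite /ball /= sub0r normrN gtr0_norm.
move=> /(_ (fun s H => (Hde s (sb s H)).1)); apply: sub_infinite_set => _ [s sI <-].
have [gs bs] := Hde s (sb s sI).
exists (dehom i (phiv (pt s))); last by rewrite !mxE !GE.
split; last by apply/ball_row.
exists (phiv (pt s)) => //; split; last by rewrite mxE -GE.
apply: zar_phi; apply/eqP => ps.
have p0 : pt s ord0 ord0 = 0 by rewrite ps mxE.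
have p1 : pt s ord0 ord_max = 0 by rewrite ps mxE.
move: p0 p1; rewrite !ptE row2_0 row2_1 => p0 p1.
have : (t0 ord0 ord0 ^+ 2 + t0 ord0 ord_max ^+ 2) * (1 + s ^+ 2) =
  (t0 ord0 ord0 + - t0 ord0 ord_max * s) ^+ 2 + (t0 ord0 ord_max + t0 ord0 ord0 * s) ^+ 2 by ring.
rewrite p0 p1 expr0n addr0 => /eqP; rewrite mulf_eq0 (gt_eqF n2) /=.
exact/negP/circle_den.
Qed.

Lemma phi_local t : t != 0 -> proj_local_part C 1 (phiv t).
Proof.
move=> t0; split; first exact: zar_phi.
have [i pi] := phi0 t0; have vi : phiv t ord0 i != 0 by rewrite mxE.
have Ci : exists2 v, C v & v ord0 i != 0 by exists (phiv t) => //; exact: zar_phi.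
exists i; split=> //; exists 1 => // eps eps0 _; split; first exact: phi_chart_lower.
by move=> k' jj; apply: (zar_chart_upper Ci) => x [].
Qed.

Lemma psi_inverse t : psi0 (phiv t) * t ord0 ord_max = psi1 (phiv t) * t ord0 ord0.
Proof.
pose f t := psi0 (phiv t) * t ord0 ord_max - psi1 (phiv t) * t ord0 ord0.
have ff : formfun (d * e + 1) f.
  by apply: formfunB; apply: formfunM; first [exact: formfun_phiv|exact: formfun_coord].
apply/eqP; rewrite -subr_eq0; apply/eqP; apply: (form_tau ff) => s bs; rewrite /f.
rewrite phiv_tau (formfun_scale _ _ fpsi0) (formfun_scale _ _ fpsi1) -aE -bE.
rewrite row2_0 row2_1; ring.
Qed.

Lemma psi_nonzero : exists2 t, t != 0 & psi1 (phiv t) != 0.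
Proof.
have [s bs] := infinite_setN0 b_inf; exists (tau s); first exact: tau_neq0.
by rewrite phiv_tau (formfun_scale _ _ fpsi1) -bE mulf_neq0 // expf_neq0 // lam_neq0.
Qed.

Let psiv v := row2 (psi0 v) (psi1 v).

(** The candidate parameter is [psiv v]. That [phi (psiv v)] is proportional to [v] is a system of
    forms in [v]; it holds on the image of [phi] by [psi_inverse], hence on [C]. *)
Lemma psi_section v : C v -> psiv v != 0 -> exists2 t, t != 0 & exists la, v = la *: phiv t.
Proof.
move=> Cv pv; exists (psiv v) => //; have [i pi] := phi0 pv.
have H k : phi i (psiv v) * v ord0 k = phi k (psiv v) * v ord0 i.
  pose f v := phi i (psiv v) * v ord0 k - phi k (psiv v) * v ord0 i.
  have fphi' l : formfun (e * d) (fun v => phi l (psiv v)).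
    apply: formfun_comp => // l'; under eq_fun do rewrite mxE.
    by case: (l' == ord0).
  have ff : formfun (e * d + 1) f.
    by apply: formfunB; apply: formfunM; first [exact: fphi'|exact: formfun_coord].
  apply/eqP; rewrite -subr_eq0; apply/eqP; apply: (zar_star ff) Cv => t t0; rewrite /f.
  have [mu ->] : exists mu, psiv (phiv t) = mu *: t.
    have tl l : t ord0 l = if l == ord0 then t ord0 ord0 else t ord0 ord_max.
      by rewrite {1}[t]row2_eta mxE.
    have pt := psi_inverse t; have [t00|t00] := eqVneq (t ord0 ord0) 0.
      have t10 : t ord0 ord_max != 0.
        apply: contra t0 => /eqP t10; rewrite [t]row2_eta t00 t10.
        by apply/eqP/rowP => l; rewrite !mxE; case: ifP.
      exists (psi1 (phiv t) / t ord0 ord_max).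
      apply/rowP => l; rewrite /psiv !mxE (tl l); case: ifP => _; last by rewrite divfK.
      move/eqP: pt; rewrite t00 !mulr0 mulf_eq0 (negbTE t10) orbF => /eqP ->//.
    exists (psi0 (phiv t) / t ord0 ord0).
    apply/rowP => l; rewrite /psiv !mxE (tl l); case: ifP => _; first by rewrite divfK.
    by rewrite mulrAC pt mulfK.
  by rewrite !(formfun_scale _ _ (fphi _)) !mxE; ring.
exists (v ord0 i / phi i (psiv v)); apply/rowP => k; rewrite !mxE.
by rewrite mulrAC [_ * phi k _]mulrC -H mulrAC divff ?mul1r.
Qed.

(** The squared distance [E] from [phi t] to [phi i t] times the normalized [v] is positive on the
    unit circle, hence bounded below by compactness. A point of the image too close to [v] in the
    chart would make it smaller. *)
Lemma phi_image_closed (v : 'rV[R]_m.+1) i : v ord0 i != 0 ->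
  (forall t la, t != 0 -> v <> la *: phiv t) ->
  exists2 del : R, 0 < del & forall (w : 'rV[R]_m.+1) t la, w ord0 i != 0 -> t != 0 ->
    ball (dehom i v) del (dehom i w) -> w <> la *: phiv t.
Proof.
move=> vi Hv; pose x := (v ord0 i)^-1 *: v.
pose E t := sqnorm (phi i t *: x - phiv t).
have fE : formfun (d * 2) E.
  apply: formfun_sum => k _; apply: formfunX.
  rewrite (_ : (fun _ => _) = fun t => x ord0 k * phi i t - phi k t).
    by apply: formfunB => //; exact: formfunZ.
  by apply/funext => t; rewrite !mxE mulrC.
have ne : @sphere1 R 1 !=set0.
  exists (row2 1 0); rewrite /sphere1 /sqnorm /= !big_ord_recl big_ord0 !mxE /=.
  by rewrite expr1n expr0n !addr0.
have cE : {within @sphere1 R 1, continuous E}.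
  by apply: continuous_subspaceT; apply: polyfun_continuous; exact: formfun_polyfun fE.
have [c c1 Ec] := compact_EVT_min ne (@sphere_compact R 1) cE.
have cF : {within @sphere1 R 1, continuous (fun t => phi i t ^+ 2)}.
  apply: continuous_subspaceT; apply: polyfun_continuous; apply: polyfunX.
  exact: formfun_polyfun (fphi i).
have [g g1 Eg] := compact_EVT_max ne (@sphere_compact R 1) cF.
have s_neq0 t : sqnorm t = 1 -> t != 0 :> 'rV[R]_2.
  move=> nt1; apply/eqP => t0; move: nt1; rewrite t0 /sqnorm big1 => [/esym/eqP|k _].
    by rewrite oner_eq0.
  by rewrite mxE expr0n.
have c0 : c != 0 by apply: s_neq0; move: c1; rewrite inE.
have Ec0 : 0 < E c.
  rewrite lt_neqAle sqnorm_ge0 andbT eq_sym; apply/eqP => /sqnorm_eq0/subr0_eq e1.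
  have pic : phi i c != 0.
    apply/eqP => pic; move: e1; rewrite pic scale0r => /esym/eqP.
    exact/negP/phiv_neq0.
  apply: (Hv c (v ord0 i / phi i c)) => //.
  by rewrite -e1 scalerA divfK // /x scalerA divff // scale1r.
pose B := (m.+1)%:R * phi i g ^+ 2.
have B0 : 0 <= B by rewrite mulr_ge0 ?ler0n ?sqr_ge0.
have B1 : 0 < B + 1 by rewrite ltr_pwDr.
(* [B] bounds the sum of the weights [phi i ^ 2]. With [del <= 1], the squared deviations are at
   most [del], so [E] would be at most [B * del < E c]. *)
pose del := Num.min 1 (E c / (B + 1)).
have del0 : 0 < del by rewrite lt_min ltr01 divr_gt0.
exists del => // w t la wi t0 /(ball_row _ _ del0) wv wE.
pose nt := Num.sqrt (sqnorm t).
have nt0 : 0 < nt.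
  rewrite sqrtr_gt0 lt_neqAle sqnorm_ge0 andbT eq_sym.
  by apply: contraNneq t0 => /sqnorm_eq0 ->.
pose t' := nt^-1 *: t.
have t'1 : sqnorm t' = 1.
  by rewrite sqnormZ -[sqnorm t]sqr_sqrtr ?sqnorm_ge0 // -/nt -exprMn mulVf ?expr1n ?gt_eqF.
have t'S : t' \in @sphere1 R 1 by rewrite inE.
have pt' k : phi k t = nt ^+ d * phi k t'.
  by rewrite (formfun_scale _ _ (fphi k)) exprVn mulrA divff ?mul1r // expf_neq0 // gt_eqF.
have wk k : w ord0 k = la * phi k t by rewrite wE !mxE.
have la0 : la != 0 by apply: contraNneq wi => la0; rewrite wk la0 mul0r.
have pit : phi i t != 0 by apply: contraNneq wi => pi0; rewrite wk pi0 mulr0.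
have pit' : phi i t' != 0 by apply: contraNneq pit => pi0; rewrite pt' pi0 mulr0.
have ntd : nt ^+ d != 0 by rewrite expf_neq0 // gt_eqF.
have Et' : E t' <= B * del.
  have -> : B * del = \sum_(k < m.+1) phi i g ^+ 2 * del.
    by rewrite sumr_const card_ord -[RHS]mulr_natl mulrA.
  apply: ler_sum => k _; rewrite !mxE.
  have -> : phi i t' * ((v ord0 i)^-1 * v ord0 k) - phi k t' =
      phi i t' * (v ord0 k / v ord0 i - w ord0 k / w ord0 i).
    by rewrite !wk !pt'; field; rewrite vi ntd pit' la0.
  rewrite exprMn ler_pM ?sqr_ge0 //; first exact: Eg.
  case: (unliftP i k) => [k'|] ->; last by rewrite !divff // subrr expr0n ltW.
  have := wv k'; rewrite !mxE => H; rewrite -real_normK ?num_real //.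
  rewrite expr2 (le_trans (ler_pM _ _ (ltW H) (ltW H))) ?normr_ge0 //.
  by rewrite ger_pMl // ge_min lexx.
have := le_trans (Ec _ t'S) Et'; apply/negP; rewrite -ltNge.
apply: (@le_lt_trans _ _ (B * (E c / (B + 1)))).
  by rewrite ler_wpM2l // ge_min lexx orbT.
rewrite mulrCA gtr_pMr // ltr_pdivrMr // mul1r ltrDl //.
Qed.

(** Around a point off the image, all nearby points of [C] are off the image, so both [psi0] and
    [psi1] vanish at them by [psi_section]. Each chart coordinate then satisfies a fixed nontrivial
    equation, against local dimension 1. *)
Lemma local_phi v : proj_local_part C 1 v -> exists2 t, t != 0 & exists la, v = la *: phiv t.
Proof.
move=> [Cv [i [vi [e0 e00 He]]]]; apply: contrapT => Hn.
have [|del del0 Hdel] := phi_image_closed vi.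
  by move=> t la t0 vE; apply: Hn; exists t => //; exists la.
have m0 : 0 < Num.min e0 del by rewrite lt_min e00.
have [|[jj [_ jind]] _] := He _ m0; first by rewrite ge_min lexx.
(* A single form whose real zeros are the common zeros of [psi0] and [psi1]. *)
pose Q v := psi0 v ^+ 2 + psi1 v ^+ 2.
have fQ : formfun (e * 2) Q by apply: formfunD; exact: formfunX.
have Ci : exists2 v, C v & v ord0 i != 0 by exists v.
have [A [A0 AE A00]] := zar_dependent (lift i (jj ord0)) fQ Ci.
have Qnn w : Q w != 0 -> psiv w != 0.
  apply: contraNneq => /rowP pw; have := pw ord0; have := pw ord_max.
  by rewrite /psiv row2_0 row2_1 !mxE => p1 p0; rewrite /Q p0 p1 expr0n addr0.
have QC : exists2 v, C v & Q v != 0.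
  have [t t0 pt] := psi_nonzero; exists (phiv t); first exact: zar_phi.
  by rewrite gt_eqF // ltr_pwDr ?sqr_ge0 // exprn_even_gt0.
have /A00 {}A00 := QC.
have [p pE] : exists p : mpol R 1, forall x, mev p x = (A`_0).[x ord0 ord0].
  rewrite -[exists _, _]/(polyfun (fun x : 'rV[R]_1 => (A`_0).[x ord0 ord0])).
  under eq_fun do rewrite horner_coef.
  apply: polyfun_sum => k; apply: polyfunM; first exact: polyfun_cst.
  by apply: polyfunX; exact: polyfun_coord.
have p0 : p != 0.
  have [u] := poly_neq0 A00; apply: contraNneq => p0.
  by have := pE (\row__ u); rewrite p0 /mev mpoly.meval0 mxE => <-.
have [_ [[[w [Cw wi] <-] wb]]] := jind p p0; rewrite pE !mxE; apply/negP/negPn/eqP.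
have Qw : Q w = 0.
  apply/eqP/negPn/negP => /Qnn/(psi_section Cw) [t t0 [la]].
  apply: Hdel => //; apply: le_ball wb; by rewrite ge_min lexx orbT.
have := AE w Cw wi; rewrite Qw mul0r.
have hP : A.[0%:P] = A`_0 by rewrite horner_coef0.
by rewrite hP.
Qed.

End RationalCurve.

Theorem rational_closure (R : realType) (m : nat) (S0 S : set 'rV[R]_m) :
  S `<=` closure S0 -> S !=set0 -> rat_connected S0 S -> has_dim S 1 ->
  real_rational_curve (proj_zar_closure S).
Proof.
move=> dS Sne conn dim1.
have [N [h [j [t1 [t2 [h0 cS cj zar]]]]]] := zariski_curve dS Sne conn dim1.
pose M (i : 'I_m.+1) := if unlift ord0 i is Some k then N k else h.
have M0E : M ord0 = h by rewrite /M unlift_none.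
have M00 s : (M ord0).[s] != 0 by rewrite M0E.
have Mj c : M (lift ord0 j) <> c *: M ord0.
  rewrite M0E /M liftK => e; move/negP: cj; apply.
  by rewrite !mxE e !hornerZ !mulfK.
have [d [phi [e [psi0 [psi1 [a [b [[fphi phi0 fpsi0 fpsi1] [b0 ab Mphi aE bE]]]]]]]]] :=
  luroth_param M00 Mj.
have [P PP] : exists P : 'I_m.+1 -> mpol R 2, forall i, is_homog d (P i) /\ forall t, mev (P i) t = phi i t.
  by have [P PP] := choice fphi; exists P.
have PE t : hev P t = \row_i phi i t by apply/rowP => i; rewrite !mxE; have [_ ->] := PP i.
have [P0 [hP0 P0E]] := fpsi0; have [P1 [hP1 P1E]] := fpsi1.
have I1 : (1 : 'I_2) = ord_max by exact: val_inj.
split; first exact: (zar_irreducible h0 cS zar).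
split; first exact: (zar_dim h0 cS cj zar).
exists d, P; split; first by move=> i; have [] := PP i.
split.
  by move=> t /phi0[i pi]; rewrite PE; apply/eqP => /rowP/(_ i)/eqP; rewrite !mxE; exact/negP.
split.
  by move=> t t0; rewrite PE; exact: (phi_local h0 cS cj zar fphi phi0 b0 ab Mphi).
split.
  move=> v /(local_phi h0 cS zar fphi phi0 fpsi0 fpsi1 b0 ab Mphi aE bE)[t t0 [la vE]].
  by exists t => //; exists la; rewrite PE.
exists e, P0, P1; split=> //; split=> //; split.
  have [t t0 pt] := psi_nonzero h0 phi0 fpsi1 b0 Mphi bE.
  by exists t; right; rewrite P1E PE.
move=> t; rewrite P0E P1E PE I1; exact: (psi_inverse h0 fphi fpsi0 fpsi1 b0 ab Mphi aE bE).
Qed.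

(** * Balls and spheres *)

Section Images.
Variable R : realType.

Lemma rat_eval_continuous n m (g h : 'I_m -> mpol R n) x :
  (forall i, mev (h i) x != 0) -> {for x, continuous (rat_eval g h)}.
Proof.
move=> hx; apply: cvg_row => i.
rewrite (_ : (fun _ => _) = fun t => mev (g i) t / mev (h i) t).
  apply: continuousM; first exact: continuous_mev.
  by apply: continuousV => //; exact: continuous_mev.
by apply/funext => t; rewrite mxE.
Qed.

Lemma regular_regulous n m (S : set 'rV[R]_m) (T : set 'rV[R]_n) :
  regular_image S T -> regulous_image S T.
Proof.
move=> [g [h [h0 [hT ->]]]]; exists g, h, (rat_eval g h); split=> //=; split.
  by move=> x Tx; apply: subset_closure; split=> // i; exact: hT.
split=> //; apply/subspace_continuousP => x Tx.
apply: cvg_trans (rat_eval_continuous (fun i => hT i x Tx)).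
exact: cvg_app (@cvg_within _ _ _ _).
Qed.

Let pr n (y : 'rV[R]_n.+1) : 'rV[R]_n := \row_i y ord0 (lift ord0 i).

Let pr_continuous n : continuous (@pr n).
Proof.
move=> y; apply: cvg_row => i; rewrite (_ : (fun _ => _) = fun t : 'rV[R]_n.+1 => t ord0 (lift ord0 i)).
  exact: coord_continuous.
by apply/funext => t; rewrite mxE.
Qed.

Let sqnorm_pr n (y : 'rV[R]_n.+1) : sqnorm y = y ord0 ord0 ^+ 2 + sqnorm (pr y).
Proof. by rewrite /sqnorm big_ord_recl; congr (_ + _); apply: eq_bigr => i _; rewrite mxE. Qed.

(** For [s = 1] and [s = -1], the graphs of the two closed hemispheres over the ball. *)
Let sect n (s : R) (x : 'rV[R]_n) : 'rV[R]_n.+1 :=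
  \row_i (if unlift ord0 i is Some k then x ord0 k else s * Num.sqrt (1 - sqnorm x)).

Let pr_sect n s : cancel (@sect n s) (@pr n).
Proof. by move=> x; apply/rowP => i; rewrite !mxE liftK. Qed.

Let sect_continuous n s : continuous (@sect n s).
Proof.
move=> x; apply: cvg_row => i; case: (unliftP ord0 i) => [k|] ->.
  rewrite (_ : (fun _ => _) = fun t : 'rV[R]_n => t ord0 k).
    exact: coord_continuous.
  by apply/funext => t; rewrite mxE liftK.
rewrite (_ : (fun _ => _) = fun t : 'rV[R]_n => s * Num.sqrt (1 - sqnorm t)).
  apply: continuousM; first exact: cst_continuous.
  apply: (@continuous_comp _ _ _ (fun t : 'rV[R]_n => 1 - sqnorm t) (@Num.sqrt R)).
    by apply: continuousB; [exact: cst_continuous|exact: polyfun_continuous (@polyfun_sqnorm _ _) _].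
  exact: sqrt_continuous.
by apply/funext => t; rewrite mxE unlift_none.
Qed.

Let sect_sphere n s (x : 'rV[R]_n) : s ^+ 2 = 1 -> closed_ball1 x -> sqnorm (sect s x) = 1.
Proof.
move=> s1 x1; rewrite sqnorm_pr pr_sect mxE unlift_none exprMn s1 sqr_sqrtr ?subr_ge0 //.
by rewrite mul1r subrK.
Qed.

Let sphere_sect n (y : 'rV[R]_n.+1) : sqnorm y = 1 -> exists2 s, s ^+ 2 = 1 & y = sect s (pr y).
Proof.
move=> y1; have e0 : 1 - sqnorm (pr y) = y ord0 ord0 ^+ 2 by rewrite -y1 sqnorm_pr addrK.
exists ((-1) ^+ (y ord0 ord0 < 0)%R); first by rewrite sqrr_sign.
apply/rowP => i; rewrite !mxE; case: (unliftP ord0 i) => [k|] ->; first by rewrite mxE.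
by rewrite e0 sqrtr_sqr -realEsign // num_real.
Qed.

Let ball_pr n (y : 'rV[R]_n.+1) : sphere1 y -> closed_ball1 (pr y).
Proof. by rewrite /sphere1 /closed_ball1 /= sqnorm_pr => <-; rewrite lerDr sqr_ge0. Qed.

Let lifted n k (q : 'I_k -> mpol R n) :
  exists q' : 'I_k -> mpol R n.+1, forall i y, mev (q' i) y = mev (q i) (pr y).
Proof.
have /choice[q' q'E] : forall i, exists q' : mpol R n.+1, forall y, mev q' y = mev (q i) (pr y).
  move=> i; apply: polyfun_comp (polyfun_mev (q i)) _ => j.
  by under eq_fun do rewrite mxE; exact: polyfun_coord.
by exists q'.
Qed.

(** The map is composed with the projection of the sphere onto the ball. Density of the good points
    lifts through the two continuous sections, since every point of the sphere lies on one of the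
    hemispheres. *)
Lemma regulous_ball_sphere n m (S : set 'rV[R]_m) :
  regulous_image S (@closed_ball1 R n) -> regulous_image S (@sphere1 R n).
Proof.
move=> [g [h [F [h0 /= [TD [cF [FE SE]]]]]]].
have [g' g'E] := lifted g; have [h' h'E] := lifted h.
exists g', h', (F \o @pr n); split.
  move=> i; have [x hx] := mev_neq0 (h0 i); apply: contraNneq hx => h'0.
  by have := h'E i (sect 1 x); rewrite h'0 /mev mpoly.meval0 pr_sect => <-.
split=> /=.
  move=> y y1 B By; have [s s1 yE] := sphere_sect y1.
  have /TD xD := ball_pr y1; move: By; rewrite {1}yE => By.
  have [x [[x1 xh] Bx]] := xD _ (sect_continuous (s := s) By).
  exists (sect s x); split=> //; split; first exact: sect_sphere.
  by move=> i; rewrite h'E pr_sect.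
split.
  apply/subspace_continuousP => y y1 B BF.
  have := (subspace_continuousP _ _).1 cF _ (ball_pr y1) B BF.
  move=> /(@pr_continuous n y) H; apply: (@filterS _ (nbhs y) _ _ _ _ H) => z /= Hz z1.
  by apply: Hz; exact: ball_pr.
split.
  move=> y [y1 hy]; rewrite /= FE; last by split; [exact: ball_pr|move=> i; rewrite -h'E].
  by apply/rowP => i; rewrite !mxE g'E h'E.
rewrite SE; apply/seteqP; split=> [_ [x x1 <-]|_ [y y1 <-]]; last first.
  by exists (pr y) => //; exact: ball_pr.
by exists (sect 1 x); rewrite /= ?pr_sect //; apply: sect_sphere; rewrite ?expr1n.
Qed.

Lemma regular_ball_sphere n m (S : set 'rV[R]_m) :
  regular_image S (@closed_ball1 R n) -> regular_image S (@sphere1 R n).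
Proof.
move=> [g [h [h0 [hT SE]]]].
have [g' g'E] := lifted g; have [h' h'E] := lifted h.
exists g', h'; split.
  move=> i; have [x hx] := mev_neq0 (h0 i); apply: contraNneq hx => h'0.
  by have := h'E i (sect 1 x); rewrite h'0 /mev mpoly.meval0 pr_sect => <-.
split; first by move=> i y y1; rewrite h'E; apply: hT; exact: ball_pr.
have E y : rat_eval g' h' y = rat_eval g h (pr y).
  by apply/rowP => i; rewrite !mxE g'E h'E.
rewrite SE; apply/seteqP; split=> [_ [x x1 <-]|_ [y y1 <-]]; last first.
  by exists (pr y); [exact: ball_pr|rewrite E].
exists (sect 1 x); rewrite ?E ?pr_sect //; apply: sect_sphere; rewrite ?expr1n //.
Qed.

End Images.

(** * Irreducible sets in a rational curve *)

Section Irreducible.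
Variables (R : realType) (m : nat) (S : set 'rV[R]_m).

Lemma nash_on_sub (T : set 'rV[R]_m) f : S `<=` T -> nash_on T f -> nash_on S f.
Proof.
move=> ST [U [oU [sU [TU [g [ng gf]]]]]]; exists U; split=> //; split=> //; split.
  exact: subset_trans TU.
by exists g; split=> // x /ST; exact: gf.
Qed.

Hypotheses (irr : sa_irreducible S) (dim1 : has_dim S 1).

Let m0 : (0 < m)%N.
Proof. by have [[j _] _] := dim1; case: m (j ord0) => [[]|]. Qed.

(* [P * sqrt B - A] and [P * sqrt B + A] are Nash functions on [S] with product zero. *)
Lemma irreducible_sign (P A B : 'rV[R]_m -> R) : polyfun P -> polyfun A -> polyfun B ->
  (forall x, S x -> 0 < B x) -> (forall x, S x -> P x ^+ 2 * B x = A x ^+ 2) ->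
  (forall x, S x -> P x * Num.sqrt (B x) = A x) \/
  (forall x, S x -> P x * Num.sqrt (B x) = - A x).
Proof.
move=> [p pE] [a aE] [b bE] B0 PBA.
have Sb : S `<=` [set x | 0 < mev b x] by move=> x /B0; rewrite /= bE.
have nf (c : mpol R m) : nash_on S (fun x => mev p x * Num.sqrt (mev b x) + mev c x).
  exact: nash_on_sub Sb (nash_sqrt _ _ _ m0).
have [_ /(_ _ _ (nf (- a)) (nf a))] := irr.
have NaE x : mev (- a) x = - A x by rewrite -aE /mev mpoly.mevalN.
case.
- move=> x Sx; rewrite NaE aE bE pE -subr_sqr exprMn sqr_sqrtr ?ltW ?B0 //.
  by rewrite PBA // subrr.
- by move=> H; left=> x /H; rewrite NaE bE pE => /eqP; rewrite subr_eq0 => /eqP.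
- by move=> H; right=> x /H; rewrite aE bE pE => /eqP; rewrite addr_eq0 => /eqP.
Qed.

(** For an isolated [x], the function [A = |y - x|^2 - e^2 / 2] is negative at [x] and positive on
    the rest of [S]. As [|A|] is the Nash function [sqrt (A^2)], it must be [A] or [-A] throughout,
    so [S] would be the point [x] alone. *)
Lemma irreducible_no_isolated x (e : R) : S x -> 0 < e -> exists y, [/\ S y, ball x e y & y != x].
Proof.
move=> Sx e0; apply: contrapT => Hn.
have Sfar y : S y -> y != x -> e ^+ 2 <= sqnorm (y - x).
  move=> Sy yx; rewrite leNgt; apply/negP => se; apply: Hn; exists y; split=> //.
  apply/ball_row => // i; rewrite distrC -ltr_sqr ?nnegrE ?normr_ge0 ?(ltW e0) //.
  rewrite real_normK ?num_real // (le_lt_trans _ se) // (le_trans _ (coord_sqnorm _ i)) //.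
  by rewrite !mxE.
pose A y := sqnorm (y - x) - e ^+ 2 / 2.
have PA : polyfun A.
  apply: polyfunB; last exact: polyfun_cst.
  apply: polyfun_comp (@polyfun_sqnorm _ _) _ => i.
  rewrite (_ : (fun _ => _) = fun y : 'rV[R]_m => y ord0 i - x ord0 i).
    by apply: polyfunB; [exact: polyfun_coord|exact: polyfun_cst].
  by apply/funext => y; rewrite !mxE.
have e2 : 0 < e ^+ 2 by rewrite exprn_gt0.
have Ax : A x < 0.
  rewrite /A subrr /sqnorm big1 => [|i _]; last by rewrite mxE expr0n.
  by rewrite sub0r oppr_lt0 divr_gt0.
have Ay y : S y -> y != x -> 0 < A y.
  move=> Sy yx; rewrite subr_gt0 (lt_le_trans _ (Sfar y Sy yx)) //.
  by rewrite ltr_pdivrMr // ltr_pMr // ltr1n.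
have A0 y : S y -> A y != 0.
  by move=> Sy; have [->|/(Ay y Sy)] := eqVneq y x; [rewrite lt_eqF|exact: lt0r_neq0].
have [i [y [z [Sy Sz]]]] := dim1_nonconstant irr.1 dim1; apply/negP/negPn.
have yx y' : S y' -> y' = x.
  move=> Sy'; apply/eqP/negPn/negP => y'x.
  have [||H|H] := irreducible_sign (@polyfun_cst R m 1) PA (polyfunX 2 PA).
  - by move=> w Sw; rewrite exprn_even_gt0 // A0.
  - by move=> w Sw; rewrite expr1n mul1r.
  - by have := H x Sx; rewrite mul1r sqrtr_sqr => AA; have := normr_ge0 (A x); rewrite AA leNgt Ax.
  - have := H y' Sy'; rewrite mul1r sqrtr_sqr gtr0_norm ?Ay // => AA.
    by have := Ay y' Sy' y'x; lra.
by rewrite (yx y Sy) (yx z Sz).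
Qed.

(** If every coordinate took finitely many values near [x], avoiding those different from the
    coordinates of [x] would isolate [x]. *)
Lemma irreducible_infinite x (e : R) : S x -> 0 < e ->
  exists k, infinite_set [set y ord0 k | y in S `&` ball x e].
Proof.
move=> Sx e0; apply: contrapT => /forallNP H.
pose V k := [set y ord0 k | y in S `&` ball x e].
have fV k : finite_set (V k) by have := H k => /contrapT.
have nV k : \forall y \near x ord0 k, ~ (V k `\ x ord0 k) y.
  have cV : closed (V k `\ x ord0 k).
    have aR : accessible_space R by exact/hausdorff_accessible/Rhausdorff.
    by apply: (accessible_finite_set_closed.1 aR); exact: finite_setD.
  apply: (open_nbhs_nbhs (conj (closed_openC cV) _)).
  by move=> [_ /=]; apply.
have nx : nbhs x (fun y : 'rV[R]_m => forall k, ~ (V k `\ x ord0 k) (y ord0 k)).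
  apply: (@filter_forall _ _ (fun k (y : 'rV[R]_m) => ~ (V k `\ x ord0 k) (y ord0 k)) _ (nbhs_filter x)) => k.
  exact: (@coord_continuous R 1 m ord0 k x) _ (nV k).
have /nbhs_ballP[d /= d0 Hd] : nbhs x (fun y : 'rV[R]_m => ball x e y /\ forall k, ~ (V k `\ x ord0 k) (y ord0 k)).
  by apply: filterS2 nx (nbhsx_ballx x e e0) => y Hy yb.
have [y [Sy yb yx]] := irreducible_no_isolated Sx d0.
have [ye Hy] := Hd y yb; move/negP: yx; apply; apply/eqP/rowP => k.
apply: contrapT => yk; apply: (Hy k); split=> //; by exists y.
Qed.

Lemma hlift_closure x : S x -> proj_zar_closure S (hlift x).
Proof. by move=> Sx; split=> [|d P hP]; [exact: hlift_neq0|apply]. Qed.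

Lemma hlift_local x : S x -> proj_local_part (proj_zar_closure S) 1 (hlift x).
Proof.
move=> Sx; split; first exact: hlift_closure.
exists ord0; split; first by rewrite hlift0 oner_eq0.
rewrite dehom_hlift; exists 1 => // eps eps0 _; split.
  have [k ik] := irreducible_infinite Sx eps0; apply: (@coord_indep1 _ _ _ k).
  apply: sub_infinite_set ik => _ [y [Sy yb] <-]; exists y => //; split=> //.
  exists (hlift y); last exact: dehom_hlift.
  by split; [exact: hlift_closure|rewrite /= hlift0 oner_eq0].
move=> k' jj jinj jind; rewrite leqNgt; apply/negP => k1.
pose l0 : 'I_k' := Ordinal (ltnW k1); pose l1 : 'I_k' := Ordinal k1.
have [A A0 AE] := dim1_algebraic dim1 (jj l0) (jj l1).
(* The relation between two coordinates on [S] is homogenized, so that it holds on the projective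
   closure. *)
have [d [g [[P [hP PE]] gE]]] := homogenize (poly_mpol2 (jj l0) (jj l1) A).
have [//|p p0 pE] := @poly2_mpol R k' l0 l1 A A0.
have [y [[[w [Cw w0] <-] _]]] := jind p p0; apply/negP/negPn; rewrite pE !mxE.
have := gE w w0; rewrite -PE !mxE; have [_ /(_ d P hP) ->] := Cw.
  by move/esym/eqP; rewrite mulf_eq0 expf_eq0 (negbTE w0) andbF.
move=> y' Sy'; rewrite PE gE; last by rewrite hlift0 oner_eq0.
by rewrite dehom_hlift (AE (exist _ y' Sy')) mulr0.
Qed.

End Irreducible.

(** * Binary forms and real polynomials: roots, positivity, growth *)

Lemma form_poly (R : realType) D (f : 'rV[R]_2 -> R) : formfun D f ->
  exists G : {poly R}, [/\ (size G <= D.+1)%N, forall x, G.[x] = f (row2 x 1) & G`_D = f (row2 1 0)].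
Proof.
move=> [P [hP PE]].
have dP mm : mm \in mpoly.msupp P -> (mm ord0 + mm ord_max)%N = D.
  move=> mP; have <- : mpoly.mdeg mm = D by move/mpoly.dhomogP: hP; apply.
  rewrite mpoly.mdegE big_ord_recl big_ord1.
  by rewrite (_ : lift ord0 ord0 = ord_max) //; exact: val_inj.
have pE (mm : mpoly.multinom 2) (v : 'rV[R]_2) :
    \prod_(i < 2) v ord0 i ^+ mm i = v ord0 ord0 ^+ mm ord0 * v ord0 ord_max ^+ mm ord_max.
  by rewrite big_ord_recl big_ord1 (_ : lift ord0 ord0 = ord_max) //; exact: val_inj.
exists (\sum_(mm <- mpoly.msupp P) mpoly.mcoeff mm P *: 'X^(mm ord0)); split.
- rewrite big_seq (leq_trans (size_sum _ _ _)) //; apply/bigmax_leqP_seq => mm mP _.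
  by rewrite (leq_trans (size_scale_leq _ _)) // size_polyXn ltnS -(dP mm mP) leq_addr.
- move=> x; rewrite -PE mevE horner_sum; apply: eq_bigr => mm _.
  by rewrite hornerZ hornerXn pE row2_0 row2_1 expr1n mulr1.
- rewrite -PE mevE coef_sum big_seq [RHS]big_seq; apply: eq_bigr => mm mP.
  rewrite coefZ coefXn pE row2_0 row2_1 expr1n mul1r expr0n -(dP mm mP).
  by congr (_ * (nat_of_bool _)%:R); rewrite -{2}[mm ord0]addn0 eqn_add2l.
Qed.

Section RealPolys.
Variable R : realType.

(** Each root to the right of [t0] is moved to [C1] with its full multiplicity, which keeps the
    factors coprime; whatever has no real root stays in [C2]. *)
Lemma split_roots (C : {poly R}) t0 : C.[t0] != 0 ->
  exists C1 C2, [/\ C = C1 * C2, coprimep C1 C2, forall t, C1.[t] = 0 -> t0 < t &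
    forall t, C2.[t] = 0 -> t < t0].
Proof.
have [n] := ubnP (size C); elim: n C => // n IHn C sC Ct0.
have C0 : C != 0 by apply: contraNneq Ct0 => ->; rewrite horner0.
have [[a ta /eqP Ca]|Cn] := pselect (exists2 a, t0 < a & root C a); last first.
  exists 1, C; split; rewrite ?mul1r ?coprime1p // => t.
    by rewrite hornerC => /eqP; rewrite oner_eq0.
  move=> Ct; rewrite ltNge le_eqVlt; apply/negP => /orP[/eqP tE|tt0].
    by move: Ct0; rewrite tE Ct eqxx.
  by apply: Cn; exists t => //; apply/rootP.
have [k [B]] := multiplicity_XsubC C a; rewrite C0 /= => Ba CE.
have k0 : (0 < k)%N.
  by rewrite lt0n; apply: contra Ba => /eqP k0; rewrite -[B]mulr1 -(expr0 ('X - a%:P)) -k0 -CE /root Ca.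
have B0 : B != 0 by apply: contraNneq Ba => ->; rewrite root0.
have [||B1 [B2 [BE cB r1 r2]]] := IHn B.
- move: sC; rewrite CE size_Mmonic ?monic_exp ?monicXsubC // size_exp_XsubC.
  by move: (size B) => sb; lia.
- by apply: contra Ct0; rewrite CE hornerM => /eqP ->; rewrite mul0r.
exists (('X - a%:P) ^+ k * B1), B2; split.
- by rewrite CE BE mulrC mulrA.
- rewrite coprimepMl cB andbT coprimep_expl // coprimep_sym coprimep_XsubC.
  by apply: contra Ba; rewrite BE rootM orbC => ->.
- move=> t; rewrite hornerM horner_exp hornerXsubC => /eqP.
  by rewrite mulf_eq0 expf_eq0 k0 subr_eq0 /= => /orP[/eqP ->|/eqP/r1].
- exact: r2.
Qed.

(** On the compact part of [K] where [a <= 0], the minimum of [b] is positive, and a large [la]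
    outweighs the minimum of [a]. *)
Lemma positive_combination (K : set R) (a b : {poly R}) : compact K ->
  (forall t, K t -> 0 <= b.[t]) -> (forall t, K t -> b.[t] = 0 -> 0 < a.[t]) ->
  exists la0, forall la, la0 <= la -> forall t, K t -> 0 < (a + la *: b).[t].
Proof.
move=> cK b0 ab.
pose K' := K `&` [set t | a.[t] <= 0].
have [[t1 K't1]|nK'] := pselect (K' !=set0); last first.
  exists 0 => la la0 t Kt; rewrite hornerD hornerZ ltr_pwDl ?mulr_ge0 ?b0 //.
  by rewrite ltNge; apply/negP => at0; apply: nK'; exists t.
have cp (p : {poly R}) A : {within A, continuous (horner p)}.
  by apply: continuous_subspaceT => t; exact: continuous_horner.
have cK' : compact K'.
  apply: compact_closedI => //; rewrite (_ : [set t | _] = horner a @^-1` [set u | u <= 0]) //.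
  by apply: closed_comp => [t _|]; [exact: continuous_horner|exact: closed_le].
have [c cK'c bc] := compact_EVT_min (ex_intro _ t1 K't1) cK' (cp b K').
have [c' cKc' ac'] := compact_EVT_min (ex_intro _ t1 K't1.1) cK (cp a K).
have bc0 : 0 < b.[c].
  move: cK'c; rewrite inE => -[Kc ac]; rewrite lt_neqAle b0 // andbT eq_sym.
  by apply/eqP => /(ab c Kc); rewrite ltNge ac.
have la0 : 0 <= (`|a.[c']| + 1) / b.[c] by rewrite divr_ge0 ?addr_ge0 ?(ltW bc0).
exists ((`|a.[c']| + 1) / b.[c]) => la lela t Kt; rewrite hornerD hornerZ.
have [at0|at0] := ltP 0 a.[t].
  by rewrite ltr_pwDl ?mulr_ge0 ?b0 // (le_trans la0).
have bct : b.[c] <= b.[t] by apply: bc; rewrite inE.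
have act : a.[c'] <= a.[t] by apply: ac'; rewrite inE.
have H : `|a.[c']| + 1 <= la * b.[t].
  apply: (@le_trans _ _ ((`|a.[c']| + 1) / b.[c] * b.[c])).
    by rewrite divfK // gt_eqF.
  by apply: ler_pM => //; exact: ltW.
by have := ler_norm (- a.[c']); rewrite normrN; lra.
Qed.

Lemma poly_growth (p : {poly R}) n : (size p <= n.+1)%N ->
  exists2 L, 0 <= L & forall t, 1 <= `|t| -> `|p.[t]| <= L * `|t| ^+ n.
Proof.
move=> pn; exists (\sum_(i < n.+1) `|p`_i|); first exact: sumr_ge0.
move=> t t1; rewrite (horner_coef_wide _ pn) (le_trans (ler_norm_sum _ _ _)) // big_distrl /=.
apply: ler_sum => i _; rewrite normrM normrX ler_wpM2l // ler_weXn2l //.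
by rewrite -ltnS.
Qed.

Lemma sqr_norm_le1 (z : R) : (z ^+ 2 <= 1) = (`|z| <= 1).
Proof. by rewrite -[z ^+ 2]real_normK ?num_real // expr_le1. Qed.

Lemma polyfun_horner n (p : {poly R}) (f : 'rV[R]_n -> R) : polyfun f -> polyfun (fun v => p.[f v]).
Proof.
move=> Pf; under eq_fun do rewrite horner_coef.
by apply: polyfun_sum => i; apply: polyfunM; [exact: polyfun_cst|exact: polyfunX].
Qed.

End RealPolys.

(** * The affine parameter, its conductor and the interval of parameters *)

Section Affine.
Variables (R : realType) (m : nat) (S : set 'rV[R]_m).
Variables (d e : nat) (phi : 'I_m.+1 -> 'rV[R]_2 -> R) (psi0 psi1 : 'rV[R]_m.+1 -> R).
Let phiv t : 'rV[R]_m.+1 := \row_i phi i t.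
Let w := phiv (row2 1 0).
Hypotheses (fphi : forall i, formfun d (phi i)) (phi0 : forall t, t != 0 -> phiv t != 0)
  (fpsi0 : formfun e psi0) (fpsi1 : formfun e psi1)
  (psi_phi : forall t, psi0 (phiv t) * t ord0 ord_max = psi1 (phiv t) * t ord0 ord0)
  (S_phi : forall x, S x -> exists2 t, t != 0 & exists la, hlift x = la *: phiv t)
  (S_w : forall x la, S x -> hlift x <> la *: w).

Variable N : 'I_m.+1 -> {poly R}.
Hypotheses (sN : forall i, (size (N i) <= d.+1)%N) (NE : forall i x, (N i).[x] = phi i (row2 x 1))
  (Nd : forall i, (N i)`_d = phi i (row2 1 0)).

Let Phi T : 'rV[R]_m.+1 := \row_i (N i).[T].
Let x T := dehom ord0 (Phi T).
Let J := [set T | (N ord0).[T] != 0 /\ S (x T)].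
Let ka := sqnorm w.
(* Vanishes exactly on the line spanned by [w], the point at infinity of the parameter line. *)
Let E0 (v : 'rV[R]_m.+1) := sqnorm (ka *: v - dotp v w *: w).
Let E (y : 'rV[R]_m) := E0 (hlift y).

Let PhiE T : Phi T = phiv (row2 T 1).
Proof. by apply/rowP => i; rewrite !mxE NE. Qed.

Let Phi_neq0 T : Phi T != 0.
Proof.
rewrite PhiE; apply: phi0; apply/eqP => /rowP/(_ ord_max)/eqP.
by rewrite row2_1 mxE oner_eq0.
Qed.

Let w_neq0 : w != 0.
Proof.
apply: phi0; apply/eqP => /rowP/(_ ord0)/eqP.
by rewrite row2_0 mxE oner_eq0.
Qed.

Let ka0 : 0 < ka.
Proof.
by rewrite lt_neqAle sqnorm_ge0 andbT eq_sym; apply: contra w_neq0 => /eqP/sqnorm_eq0 ->.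
Qed.

Let hlift_x T : (N ord0).[T] != 0 -> hlift (x T) = (N ord0).[T]^-1 *: Phi T.
Proof.
move=> N0; have P0 : Phi T ord0 ord0 != 0 by rewrite mxE.
by rewrite [in RHS](hlift_dehom P0) scalerA [Phi T _ _]mxE mulVf // scale1r.
Qed.

Let J_cover y : S y -> exists2 T, J T & x T = y.
Proof.
move=> Sy; have [t t0 [la yE]] := S_phi Sy.
have t1 : t ord0 ord_max != 0.
  apply/eqP => t1; apply: (@S_w y (la * t ord0 ord0 ^+ d)) => //.
  rewrite yE -scalerA; congr (_ *: _); apply/rowP => i; rewrite !mxE.
  rewrite -(formfun_scale _ _ (fphi i)); congr phi.
  by rewrite {1}[t]row2_eta t1; apply/rowP => l; rewrite !mxE; case: ifP; rewrite ?mulr1 ?mulr0.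
pose T := t ord0 ord0 / t ord0 ord_max.
have tE : hlift y = (la * t ord0 ord_max ^+ d) *: Phi T.
  rewrite yE -scalerA; congr (_ *: _); apply/rowP => i; rewrite !mxE NE.
  rewrite -(formfun_scale _ _ (fphi i)); congr phi.
  rewrite {1}[t]row2_eta; apply/rowP => l; rewrite !mxE; case: ifP => _; last by rewrite mulr1.
  by rewrite mulrC divfK.
have e0 : 1 = (la * t ord0 ord_max ^+ d) * (N ord0).[T].
  by rewrite -[LHS](hlift0 y) tE !mxE.
have N0 : (N ord0).[T] != 0.
  by apply/eqP => N0; move/eqP: e0; rewrite N0 mulr0 oner_eq0.
have xE : x T = y.
  apply/rowP => j; rewrite -(hliftS y) tE !mxE.
  by rewrite -[LHS]mulr1 e0; field.
by exists T => //; split=> //; rewrite xE.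
Qed.

Let PE0 : polyfun E0.
Proof.
apply: polyfun_comp (@polyfun_sqnorm _ _) _ => i.
rewrite (_ : (fun _ => _) = fun v : 'rV[R]_m.+1 => ka * v ord0 i - dotp v w * w ord0 i).
  apply: polyfunB; first by apply: polyfunM; [exact: polyfun_cst|exact: polyfun_coord].
  apply: polyfunM; last exact: polyfun_cst.
  by apply: polyfun_sum => j; apply: polyfunM; [exact: polyfun_coord|exact: polyfun_cst].
by apply/funext => v; rewrite !mxE.
Qed.

Let PE : polyfun E. Proof. exact: polyfun_hlift PE0. Qed.

Let E_gt0 y : S y -> 0 < E y.
Proof.
move=> Sy; rewrite lt_neqAle sqnorm_ge0 andbT eq_sym; apply/eqP => /sqnorm_eq0/subr0_eq e1.
apply: (@S_w y (ka^-1 * dotp (hlift y) w)) => //.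
by rewrite -scalerA -e1 scalerA mulVf ?scale1r // gt_eqF.
Qed.

Let E0_scale c v : E0 (c *: v) = c ^+ 2 * E0 v.
Proof.
rewrite /E0 -sqnormZ; congr sqnorm.
by rewrite dotpZ scalerBr !scalerA [c * ka]mulrC.
Qed.

Let g := \sum_(i < m.+1) N i ^+ 2.
Let q i := ka *: N i - w ord0 i *: \sum_(j < m.+1) w ord0 j *: N j.
Let ee := \sum_(i < m.+1) q i ^+ 2.

Let gE T : g.[T] = sqnorm (Phi T).
Proof. by rewrite /g horner_sum; apply: eq_bigr => i _; rewrite horner_exp mxE. Qed.

Let eeE T : ee.[T] = E0 (Phi T).
Proof.
rewrite /ee horner_sum; apply: eq_bigr => i _; rewrite horner_exp; congr (_ ^+ 2).
rewrite /q hornerD hornerN !hornerZ horner_sum !mxE; congr (_ - _).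
by rewrite mulrC; congr (_ * _); apply: eq_bigr => j _; rewrite hornerZ !mxE mulrC.
Qed.

Let coef_lt (p : {poly R}) n : (size p <= n.+1)%N -> p`_n = 0 -> (size p <= n)%N.
Proof.
move=> pn p0; rewrite leqNgt; apply/negP => np.
have sp : size p = n.+1 by apply/eqP; rewrite eqn_leq pn np.
have : lead_coef p == 0 by rewrite lead_coefE sp p0.
by rewrite lead_coef_eq0 -size_poly_eq0 sp.
Qed.

(** The coefficient of [T^d] in [Phi] is [w], which the linear map behind [E0] kills; so each [q i]
    has degree less than [d]. *)
Let size_ee : (size ee <= d.*2)%N.
Proof.
have sq i : (size (q i) <= d)%N.
  apply: coef_lt.
    rewrite (leq_trans (size_polyD _ _)) // geq_max size_polyN.
    rewrite !(leq_trans (size_scale_leq _ _)) //.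
    by rewrite (leq_trans (size_sum _ _ _)) //; apply/bigmax_leqP => j _; rewrite (leq_trans (size_scale_leq _ _)).
  rewrite /q coefB !coefZ coef_sum (_ : \sum_(j < m.+1) _ = ka).
    by rewrite Nd mxE mulrC subrr.
  by apply: eq_bigr => j _; rewrite coefZ Nd mxE expr2.
rewrite (leq_trans (size_sum _ _ _)) //; apply/bigmax_leqP => i _.
by rewrite expr2 (leq_trans (size_polyMleq _ _)) // (leq_trans (leq_pred _)) // -addnn leq_add.
Qed.

(** The coefficient of [T^(2 d)] in [g] is [ka = |w|^2], so [r] has degree less than [2 d]. *)
Let r := ka *: 'X^(d.*2) - g.

Let size_r : (size r <= d.*2)%N.
Proof.
apply: coef_lt.
  rewrite (leq_trans (size_polyD _ _)) // geq_max size_polyN.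
  rewrite (leq_trans (size_scale_leq _ _)) ?size_polyXn //=.
  rewrite (leq_trans (size_sum _ _ _)) //; apply/bigmax_leqP => i _.
  rewrite expr2 (leq_trans (size_polyMleq _ _)) // -addnn.
  by have := sN i; move: (size _) => s sd; lia.
rewrite /r coefB coefZ coefXn eqxx mulr1 /g coef_sum.
rewrite (_ : \sum_(i < m.+1) _ = ka) ?subrr //; apply: eq_bigr => i _.
rewrite expr2 coefM -addnn (bigD1 (inord d)) //= inordK ?ltnS ?leq_addr //.
rewrite addnK Nd big1 => [|j jd]; first by rewrite addr0 mxE expr2.
have [dj|jd'] := ltnP d j.
  by rewrite nth_default ?mul0r // (leq_trans (sN i)).
rewrite [X in _ * X]nth_default ?mulr0 // (leq_trans (sN i)) //.
have jnd : j != d :> nat by apply: contra jd => /eqP jE; apply/eqP/val_inj; rewrite /= inordK ?ltnS ?leq_addr.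
by move: jd' jnd; lia.
Qed.

Let J_rel T : J T -> sqnorm (hlift (x T)) * ee.[T] = E (x T) * g.[T].
Proof.
move=> [N0 _]; rewrite /E hlift_x // sqnormZ E0_scale gE eeE; ring.
Qed.

Let J_rel' T : J T -> E (x T) * (ka * T ^+ d.*2) = sqnorm (hlift (x T)) * ee.[T] + E (x T) * r.[T].
Proof.
move=> JT; rewrite J_rel // /r hornerD hornerN hornerZ hornerXn; ring.
Qed.

Let J_psi T : J T -> psi1 (hlift (x T)) * T = psi0 (hlift (x T)).
Proof.
move=> [N0 _]; rewrite hlift_x // (formfun_scale _ _ fpsi0) (formfun_scale _ _ fpsi1) -mulrA.
by congr (_ * _); have := psi_phi (row2 T 1); rewrite -PhiE row2_0 row2_1 mulr1.
Qed.

(* [T] is integral over the functions that become regular on [S] after multiplication by a power of [E]: the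
   relation [J_rel'] bounds the power of [T] that is needed. *)
Let Red (F : R -> R) := exists k (a : 'I_(d.*2) -> 'rV[R]_m -> R),
  (forall i, polyfun (a i)) /\ forall T, J T -> E (x T) ^+ k * F T = \sum_i a i (x T) * T ^+ i.

Let Red_ext F F' : (forall T, J T -> F T = F' T) -> Red F -> Red F'.
Proof. by move=> FF [k [a [Pa aE]]]; exists k, a; split=> // T JT; rewrite -FF // aE. Qed.

Let RedD F F' : Red F -> Red F' -> Red (fun T => F T + F' T).
Proof.
move=> [k [a [Pa aE]]] [l [b [Pb bE]]].
exists (k + l)%N, (fun i y => E y ^+ l * a i y + E y ^+ k * b i y); split=> [i|T JT].
  by apply: polyfunD; apply: polyfunM => //; exact: polyfunX.
under eq_bigr do rewrite mulrDl -!mulrA.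
by rewrite big_split /= -!big_distrr /= -aE // -bE // exprD; ring.
Qed.

Let RedZ (c : 'rV[R]_m -> R) F : polyfun c -> Red F -> Red (fun T => c (x T) * F T).
Proof.
move=> Pc [k [a [Pa aE]]]; exists k, (fun i y => c y * a i y); split=> [i|T JT].
  exact: polyfunM.
by rewrite mulrCA aE // big_distrr; apply: eq_bigr => i _ /=; rewrite mulrA.
Qed.

Let RedE l F : Red (fun T => E (x T) ^+ l * F T) -> Red F.
Proof.
move=> [k [a [Pa aE]]]; exists (k + l)%N, a; split=> // T JT.
by rewrite -aE // exprD mulrA.
Qed.

Let Red_low (p : {poly R}) : (size p <= d.*2)%N -> Red (horner p).
Proof.
move=> pd; exists 0%N, (fun i _ => p`_i); split=> [i|T JT]; first exact: polyfun_cst.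
by rewrite mul1r (horner_coef_wide _ pd).
Qed.

Let Red_top : Red (fun T => T ^+ d.*2).
Proof.
apply: (@RedE 1); apply: (@Red_ext (fun T => ka^-1 *
   (sqnorm (hlift (x T)) * ee.[T] + E (x T) * r.[T]))).
  by move=> T JT; rewrite -J_rel' // expr1 mulrCA mulKf // gt_eqF.
apply: (RedZ (c := fun=> ka^-1)); first exact: polyfun_cst.
apply: RedD.
  apply: (RedZ (c := fun y => sqnorm (hlift y))); last exact: Red_low.
  by apply: polyfun_hlift; exact: polyfun_sqnorm.
by apply: (RedZ (c := E)); last exact: Red_low.
Qed.

Let RedX F : Red F -> Red (fun T => T * F T).
Proof.
move=> [k [a [Pa aE]]]; apply: (@RedE k).
apply: (@Red_ext (fun T => \sum_i a i (x T) * T ^+ i.+1)).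
  move=> T JT; rewrite mulrCA aE // big_distrr; apply: eq_bigr => i _ /=.
  by rewrite exprS; ring.
have low0 : Red (fun=> 0).
  by apply: (@Red_ext (horner 0)) => [T _|]; [rewrite horner0|apply: Red_low; rewrite size_poly0].
elim: (index_enum _) => [|i s IHs]; first by under eq_fun do rewrite big_nil.
under eq_fun do rewrite big_cons; apply: RedD => //; apply: RedZ => //.
have [id|id] := ltnP i.+1 d.*2; last first.
  by have -> : i.+1 = d.*2 by apply/eqP; rewrite eqn_leq id ltn_ord.
apply: (@Red_ext (horner 'X^(i.+1))) => [T _|]; first by rewrite hornerXn.
by apply: Red_low; rewrite size_polyXn.
Qed.

Let Red_poly (p : {poly R}) : Red (horner p).
Proof.
have R1 : Red (fun=> 1).
  have [d0|d0] := posnP d.*2.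
    by apply: (@Red_ext _ _ _ Red_top) => T _; rewrite d0 expr0.
  by apply: (@Red_ext (horner 1)) => [T _|]; [rewrite hornerC|apply: Red_low; rewrite size_poly1].
elim/poly_ind: p => [|p c IHp].
  by apply: (@Red_ext (horner 0)) => [//|]; apply: Red_low; rewrite size_poly0.
apply: (@Red_ext (fun T => T * p.[T] + c * 1)).
  by move=> T _; rewrite hornerD hornerM hornerX hornerC mulr1 mulrC.
by apply: RedD; [exact: RedX|apply: (RedZ (c := fun=> c)) => //; exact: polyfun_cst].
Qed.

Let n1 := d.*2.-1.
(** On [J] one has [psi1 T = psi0], and the reduction leaves the powers of [T] up to [n1 = 2 d - 1];
    this power of [psi1] turns all of them into polynomials. *)
Let c (y : 'rV[R]_m) := psi1 (hlift y) ^+ n1.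

Let Pc : polyfun c.
Proof. by apply: polyfunX; apply: polyfun_hlift; exact: formfun_polyfun fpsi1. Qed.

Let conductor (p : {poly R}) : exists k Q, polyfun Q /\
  forall T, J T -> E (x T) ^+ k * (c (x T) * p.[T]) = Q (x T).
Proof.
have [k [a [Pa aE]]] := Red_poly p.
exists k, (fun y => \sum_i a i y * (psi0 (hlift y) ^+ i * psi1 (hlift y) ^+ (n1 - i))); split.
  apply: polyfun_sum => i; apply: polyfunM => //; apply: polyfunM; apply: polyfunX; apply: polyfun_hlift.
    exact: formfun_polyfun fpsi0.
  exact: formfun_polyfun fpsi1.
move=> T JT; rewrite mulrCA aE // big_distrr; apply: eq_bigr => i _ /=.
rewrite -(J_psi JT) exprMn /c.
have {1}-> : n1 = (i + (n1 - i))%N.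
  by rewrite subnKC // -ltnS (leq_trans (ltn_ord i)) // /n1; case: (d.*2).
by rewrite exprD; ring.
Qed.

Hypothesis psi_neq0 : exists t, psi0 (phiv t) != 0 \/ psi1 (phiv t) != 0.

(** [C] is the conductor as a polynomial in the parameter, the denominators of [x] being cleared. It
    is nonzero because [psi1], and then [psi0], would otherwise vanish along all of [phi]. *)
Let exists_C : exists2 C : {poly R}, C != 0 &
  forall T, (N ord0).[T] != 0 -> C.[T] = (N ord0).[T] ^+ (e * n1) * c (x T).
Proof.
have [p pE] := polyfun_poly N (formfun_polyfun fpsi1).
exists (p ^+ n1); last first.
  move=> T N0; rewrite horner_exp pE /c hlift_x // (formfun_scale _ _ fpsi1) exprMn mulrA.
  by rewrite -exprM mulnC exprM -exprM exprVn mulnC mulfV ?mul1r // expf_neq0.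
rewrite expf_neq0 //; apply/eqP => p0; have [t] := psi_neq0.
have iR : infinite_set [set: R] by apply: sub_infinite_set (infinite_itvoo (@ltr01 R)).
have psi1_0 : forall t, psi1 (phiv t) = 0.
  apply: (form2_eq0 (formfun_phiv fphi fpsi1) iR) => T _.
  by rewrite -[\row_i _]/(phiv (row2 T 1)) -PhiE -[psi1 _]pE p0 horner0.
have psi0_0 : forall t, psi0 (phiv t) = 0.
  apply: (form2_eq0 (formfun_phiv fphi fpsi0) iR) => T _.
  by have := psi_phi (row2 T 1); rewrite psi1_0 mul0r row2_1 mulr1.
by rewrite psi0_0 psi1_0 eqxx => -[].
Qed.

Hypotheses (irr : sa_irreducible S) (dim1 : has_dim S 1) (cS : compact S).

Let ck (A : set 'rV[R]_m) (f : 'rV[R]_m -> R) : polyfun f -> {within A, continuous f}.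
Proof. by move=> Pf; apply: continuous_subspaceT; exact: polyfun_continuous. Qed.

Let S_bound : exists2 K, 0 <= K & forall y, S y -> sqnorm (hlift y) <= K.
Proof.
have Pn : polyfun (fun y : 'rV[R]_m => sqnorm (hlift y)) by apply: polyfun_hlift; exact: polyfun_sqnorm.
have [z _ zS] := compact_EVT_max irr.1 cS (ck Pn).
by exists (sqnorm (hlift z)) => [|y Sy]; [exact: sqnorm_ge0|apply: zS; rewrite inE].
Qed.

(** [E] has a positive minimum on the compact set [S], so in [J_rel'] the term in [T^(2 d)] would
    dominate the right-hand side, of lower degree in [T], for large [T]. *)
Let J_bound : exists B, forall T, J T -> `|T| <= B.
Proof.
have [K K0 SK] := S_bound.
have [z zS zE] := compact_EVT_min irr.1 cS (ck PE).
have Ez : 0 < E z by apply: E_gt0; move: zS; rewrite inE.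
case: (posnP d.*2) => [d0|d0].
  exists 0 => T JT; have := J_rel' JT; move: size_ee size_r; rewrite d0 !size_poly_leq0.
  move=> /eqP -> /eqP ->; rewrite !horner0 !mulr0 addr0 expr0 mulr1 => /eqP.
  by rewrite mulf_eq0 (gt_eqF ka0) orbF gt_eqF // E_gt0 //; case: JT.
have dS : d.*2 = n1.+1 by rewrite /n1 prednK.
have [|L1 L10 eeL] := @poly_growth _ ee n1; first by rewrite -dS.
have [|L2 L20 rL] := @poly_growth _ r n1; first by rewrite -dS.
exists (Num.max 1 ((K / E z * L1 + L2) / ka)) => T JT; rewrite le_max.
have [//|T1] := leP `|T| 1; rewrite /= ler_pdivlMr //.
have Tn : 0 < `|T| ^+ n1 by rewrite exprn_gt0 // (lt_trans ltr01).
have ES : 0 < E (x T) by apply: E_gt0; case: JT.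
have Ezx : E z <= E (x T) by apply: zE; rewrite inE; case: JT.
rewrite -(ler_pM2r Tn) -(ler_pM2l ES).
have -> : E (x T) * (`|T| * ka * `|T| ^+ n1) = `|E (x T) * (ka * T ^+ d.*2)|.
  by rewrite !normrM normrX dS exprS (gtr0_norm ka0) (gtr0_norm ES); ring.
rewrite J_rel' // (le_trans (ler_normD _ _)) // mulrDl mulrDr lerD //.
  rewrite normrM ger0_norm ?sqnorm_ge0 //.
  have -> : E (x T) * (K / E z * L1 * `|T| ^+ n1) = (E (x T) / E z * K) * (L1 * `|T| ^+ n1) by ring.
  apply: ler_pM; rewrite ?sqnorm_ge0 ?normr_ge0 //; last exact: eeL (ltW T1).
  apply: (le_trans (SK _ JT.2)); rewrite ler_peMl //.
  by rewrite ler_pdivlMr // mul1r.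
rewrite normrM (gtr0_norm ES) ler_pM2l //; exact: rL (ltW T1).
Qed.

Let x_continuous T : (N ord0).[T] != 0 -> {for T, continuous x}.
Proof.
move=> N0; apply: cvg_row => i.
rewrite (_ : (fun _ => _) = fun t => (N (lift ord0 i)).[t] / (N ord0).[t]).
  apply: continuousM; first exact: continuous_horner.
  by apply: continuousV => //; exact: continuous_horner.
by apply/funext => t; rewrite !mxE.
Qed.

(** Boundedness of [S] gives [N_i^2 <= K N_0^2] on [J], hence on its closure. There [N_0 = 0] would
    make all of [Phi] zero, so [x] is continuous at limit points, and [S] is closed. *)
Let J_closed : closed J.
Proof.
have [K K0 SK] := S_bound; move=> T JT.
have cN i : (N i).[T] ^+ 2 <= K * (N ord0).[T] ^+ 2.
  have cl : closed [set t | 0 <= (K *: N ord0 ^+ 2 - N i ^+ 2).[t]].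
    rewrite (_ : [set t | _] = horner (K *: N ord0 ^+ 2 - N i ^+ 2) @^-1` [set u | 0 <= u]) //.
    by apply: closed_comp => [t _|]; [exact: continuous_horner|exact: closed_ge].
  suff /closure_subset/(_ _ JT)/cl : J `<=` [set t | 0 <= (K *: N ord0 ^+ 2 - N i ^+ 2).[t]].
    by rewrite /= hornerD hornerN hornerZ !horner_exp subr_ge0.
  move=> t [N0 Sx] /=; rewrite hornerD hornerN hornerZ !horner_exp subr_ge0.
  have := le_trans (coord_sqnorm _ i) (SK _ Sx).
  rewrite hlift_x // !mxE exprMn exprVn mulrC ler_pdivrMr //.
  by rewrite exprn_even_gt0.
have N0 : (N ord0).[T] != 0.
  apply: contra (Phi_neq0 T) => /eqP N0; apply/eqP/rowP => i; rewrite !mxE.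
  have := cN i; rewrite N0 expr0n mulr0 => Ni; apply/eqP; rewrite -sqrf_eq0.
  by rewrite eq_le Ni sqr_ge0.
split=> //; have : closed S by apply: compact_closed => //; exact: norm_hausdorff.
apply=> B xB; have [t [[t0 Sx] tB]] := JT _ (x_continuous N0 xB).
by exists (x t).
Qed.

Let J_compact : compact J.
Proof.
have [B JB] := J_bound.
apply: (@subclosed_compact _ _ `[- B, B]); [exact: J_closed|exact: segment_compact|].
by move=> T /JB; rewrite /= in_itv /= ler_norml.
Qed.

(* [sigma] is a square root of 1 modulo [C] and has the sign of [T - t0] on [J]: if [J] met both sides of [t0]
   outside the zeros of [C], the Nash functions [c E^k (|sigma| - sigma)] and [c E^k (|sigma| + sigma)] would be
   zero divisors. *)
Let one_sided (C : {poly R}) t0 :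
  (forall T, (N ord0).[T] != 0 -> C.[T] = (N ord0).[T] ^+ (e * n1) * c (x T)) ->
  ~ J t0 -> C.[t0] != 0 ->
  (forall T, J T -> C.[T] != 0 -> t0 < T) \/ (forall T, J T -> C.[T] != 0 -> T < t0).
Proof.
move=> CE Jt0 Ct0; have [C1 [C2 [CC co r1 r2]]] := split_roots Ct0.
have [[u v] /= uv] := Bezout_eq1_coprimepP _ _ co.
(* By Bezout, [a] is 1 modulo [C1] and -1 modulo [C2], so [a^2] is 1 modulo [C]. Adding multiples of
   [b] keeps these residues and pushes towards the sign of [T - t0]. *)
pose a := v * C2 - u * C1; pose b := C ^+ 2 * ('X - t0%:P).
have bE T : b.[T] = C.[T] ^+ 2 * (T - t0) by rewrite hornerM horner_exp hornerXsubC.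
have uvE T : u.[T] * C1.[T] + v.[T] * C2.[T] = 1.
  by rewrite -!hornerM -hornerD uv hornerC.
have aE T : a.[T] = v.[T] * C2.[T] - u.[T] * C1.[T] by rewrite hornerD hornerN !hornerM.
have Tt0 T : J T -> T != t0 by move=> JT; apply: contra_notN Jt0 => /eqP <-.
have b0 T : J T -> b.[T] = 0 -> C1.[T] = 0 \/ C2.[T] = 0.
  move=> /Tt0 T0 /eqP; rewrite bE mulf_eq0 subr_eq0 (negbTE T0) orbF expf_eq0 /= CC hornerM.
  by rewrite mulf_eq0 => /orP[/eqP|/eqP]; [left|right].
have [|||la1 H1] := @positive_combination _ (J `&` [set T | t0 <= T]) a b.
- by apply: compact_closedI => //; exact: closed_ge.
- by move=> T [_ /= T0]; rewrite bE mulr_ge0 ?sqr_ge0 // subr_ge0.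
- move=> T [JT /= T0] /(b0 T JT)[C10|/r2]; last by rewrite ltNge T0.
  by rewrite aE; have := uvE T; rewrite C10 !mulr0 add0r subr0 => ->.
have [|||la2 H2] := @positive_combination _ (J `&` [set T | T <= t0]) (- a) (- b).
- by apply: compact_closedI => //; exact: closed_le.
- by move=> T [_ /= T0]; rewrite hornerN bE -mulrN mulr_ge0 ?sqr_ge0 // oppr_ge0 subr_le0.
- move=> T [JT /= T0]; rewrite hornerN => /eqP; rewrite oppr_eq0 => /eqP /(b0 T JT)[/r1|C20].
    by rewrite ltNge T0.
  by rewrite hornerN aE; have := uvE T; rewrite C20 !mulr0 addr0 sub0r opprK => ->.
pose la := Num.max la1 la2; pose sg := a + la *: b.
have sg_gt T : J T -> t0 < T -> 0 < sg.[T].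
  by move=> JT T0; apply: H1; [rewrite le_max lexx|split=> //=; exact: ltW].
have sg_lt T : J T -> T < t0 -> sg.[T] < 0.
  move=> JT T0; have : 0 < (- a + la *: - b).[T].
    by apply: H2; [rewrite le_max lexx orbT|split=> //=; exact: ltW].
  by rewrite scalerN -opprD hornerN oppr_gt0.
have sg_neq0 T : J T -> sg.[T] != 0.
  move=> JT; have := Tt0 T JT; rewrite neq_lt => /orP[/(sg_lt T JT)|/(sg_gt T JT)].
    by move/lt_eqF ->.
  exact: lt0r_neq0.
(* The quotient of [sg^2 - 1] by [C]; the first term comes from
   [a^2 = (u C1 + v C2)^2 - 4 u v C1 C2]. *)
pose q1 := - (4 *: (u * v)) + (2 * la) *: (a * C * ('X - t0%:P)) + (la ^+ 2) *: (C ^+ 3 * ('X - t0%:P) ^+ 2).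
have sg2 T : sg.[T] ^+ 2 = 1 + C.[T] * q1.[T].
  rewrite /sg /q1 /a /b CC !(hornerD, hornerZ, hornerN, hornerM, horner_exp, hornerX, hornerC).
  have := uvE T; move: u.[T] v.[T] C1.[T] C2.[T] => U V D1 D2 e1.
  have e2 : (U * D1 + V * D2) ^+ 2 = 1 by rewrite e1 expr1n.
  rewrite -[X in _ = X + _]e2; ring.
(* [C] is [c] times this power of [N ord0], so [C q1] is [c] times a polynomial in [T] and descends
   to [S]. *)
have [k1 [Q1 [PQ1 Q1E]]] := conductor (N ord0 ^+ (e * n1) * q1).
have [k2 [Q2 [PQ2 Q2E]]] := conductor sg.
have Cq T : J T -> E (x T) ^+ k1 * (C.[T] * q1.[T]) = Q1 (x T).
  move=> JT; rewrite -Q1E // hornerM horner_exp CE; last by case: JT.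
  by ring.
(* At [x T], [B] is the square of [E^k1 sg], and [A] is [P] times [E^k1 sg]; thus [P sqrt B] is [A]
   or [-A] according to the sign of [sg]. *)
pose P y := c y * E y ^+ k2; pose B y := E y ^+ k1 * (E y ^+ k1 + Q1 y).
pose A y := E y ^+ k1 * Q2 y.
have BE T : J T -> B (x T) = (E (x T) ^+ k1 * sg.[T]) ^+ 2.
  by move=> JT; rewrite /B -Cq // exprMn sg2; ring.
have AE T : J T -> A (x T) = P (x T) * (E (x T) ^+ k1 * sg.[T]).
  by move=> JT; rewrite /A -Q2E // /P; ring.
have Eg T : J T -> 0 < E (x T) by move=> JT; apply: E_gt0; case: JT.
have P_neq0 T : J T -> C.[T] != 0 -> P (x T) != 0.
  move=> JT CT; apply: mulf_neq0; last by rewrite expf_neq0 // gt_eqF // Eg.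
  by apply: contra CT => /eqP c0; rewrite CE ?c0 ?mulr0 //; case: JT.
have [|||||H|H] := irreducible_sign irr dim1 (P := P) (A := A) (B := B).
- by apply: polyfunM => //; exact: polyfunX.
- by apply: polyfunM => //; exact: polyfunX.
- by apply: polyfunM; [exact: polyfunX|apply: polyfunD => //; exact: polyfunX].
- move=> y /J_cover[T JT <-]; rewrite BE // exprn_even_gt0 //= mulf_neq0 ?sg_neq0 //.
  by rewrite expf_neq0 // gt_eqF // Eg.
- by move=> y /J_cover[T JT <-]; rewrite BE // AE // -exprMn.
- left=> T JT CT; have := H (x T) JT.2; rewrite BE // AE // sqrtr_sqr.
  have P0 := P_neq0 T JT CT.
  move=> /(mulfI P0); rewrite normrM normrX (gtr0_norm (Eg T JT)) => /mulfI.
  rewrite expf_neq0 ?gt_eqF ?Eg // => /(_ isT) sT.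
  have := Tt0 T JT; rewrite neq_lt => /orP[/(sg_lt T JT)|//].
  by rewrite -sT ltNge normr_ge0.
- right=> T JT CT; have := H (x T) JT.2; rewrite BE // AE // sqrtr_sqr -mulrN.
  have P0 := P_neq0 T JT CT.
  move=> /(mulfI P0); rewrite normrM normrX (gtr0_norm (Eg T JT)) -mulrN => /mulfI.
  rewrite expf_neq0 ?gt_eqF ?Eg // => /(_ isT) sT.
  have := Tt0 T JT; rewrite neq_lt => /orP[//|/(sg_gt T JT)].
  by rewrite -oppr_lt0 -sT ltNge normr_ge0.
Qed.

(** Near any of its points [S] has a coordinate with infinitely many values, so the images of
    finitely many parameters cannot fill a neighbourhood. *)
Let finite_image_dense (A : set R) (Z : set 'rV[R]_m) : closed Z -> finite_set A ->
  (forall y, S y -> Z y \/ exists2 T, A T & y = x T) -> S `<=` Z.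
Proof.
move=> cZ fA SZ y Sy; apply: contrapT => Zy.
have /nbhs_ballP[d0 /= d00 Hd] : nbhs y (~` Z) by apply: open_nbhs_nbhs; split=> //; exact: closed_openC.
have [k] := irreducible_infinite irr dim1 Sy d00; apply.
apply: (@sub_finite_set _ _ ((fun T => x T ord0 k) @` A)); last exact: finite_image.
move=> _ [z [Sz zb] <-]; have [Zz|[T AT ->]] := SZ z Sz; last by exists T.
by have := Hd z zb.
Qed.

Lemma affine_regular_image : regular_image S (@closed_ball1 R 1).
Proof.
have [C C0 CE] := exists_C; have fC := finite_roots C0.
pose J' := [set T | J T /\ C.[T] != 0].
have JC T : J T -> ~ J' T -> C.[T] = 0.
  by move=> JT nT; apply/eqP/negPn/negP => CT; apply: nT.
have J'0 : J' !=set0.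
  apply: contrapT => J'0; have [y Sy] := irr.1.
  suff : S `<=` set0 by move/(_ y Sy).
  apply: (finite_image_dense closed0 fC) => z /J_cover[T JT <-].
  by right; exists T => //=; apply: JC => // J'T; apply: J'0; exists T.
have [Bd JB] := J_bound.
have lbJ : has_lbound J' by exists (- Bd) => T [/JB]; rewrite ler_norml => /andP[].
have ubJ : has_ubound J' by exists Bd => T [/JB]; rewrite ler_norml => /andP[].
pose al := inf J'; pose be := sup J'.
have J'J : J' `<=` J by move=> T [].
have Jbe : J be by apply/J_closed/(closure_subset J'J); exact: closure_sup.
have Jal : J al.
  apply/J_closed => B /nbhs_ballP[de /= de0 Hde].
  have [T J'T Tal] := inf_lt J'0 (etrans (ltrDl al de) de0).
  exists T; split; first exact: J'J.
  apply: Hde; rewrite /ball /= distrC ger0_norm ?subr_ge0 ?ge_inf //.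
  by rewrite ltrBlDl.
have J'ab T : J' T -> al <= T <= be.
  by move=> J'T; rewrite (ge_inf lbJ J'T) (sup_upper_bound (conj J'0 ubJ) J'T).
(* A gap of the closed set [J] between [al] and [be] contains some [t0] with [C(t0) != 0]; by
   [one_sided], [J'] would lie on one side of it, against [al] and [be] being its infimum and
   supremum. *)
have Jab T : al <= T <= be -> J T.
  move=> /andP[aT Tb]; apply: contrapT => JT.
  have {}Tb : T < be by rewrite lt_neqAle Tb andbT; apply/eqP => e1; apply: JT; rewrite e1.
  have {}aT : al < T by rewrite lt_neqAle aT andbT; apply/eqP => e1; apply: JT; rewrite -e1.
  have /nbhs_ballP[de /= de0 Hde] : nbhs T (~` J) by apply: open_nbhs_nbhs; split=> //; exact: closed_openC.
  have Tm : T < Num.min (T + de) be by rewrite lt_min Tb ltrDl de0.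
  have [t0 [/= /andP[Tt0]]] := infinite_setN0 (infinite_setD (infinite_itvoo Tm) fC).
  rewrite lt_min => /andP[t0d t0b] /eqP Ct0.
  have Jt0 : ~ J t0 by apply: Hde; rewrite /ball /= ltr0_norm ?subr_lt0 // opprB ltrBlDl.
  have [H|H] := one_sided CE Jt0 Ct0.
    have [T' [JT' CT'] T't0] := inf_lt J'0 (lt_trans aT Tt0).
    by have := H T' JT' CT'; rewrite ltNge (ltW T't0).
  have [T' [JT' CT'] T't0] := sup_gt J'0 t0b.
  by have := H T' JT' CT'; rewrite ltNge (ltW T't0).
have ab : al <= be by have [T /J'ab/andP[aT /(le_trans aT)]] := J'0.
pose I := [set T | al <= T <= be].
have cI : compact (x @` I).
  apply: continuous_compact.
    apply/subspace_continuousP => T /Jab[N0 _].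
    by apply: cvg_trans (x_continuous N0); exact: cvg_app (@cvg_within _ _ _ _).
  rewrite (_ : I = `[al, be]%classic); first exact: segment_compact.
  by apply/seteqP; split=> T; rewrite /= in_itv.
have SI : S = x @` I.
  apply/seteqP; split; last by move=> _ [T /Jab[_ Sx] <-].
  apply: (@finite_image_dense _ _ _ fC); first by apply: compact_closed => //; exact: norm_hausdorff.
  move=> y /J_cover[T JT <-]; have [J'T|J'T] := pselect (J' T).
    by left; exists T => //; exact: J'ab.
  by right; exists T => //=; exact: JC.
(* The affine map of [[-1, 1]] onto [[al, be]]; it is constant when [al = be], a case treated apart
   below. *)
pose L (z : 'rV[R]_1) := (al + be) / 2 + (be - al) / 2 * z ord0 ord0.
have PL : polyfun L.
  apply: polyfunD; first exact: polyfun_cst.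
  by apply: polyfunM; [exact: polyfun_cst|exact: polyfun_coord].
have /choice[G GE] : forall i, exists G : mpol R 1, forall z, mev G z = (N i).[L z].
  by move=> i; exact: polyfun_horner.
have LI z : closed_ball1 z -> I (L z).
  rewrite /closed_ball1 /= /sqnorm big_ord1 /L; move: (z ord0 ord0) => z0 z1.
  have /andP[zl zr] : -1 <= z0 <= 1 by rewrite -ler_norml -sqr_norm_le1.
  have bl : 0 <= (be - al) * (1 + z0) by rewrite mulr_ge0 ?subr_ge0 //; lra.
  have br : 0 <= (be - al) * (1 - z0) by rewrite mulr_ge0 ?subr_ge0 //; lra.
  by apply/andP; split; lra.
have h0 z : closed_ball1 z -> mev (G ord0) z != 0.
  by move=> /LI/Jab[N0 _]; rewrite GE.
exists (fun j => G (lift ord0 j)), (fun=> G ord0); split.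
  move=> _; have /h0 : closed_ball1 (0 : 'rV[R]_1) by rewrite /closed_ball1 /= /sqnorm big_ord1 mxE expr0n.
  by apply: contraNneq => ->; rewrite /mev mpoly.meval0.
split; first by move=> _; exact: h0.
have xL z : rat_eval (fun j => G (lift ord0 j)) (fun=> G ord0) z = x (L z).
  by apply/rowP => j; rewrite !mxE !GE.
rewrite SI; apply/seteqP; split=> [_ [T /andP[aT Tb] <-]|_ [z /LI LIz <-]]; last first.
  by exists (L z).
have [be_al|ab0] := eqVneq al be.
  exists 0; first by rewrite /closed_ball1 /= /sqnorm big_ord1 mxE expr0n.
  rewrite xL /L mxE mulr0 addr0 -be_al; congr x.
  by apply/eqP; rewrite eq_le; apply/andP; split; lra.
have ba : 0 < be - al by rewrite subr_gt0 lt_neqAle ab0.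
exists (\row__ ((2 * T - al - be) / (be - al))).
  rewrite /closed_ball1 /= /sqnorm big_ord1 mxE sqr_norm_le1 ler_norml.
  by rewrite ler_pdivlMr // ler_pdivrMr //; apply/andP; split; lra.
rewrite xL /L mxE; congr x; field; exact: lt0r_neq0.
Qed.

End Affine.

(** * From a rational parametrization to a regular image of the interval *)

Section Converse.
Variables (R : realType) (m : nat) (S : set 'rV[R]_m).

Lemma dehomZ (c : R) (v : 'rV[R]_m.+1) i : c != 0 -> dehom i (c *: v) = dehom i v.
Proof.
move=> c0; apply/rowP => j; rewrite !mxE; have [->|v0] := eqVneq (v ord0 i) 0.
  by rewrite mulr0 invr0 !mulr0.
by field; rewrite c0 v0.
Qed.

(** The directions [(1 - s^2 : 2 s)] with [|s| <= 1] fill the projective line: the difference of the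
    two sides is [2 t0] at [s = -1] and [-2 t0] at [s = 1]. *)
Lemma half_angle (t0 t1 : R) : exists2 s, `|s| <= 1 & (1 - s ^+ 2) * t1 = 2 * s * t0.
Proof.
wlog t00 : t0 t1 / t0 <= 0.
  move=> H; have [|t00] := leP t0 0; first exact: H.
  have [|s s1 sE] := H (- t0) (- t1); first by rewrite oppr_le0 ltW.
  by exists s => //; move: sE; rewrite !mulrN => /oppr_inj.
pose p : {poly R} := t1 *: (1 - 'X^2) - (2 * t0) *: 'X.
have pE s : p.[s] = (1 - s ^+ 2) * t1 - 2 * s * t0 by rewrite !hornerE; ring.
have [||s sI /rootP] := @poly_ivt _ p (-1) 1; first by lra.
  by rewrite !pE sqrrN expr1n; apply/andP; split; lra.
by rewrite pE => /eqP; rewrite subr_eq0 => /eqP sE; exists s => //; rewrite ler_norml.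
Qed.

Hypotheses (irr : sa_irreducible S) (dim1 : has_dim S 1) (cS : compact S).

Lemma rational_regular_image :
  real_rational_curve (proj_zar_closure S) -> regular_image S (@closed_ball1 R 1).
Proof.
move=> [_ [_ [d [phi [hphi [phi0 [_ [C1 [e [P0 [P1 [h0 [h1 [[tp ptp] pp]]]]]]]]]]]]]].
have fphi i : formfun d (mev (phi i)) by exact: formfun_mev.
have S_phi x : S x -> exists2 t : 'rV[R]_2, t != 0 & exists la, hlift x = la *: hev phi t.
  by move=> Sx; apply: C1; exact: hlift_local.
have I1 : (1 : 'I_2) = ord_max by exact: val_inj.
have hevZ c t : hev phi (c *: t) = c ^+ d *: hev phi t.
  by apply/rowP => i; rewrite !mxE (formfun_scale _ _ (fphi i)).
have [[u [u0 Hu]]|Hn] := pselect (exists u : 'rV[R]_2, u != 0 /\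
    forall x la, S x -> hlift x <> la *: hev phi u); last first.
  (* No direction is missing, so [S] is the image of the whole projective line, which the half-angle
     map covers from [[-1, 1]]. *)
  have all_u (u : 'rV[R]_2) : u != 0 -> S (dehom ord0 (hev phi u)) /\ mev (phi ord0) u != 0.
    move=> u0; apply: contrapT => nu; apply: Hn; exists u; split=> // x la Sx xE; apply: nu.
    have la0 : la != 0.
      by apply/eqP => la0; have := hlift_neq0 x; rewrite xE la0 scale0r eqxx.
    rewrite -(dehomZ _ _ la0) -xE dehom_hlift; split=> //.
    have : hlift x ord0 ord0 != 0 by rewrite hlift0 oner_eq0.
    by rewrite xE !mxE mulf_eq0 negb_or => /andP[].
  pose ts (s : R) := row2 (1 - s ^+ 2) (2 * s).
  have ts0 s : ts s != 0.
    apply/eqP => e1; have := congr1 (fun v : 'rV[R]_2 => v ord0 ord0) e1.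
    have := congr1 (fun v : 'rV[R]_2 => v ord0 ord_max) e1.
    rewrite /ts row2_0 row2_1 !mxE => /eqP; rewrite mulf_eq0 pnatr_eq0 /= => /eqP ->.
    by rewrite expr0n subr0 => /eqP; rewrite oner_eq0.
  have /choice[G GE] : forall i, exists G : mpol R 1, forall z, mev G z = mev (phi i) (ts (z ord0 ord0)).
    move=> i; apply: (polyfun_comp (polyfun_mev (phi i))) => l.
    have Pc := @polyfun_coord R 1 ord0.
    have P1' : polyfun (fun z : 'rV[R]_1 => 1 - z ord0 ord0 ^+ 2).
      by apply: polyfunB; [exact: polyfun_cst|exact: polyfunX].
    have P2' : polyfun (fun z : 'rV[R]_1 => 2 * z ord0 ord0).
      by apply: polyfunM => //; exact: polyfun_cst.
    under eq_fun do rewrite mxE.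
    by case: (l == ord0).
  have G0 z : mev (G ord0) z != 0 by rewrite GE; case: (all_u _ (ts0 (z ord0 ord0))).
  exists (fun j => G (lift ord0 j)), (fun=> G ord0); split.
    by move=> _; apply: contraNneq (G0 0) => ->; rewrite /mev mpoly.meval0.
  split=> //.
  have rE z : rat_eval (fun j => G (lift ord0 j)) (fun=> G ord0) z = dehom ord0 (hev phi (ts (z ord0 ord0))).
    by apply/rowP => j; rewrite !mxE !GE.
  apply/seteqP; split=> [x Sx|_ [z _ <-]]; last by rewrite rE; case: (all_u _ (ts0 (z ord0 ord0))).
  have [t t0 [la xE]] := S_phi x Sx.
  have [s s1 sE] := half_angle (t ord0 ord0) (t ord0 ord_max).
  have [mu tE] : exists mu, t = mu *: ts s.
    have [s0|s0] := eqVneq (1 - s ^+ 2) 0.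
      have s20 : s != 0.
        by apply/eqP => s00; move/eqP: s0; rewrite s00 expr0n subr0 oner_eq0.
      exists (t ord0 ord_max / (2 * s)); rewrite [LHS]row2_eta; apply/rowP => l; rewrite !mxE.
      case: ifP => _; last by rewrite divfK // mulf_neq0 // pnatr_eq0.
      move/eqP: sE; rewrite s0 mul0r eq_sym mulf_eq0 mulf_eq0 pnatr_eq0 (negbTE s20) /= => /eqP ->.
      by rewrite mulr0.
    exists (t ord0 ord0 / (1 - s ^+ 2)); rewrite [LHS]row2_eta; apply/rowP => l; rewrite !mxE.
    case: ifP => _; first by rewrite divfK.
    by apply: (mulfI s0); rewrite sE; field.
  exists (\row__ s).
    by rewrite /closed_ball1 /= /sqnorm big_ord1 mxE sqr_norm_le1.
  rewrite rE mxE -[RHS]dehom_hlift xE tE hevZ scalerA dehomZ //.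
  apply/eqP => c0; have := hlift_neq0 x; rewrite xE tE hevZ scalerA c0 scale0r eqxx //.
(* Multiplication by [u] as a complex number, which moves the direction [(1 : 0)] to the missing
   direction [u]. Accordingly, the inverse map is multiplied by the conjugate of [u] below. *)
pose lin (s : 'rV[R]_2) : 'rV[R]_2 := row2 (s ord0 ord0 * u ord0 ord0 - s ord0 ord_max * u ord0 ord_max)
  (s ord0 ord0 * u ord0 ord_max + s ord0 ord_max * u ord0 ord0).
pose un := u ord0 ord0 ^+ 2 + u ord0 ord_max ^+ 2.
have un0 : un != 0.
  rewrite /un paddr_eq0 ?sqr_ge0 // !sqrf_eq0; apply: contra u0 => /andP[/eqP e0 /eqP e1].
  by rewrite [u]row2_eta e0 e1; apply/eqP/rowP => l; rewrite !mxE; case: ifP.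
have flin l : formfun 1 (fun s : 'rV[R]_2 => lin s ord0 l).
  have fZ (c : R) k : formfun 1 (fun s : 'rV[R]_2 => s ord0 k * c).
    by under eq_fun do rewrite mulrC; apply: formfunZ; exact: formfun_coord.
  under eq_fun do rewrite mxE.
  by case: (l == ord0); [exact: formfunB|exact: formfunD].
have lin_onto t : exists s, lin s = t.
  exists (row2 ((t ord0 ord0 * u ord0 ord0 + t ord0 ord_max * u ord0 ord_max) / un)
    ((t ord0 ord_max * u ord0 ord0 - t ord0 ord0 * u ord0 ord_max) / un)).
  rewrite [RHS]row2_eta /lin !row2_0 !row2_1; apply/rowP => l; rewrite !mxE.
  by case: ifP => _; rewrite /un; field; exact: un0.
have lin0 s : s != 0 -> lin s != 0.
  apply: contraNneq => /rowP e1; have := e1 ord0; have := e1 ord_max.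
  rewrite /lin row2_0 row2_1 !mxE => e11 e10.
  have s0 : un * s ord0 ord0 = u ord0 ord0 * 0 + u ord0 ord_max * 0 by rewrite -{1}e10 -e11 /un; ring.
  have s1 : un * s ord0 ord_max = u ord0 ord0 * 0 - u ord0 ord_max * 0 by rewrite -{1}e11 -e10 /un; ring.
  rewrite !mulr0 ?addr0 in s0; rewrite !mulr0 ?subr0 in s1.
  move/eqP: s0; rewrite mulf_eq0 (negbTE un0) => /eqP s0.
  move/eqP: s1; rewrite mulf_eq0 (negbTE un0) => /eqP s1.
  by rewrite [s]row2_eta s0 s1; apply/eqP/rowP => l; rewrite !mxE; case: ifP.
have linu : lin (row2 1 0) = u.
  by rewrite [RHS]row2_eta /lin row2_0 row2_1 !mul0r !mul1r subr0 addr0.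
pose phi' i s := mev (phi i) (lin s).
have fphi' i : formfun d (phi' i).
  by rewrite -[d]mul1n; apply: formfun_comp (fphi i) flin.
have [N NP] : exists N : 'I_m.+1 -> {poly R}, forall i, [/\ (size (N i) <= d.+1)%N,
    forall T, (N i).[T] = phi' i (row2 T 1) & (N i)`_d = phi' i (row2 1 0)].
  by have [N NP] := choice (fun i => form_poly (fphi' i)); exists N.
have fP0 := formfun_mev h0; have fP1 := formfun_mev h1.
apply: (@affine_regular_image R m S d e phi'
  (fun v => mev P0 v * u ord0 ord0 + mev P1 v * u ord0 ord_max)
  (fun v => mev P1 v * u ord0 ord0 - mev P0 v * u ord0 ord_max) fphi' _ _ _ _ _ _ N) => //.
- by move=> t t0; exact: (phi0 _ (lin0 _ t0)).
- by apply: formfunD; rewrite -[e]addn0; apply: formfunM => //; exact: formfun_cst.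
- by apply: formfunB; rewrite -[e]addn0; apply: formfunM => //; exact: formfun_cst.
- move=> t; have := pp (lin t); rewrite I1 /lin row2_0 row2_1 -/(lin t).
  rewrite -[\row_i phi' i t]/(hev phi (lin t)).
  move: (mev P0 _) (mev P1 _) => a b; lra.
- move=> x Sx; have [t t0 [la xE]] := S_phi x Sx; have [s sE] := lin_onto t.
  exists s; last by exists la; rewrite xE -sE.
  apply: contraNneq t0 => s0; rewrite -sE s0 /lin !mxE !mul0r subr0 addr0.
  by apply/eqP/rowP => l; rewrite !mxE; case: ifP.
- by move=> x la Sx; rewrite -[\row_i _]/(hev phi (lin (row2 1 0))) linu; exact: Hu.
- by move=> i; case: (NP i).
- by move=> i T; case: (NP i).
- by move=> i; case: (NP i).
- have [s sE] := lin_onto tp; exists s; rewrite -[\row_i _]/(hev phi (lin s)) sE.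
  move: ptp; move: (mev P0 _) (mev P1 _) => a b ab.
  apply: contrapT => /not_orP[/negP/negPn/eqP e0 /negP/negPn/eqP e1].
  have aun : a * un = u ord0 ord0 * 0 - u ord0 ord_max * 0 by rewrite -{1}e0 -e1 /un; ring.
  have bun : b * un = u ord0 ord_max * 0 + u ord0 ord0 * 0 by rewrite -{1}e0 -e1 /un; ring.
  rewrite !mulr0 ?subr0 in aun; rewrite !mulr0 ?addr0 in bun.
  move/eqP: aun; rewrite mulf_eq0 (negbTE un0) orbF => /eqP a0.
  move/eqP: bun; rewrite mulf_eq0 (negbTE un0) orbF => /eqP b0.
  by case: ab; rewrite ?a0 ?b0 eqxx.
Qed.

End Converse.

(* The equivalence of the nine conditions *)
Local Close Scope ring_scope.

(** Projection of the sphere onto the ball, and the passage from regular to regulous, make every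
    image condition imply that [S] is a regulous image of some sphere. That one leads to the
    rational curve, and the curve back to a regular image of the interval. *)
Theorem theorem1p6 (R : realType) (m : nat) (S : set 'rV[R]_m) :
  semialgebraic S -> has_dim S 1 ->
  [<-> inf_eq (rB_set S) 1;
       inf_finite (rB_set S);
       inf_eq (rsB_set S) 1;
       inf_finite (rsB_set S);
       inf_eq (rS_set S) 1;
       inf_finite (rS_set S);
       inf_eq (rsS_set S) 1;
       inf_finite (rsS_set S);
       sa_irreducible S /\ compact S /\
       real_rational_curve (proj_zar_closure S)].
Proof.
move=> _ dim1.
have inf1 (P : nat -> Prop) : P 1 -> inf_eq P 1 by [].
have fin (P : nat -> Prop) : inf_eq P 1 -> inf_finite P by move=> [_ [P1 _]]; exists 1.
have to_curve : inf_finite (rsS_set S) -> sa_irreducible S /\ compact S /\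
    real_rational_curve (proj_zar_closure S).
  move=> [[|n] [//_ im]].
  have [cS Sne [S0 [S0S dS conn]]] := regulous_sphere im.
  split; first exact: rat_connected_irreducible dS Sne conn.
  by split=> //; exact: rational_closure dS Sne conn dim1.
have to_ball : inf_finite (rsS_set S) -> rB_set S 1.
  by move=> /to_curve[irr [cS rat]]; exact: rational_regular_image.
have rS_rsS : inf_finite (rS_set S) -> inf_finite (rsS_set S).
  by move=> [n [n1 im]]; exists n; split=> //; exact: regular_regulous.
have rsB_rsS : inf_finite (rsB_set S) -> inf_finite (rsS_set S).
  by move=> [n [n1 im]]; exists n; split=> //; exact: regulous_ball_sphere.
have rB_rsB : inf_finite (rB_set S) -> inf_finite (rsB_set S).
  by move=> [n [n1 im]]; exists n; split=> //; exact: regular_regulous.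
tfae.
- exact: fin.
- by move=> /rB_rsB/rsB_rsS/to_ball/regular_regulous im; exact: inf1.
- exact: fin.
- by move=> /rsB_rsS/to_ball/regular_ball_sphere im; exact: inf1.
- exact: fin.
- by move=> /rS_rsS/to_ball/regular_ball_sphere/regular_regulous im; exact: inf1.
- exact: fin.
- exact: to_curve.
- by move=> [irr [cS rat]]; apply: inf1; exact: rational_regular_image.
Qed.
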